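(* Assume $X$ has finite variation, i.e. $\sigma=0$ and $\int_{|x|\le1}|x|\nu(dx)<\infty$, and that $d_+>0$. Then $$\lim_{t\to T}\frac{1}{T-t}\Big(\frac{K}{b(t)}-1\Big)=\int(e^y-1)_-\,\nu(dy).$$
   Context: Let $X$ be a real Lévy process with characteristic triplet $(\sigma^2,\gamma,\nu)$; $(\mathcal F_t)$ the usual augmentation of its natural filtration. Fix $T>0$, $K>0$, $r>0$, $\delta\ge0$. Assume $\int_{|x|\ge1}e^x\nu(dx)<\infty$ and $\frac{\sigma^2}{2}+\gamma+\int(e^x-1-x\mathbf 1_{|x|\le1})\nu(dx)=0$, and the non-degeneracy condition: $\sigma\neq0$, or $\nu((-\infty,0))>0$, or $\int_{(0,\infty)}(x\wedge1)\nu(dx)=\infty$. For $x\ge0$ let $S^x_t=xe^{(r-\delta)t+X_t}$; $P(t,x)=\sup_{\tau\in\mathcal T_{0,T-t}}\mathbb E[e^{-r\tau}(K-S^x_\tau)_+]$ (American put, $\mathcal T_{0,s}$ = stopping times in $[0,s]$), and $b(t)=\inf\{x\ge0:P(t,x)>(K-x)_+\}$, $t\in[0,T)$, its critical price. Let $d_+=r-\delta-\int(e^y-1)_+\nu(dy)$, and $(u)_-=\max(-u,0)$. *)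

(* Defs.v *)
From HB Require Import structures.
From mathcomp Require Import all_boot all_order all_algebra.
From mathcomp Require Import all_classical all_reals all_analysis.
Set Implicit Arguments. Unset Strict Implicit. Unset Printing Implicit Defensive.
Import Order.TTheory GRing.Theory Num.Theory.
Import numFieldNormedType.Exports.
Local Open Scope classical_set_scope.
Local Open Scope ring_scope.

Definition levy_measure (R : realType) (nu : {measure set R -> \bar R}) : Prop :=
  nu [set 0] = 0%E /\
  (\int[nu]_x (Num.min (x ^+ 2) 1)%:E < +oo)%E.

(* real and imaginary parts of the Lévy-Khintchine exponent
   psi(u) = i gamma u - sigma^2 u^2/2 + int (e^{iux} - 1 - iux 1_{|x|<=1}) nu(dx)
   (the integrals are finite for a Lévy measure, so [fine] is harmless). *)
Definition Re_psi (R : realType) (sigma gamma : R) (nu : {measure set R -> \bar R})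
  (u : R) : R :=
  - (sigma ^+ 2 * u ^+ 2) / 2 + fine (\int[nu]_x (cos (u * x) - 1)%:E).

Definition Im_psi (R : realType) (sigma gamma : R) (nu : {measure set R -> \bar R})
  (u : R) : R :=
  gamma * u +
  fine (\int[nu]_x (sin (u * x) - u * x * (if `|x| <= 1 then 1 else 0))%:E).

Definition cadlag (R : realType) (f : R -> R) : Prop :=
  forall t, 0 <= t -> (f @ t^'+ --> f t) /\ (0 < t -> cvg (f @ t^'-)).

(* X is a Lévy process on (Omega, P) with characteristic triplet
   (sigma^2, gamma, nu):  X_0 = 0 a.s., a.s. càdlàg paths, independent
   increments, and E[e^{iuX_t}] = e^{t psi(u)} (written as real and
   imaginary parts). *)
Definition is_levy_process (R : realType) (d : measure_display)
  (Omega : measurableType d) (P : probability Omega R) (X : R -> Omega -> R)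
  (sigma gamma : R) (nu : {measure set R -> \bar R}) : Prop :=
  levy_measure nu /\
  (forall t, measurable_fun setT (X t)) /\
  {ae P, forall w, X 0 w = 0} /\
  {ae P, forall w, cadlag (fun t => X t w)} /\
  (forall (n : nat) (tt : nat -> R) (B : nat -> set R),
      0 <= tt 0%N -> (forall i, tt i <= tt i.+1) -> (forall i, measurable (B i)) ->
      P [set w | forall i, (i < n)%N -> B i (X (tt i.+1) w - X (tt i) w)] =
      (\prod_(i < n) P [set w | B i (X (tt i.+1) w - X (tt i) w)%R])%E) /\
  (forall t u, 0 <= t ->
      (\int[P]_w (cos (u * X t w))%:E =
        (expR (t * Re_psi sigma gamma nu u) * cos (t * Im_psi sigma gamma nu u))%:E)%E /\
      (\int[P]_w (sin (u * X t w))%:E =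
        (expR (t * Re_psi sigma gamma nu u) * sin (t * Im_psi sigma gamma nu u))%:E)%E).

Definition null_set (R : realType) (d : measure_display)
  (Omega : measurableType d) (P : probability Omega R) (N : set Omega) : Prop :=
  exists M, measurable M /\ P M = 0%E /\ N `<=` M.

Definition aug_natural (R : realType) (d : measure_display)
  (Omega : measurableType d) (P : probability Omega R) (X : R -> Omega -> R)
  (u : R) : set (set Omega) :=
  <<s [set A | exists s B, 0 <= s <= u /\ measurable B /\ A = X s @^-1` B]
      `|` null_set P >>.

Definition usual_filtration (R : realType) (d : measure_display)
  (Omega : measurableType d) (P : probability Omega R) (X : R -> Omega -> R)
  (t : R) : set (set Omega) :=
  [set A | forall u, t < u -> aug_natural P X u A].

Definition stopping_time_le (R : realType) (d : measure_display)
  (Omega : measurableType d) (P : probability Omega R) (X : R -> Omega -> R)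
  (s : R) (tau : Omega -> R) : Prop :=
  (forall w, 0 <= tau w <= s) /\
  (forall u, usual_filtration P X u [set w | tau w <= u]).

Definition price (R : realType) (Omega : Type) (X : R -> Omega -> R)
  (r delta x t : R) (w : Omega) : R :=
  x * expR ((r - delta) * t + X t w).

Definition put_value (R : realType) (d : measure_display)
  (Omega : measurableType d) (P : probability Omega R) (X : R -> Omega -> R)
  (r delta K T : R) (t x : R) : R :=
  fine (ereal_sup [set (\int[P]_w
           (expR (- r * tau w) * Num.max (K - price X r delta x (tau w) w) 0)%:E)%E
         | tau in stopping_time_le P X (T - t)]).

Definition critical_price (R : realType) (d : measure_display)
  (Omega : measurableType d) (P : probability Omega R) (X : R -> Omega -> R)
  (r delta K T : R) (t : R) : R :=
  inf [set x | 0 <= x /\ Num.max (K - x) 0 < put_value P X r delta K T t x].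

Definition d_plus (R : realType) (nu : {measure set R -> \bar R}) (r delta : R)
  : \bar R :=
  ((r - delta)%:E - \int[nu]_y (Num.max (expR y - 1) 0)%:E)%E.

(* Main.v *)
(* Write [I] for the integral of [(1 - e^y)_+] and [d] for the drift of the
   log-price, so that [d_+ > 0] means [d > I].  The engine is the small time
   expansion [E (1 - e^{W_h})_+ = h I + o(h)] for a variable [W_h] distributed as the
   finite variation Levy process at time [h] with any drift [c >= 0].  It is proved
   without the Levy-Ito decomposition: tent functions are Fourier transforms of
   integrable functions, so the expansion for them follows from the one of the
   characteristic function, which is [e^{h psi}] with [psi(u) = o(u)] up to the drift;
   the put payoff is then squeezed between finite sums of tents.
   Lower bound.  For [lam < I] and [x = K / (1 + lam s)], [s = T - t] small, the
   European put is worth about [x s I > x s lam = K - x], hence [b(t) <= x].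
   Upper bound.  For [I < lam < d] the process [max (K - S_u, K lam (s - u))] is, up
   to the discretisation, a supermartingale, because
   [E max (1 - Y_h, - lam h) <= 0] where [Y_h] is the growth factor of the price over
   a time [h].  It dominates the payoff, and it starts from [K - x] when
   [x < K (1 - lam s)]; a discretisation of the stopping time from the right and
   Fatou's lemma give [P(t, x) <= K - x], hence [b(t) >= x] for such [x]. *)
Require Import Defs.
From HB Require Import structures.
From mathcomp Require Import all_boot all_order all_algebra.
From mathcomp Require Import all_classical all_reals all_analysis.
From mathcomp Require Import measurable_realfun.
From mathcomp Require Import ring lra.
Import Order.TTheory GRing.Theory Num.Theory.
Import numFieldNormedType.Exports.
Import HBNNSimple.
Local Open Scope classical_set_scope.
Local Open Scope ring_scope.
Set Implicit Arguments.
Unset Strict Implicit.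
Unset Printing Implicit Defensive.

(** * Elementary bounds and Fubini for real integrals *)

(** Cutting the frequencies of a tent at [N] costs about [1 / N], so an error [o(h)] forces [N] of
    order [1 / h]. At such frequencies [h psi(u)] is small only because finite variation makes the
    driftless exponent sublinear, [|psi(u)| <= A + e u] with [e] as small as desired; the drift does
    not satisfy this and is kept as an exact translation by [c h]. A second obstacle is that [nu]
    may be infinite near [0]: uniform closeness of a tent and its smoothing says nothing about their
    [nu]-integrals, and a Lipschitz constant independent of [N] is required too. The sign [c >= 0]
    makes the put payoff vanish at [c h]. In the upper bound the floor [lam h] is absorbed into the
    drift, which becomes [d - lam]; this is why the room between [I] and [d] matters. Two features
    of the definitions have a price: stationarity of the increments is not postulated and is
    recovered by dividing characteristic functions, and a stopping time is measurable only up to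
    null sets that need not be measurable, so integrals of stopped payoffs are handled through the
    simple functions below them. *)

Lemma is_derive_continuous_within (R : realType) (f df : R -> R) (A : set R) :
  (forall x : R, is_derive x 1 f (df x)) -> {within A, continuous f}.
Proof.
move=> fdf; apply: continuous_subspaceT => x.
apply: differentiable_continuous; apply/derivable1_diffP.
by have [] := fdf x.
Qed.

Lemma MVT_norm (R : realType) (f df : R -> R) (x y : R) :
  (forall z : R, is_derive z 1 f (df z)) ->
  exists2 c, `|c - x| <= `|y - x| & f y - f x = df c * (y - x).
Proof.
move=> fdf; have [xy|yx] := leP x y.
  have [c] := MVT_segment xy (fun z _ => fdf z) (is_derive_continuous_within fdf).
  rewrite in_itv/= => /andP[xc cy] e; exists c => //.
  by rewrite !ger0_norm ?subr_ge0// lerB.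
have [c] := MVT_segment (ltW yx) (fun z _ => fdf z)
  (is_derive_continuous_within fdf).
rewrite in_itv/= => /andP[yc cx] e; exists c; last first.
  by rewrite -opprB e -mulrN opprB.
by rewrite !ler0_norm ?subr_le0// ?(ltW yx)// !opprB lerB.
Qed.

Lemma cos_lip (R : realType) (x y : R) : `|cos y - cos x| <= `|y - x|.
Proof.
have [c _ ->] := @MVT_norm R cos (fun z => - sin z) x y (fun=> _).
by rewrite normrM normrN ler_piMl// sin_max.
Qed.

Lemma sin_lip (R : realType) (x y : R) : `|sin y - sin x| <= `|y - x|.
Proof.
have [c _ ->] := @MVT_norm R sin cos x y (fun=> _).
by rewrite normrM ler_piMl// cos_max.
Qed.

Lemma sin_le_norm (R : realType) (x : R) : `|sin x| <= `|x|.
Proof. by have := sin_lip (0:R) x; rewrite sin0 !subr0. Qed.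

Lemma onem_cos_le_norm (R : realType) (x : R) : 1 - cos x <= `|x|.
Proof. 
have := cos_lip (0:R) x; rewrite cos0 subr0; apply: le_trans.
by rewrite -normrN opprB ler_norm.
Qed.

Lemma onem_cos_ge0 (R : realType) (x : R) : 0 <= 1 - cos x.
Proof. by rewrite subr_ge0 cos_le1. Qed.

Lemma onem_cos_le2 (R : realType) (x : R) : 1 - cos x <= 2.
Proof. have := cos_geN1 x; lra. Qed.

(** Mean value theorem for [cos (x + t) + x * sin t], whose derivative [sin t - sin (x + t)] is at
    most [|x|]. *)
Lemma cos_taylor (R : realType) (b t : R) :
  `|cos (b + t) - cos t + b * sin t| <= b ^+ 2.
Proof.
pose f (x : R) := cos (x + t) + x * sin t.
have fd (z : R) : is_derive z 1 f (- sin (z + t) + sin t).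
  rewrite /f; apply: is_derive_eq; rewrite /GRing.scale/=.
  by ring.
have [c cb e] := MVT_norm 0 b fd.
have -> : cos (b + t) - cos t + b * sin t = f b - f 0.
  by rewrite /f add0r mul0r addr0; ring.
move: cb; rewrite e !subr0 => cb; 
rewrite normrM -(real_normK (num_real b)) expr2 ler_pM//.
rewrite addrC; have := sin_lip (c + t) t; move/le_trans; apply.
by rewrite -normrN opprB addrK.
Qed.

Lemma onem_cos_le_sqr (R : realType) (x : R) : 1 - cos x <= x ^+ 2.
Proof.
have := cos_taylor x 0; rewrite addr0 cos0 sin0 mulr0 addr0.
by apply: le_trans; rewrite -normrN opprB ler_norm.
Qed.

Lemma expR_taylor_le0 (R : realType) (a : R) : a <= 0 ->
  `|expR a - 1 - a| <= a ^+ 2.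
Proof.
move=> a0; rewrite ger0_norm; last by have := expR_ge1Dx a; lra.
have [c cb e] := @MVT_norm R expR expR 0 a (fun=> _).
move: e cb; rewrite expR0 !subr0 => -> cb.
have -> : expR c * a - a = (1 - expR c) * (- a) by ring.
rewrite -sqrrN expr2 ler_wpM2r// ?oppr_ge0//.
have := expR_ge1Dx c; rewrite (ler0_norm a0) in cb.
have := ler_norm (- c); rewrite normrN; lra.
Qed.

(* second-order expansion of [Re (e^{i t} e^{a + i b})] *)
Lemma expR_cos_taylor (R : realType) (a b t : R) : a <= 0 ->
  `|expR a * cos (b + t) - cos t - (a * cos t - b * sin t)| <=
  2 * (a ^+ 2 + b ^+ 2).
Proof.
move=> a0.
have -> : expR a * cos (b + t) - cos t - (a * cos t - b * sin t) =
  (expR a - 1 - a) * cos (b + t) + a * (cos (b + t) - cos t) +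
  (cos (b + t) - cos t + b * sin t) by ring.
apply: (le_trans (ler_normD _ _)).
have h1 : `|(expR a - 1 - a) * cos (b + t)| <= a ^+ 2.
  rewrite normrM -[leRHS]mulr1 ler_pM// ?expR_taylor_le0//.
  exact: cos_max.
have h2 : `|a * (cos (b + t) - cos t)| <= `|a| * `|b|.
  rewrite normrM ler_wpM2l//.
  by have := cos_lip t (b + t); rewrite addrK.
have h3 := cos_taylor b t.
have h4 := ler_normD ((expR a - 1 - a) * cos (b + t)) (a * (cos (b + t) - cos t)).
have h5 : `|a| * `|b| <= a ^+ 2 + b ^+ 2.
  have := sqr_ge0 (`|a| - `|b|); rewrite sqrrB !real_normK ?num_real//.
  have := sqr_ge0 a; have := sqr_ge0 b; lra.
lra.
Qed.

Lemma measurable_cos (R : realType) : measurable_fun setT (@cos R).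
Proof. by apply: continuous_measurable_fun; exact: continuous_cos. Qed.

Lemma measurable_sin (R : realType) : measurable_fun setT (@sin R).
Proof. by apply: continuous_measurable_fun; exact: continuous_sin. Qed.

Lemma measurable_invX2 (R : realType) :
  measurable_fun setT (fun u : R => (u ^+ 2)^-1).
Proof.
rewrite (_ : (fun u : R => _) = (fun u => (u ^+ 2) `^ (-1))); last first.
  by apply/funext => u; rewrite powR_inv1 ?sqr_ge0.
apply: (@measurableT_comp _ _ _ _ _ _ (@powR R ^~ (-1)) _ (fun u : R => u ^+ 2)).
  exact: measurable_powR.
exact: measurable_funX.
Qed.

Lemma integrable_dom d (T : measurableType d) (R : realType)
    (mu : {measure set T -> \bar R}) (D : set T) (f g : T -> R) :
  measurable D -> measurable_fun D f -> mu.-integrable D (EFin \o g) ->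
  (forall x, D x -> `|f x| <= g x) -> mu.-integrable D (EFin \o f).
Proof.
move=> mD mf ig fg; apply: le_integrable ig => //; first exact/measurable_EFinP.
by move=> x Dx /=; rewrite lee_fin (le_trans (fg _ Dx))// ler_norm.
Qed.

Section Rfubini.
Context d1 d2 (T1 : measurableType d1) (T2 : measurableType d2) (R : realType).
Variables (m1 : {sigma_finite_measure set T1 -> \bar R}).
Variables (m2 : {sigma_finite_measure set T2 -> \bar R}).
Variables (f : T1 -> T2 -> R) (a : T1 -> R) (b : T2 -> R).
Hypothesis mf : measurable_fun setT (fun z : T1 * T2 => f z.1 z.2).
Hypothesis ia : m1.-integrable setT (EFin \o a).
Hypothesis ib : m2.-integrable setT (EFin \o b).
Hypothesis fab : forall x y, `|f x y| <= a x * b y.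

Let mfl x : measurable_fun setT (f x).
Proof.
exact: (@measurableT_comp _ _ _ _ _ _ (fun z : T1 * T2 => f z.1 z.2) _ _
  mf (pair1_measurable x)).
Qed.

Let mfr y : measurable_fun setT (f^~ y).
Proof.
exact: (@measurableT_comp _ _ _ _ _ _ (fun z : T1 * T2 => f z.1 z.2) _ _
  mf (pair2_measurable y)).
Qed.

Lemma integrable_section1 x : m2.-integrable setT (EFin \o f x).
Proof.
apply: (@integrable_dom _ _ _ _ _ _ (fun y => a x * b y)) => //.
exact: (integrableZl measurableT (a x) ib).
Qed.

Lemma integrable_section2 y : m1.-integrable setT (EFin \o f^~ y).
Proof.
apply: (@integrable_dom _ _ _ _ _ _ (fun x => a x * b y)) => //.
rewrite (_ : EFin \o _ = (EFin \o a) \* cst (b y)%:E)%E; last exact/funext.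
exact: (integrableZr measurableT (b y) ia).
Qed.

Let if12 : (m1 \x m2)%E.-integrable setT (fun z => (f z.1 z.2)%:E).
Proof.
apply/integrable12ltyP; first exact/measurable_EFinP.
apply: (@le_lt_trans _ _ (\int[m1]_x ((a x)%:E * \int[m2]_y (b y)%:E))%E).
  apply: ge0_le_integral => //.
  - by move=> x _; exact: integral_ge0.
  - apply: (@measurable_fun_fubini_tonelli_F _ _ _ _ _ _
      (fun z => `|(f z.1 z.2)%:E|%E)) => //.
    by apply: measurableT_comp => //; exact/measurable_EFinP.
  - apply: emeasurable_funM; first exact: measurable_int ia.
    exact: measurable_cst.
  move=> x _ /=; rewrite -integralZl//; apply: ge0_le_integral => //.
  - apply/measurable_EFinP.
    exact: (measurableT_comp (@normr_measurable R setT)).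
  - by apply: emeasurable_funM => //; exact: measurable_int ib.
  - by move=> y _; rewrite -EFinM lee_fin.
have iby : (\int[m2]_y (b y)%:E)%E \is a fin_num by exact: integrable_fin_num ib.
rewrite -(fineK iby) integralZr//.
have /fineK <- : (\int[m1]_x (a x)%:E)%E \is a fin_num.
  exact: integrable_fin_num ia.
by rewrite -EFinM ltry.
Qed.

Lemma integrable_Rintegral1 :
  m1.-integrable setT (EFin \o (fun x => \int[m2]_y f x y)).
Proof.
have := integrable_fubini_F if12; apply: eq_integrable => // x _ /=.
by rewrite /fubini_F /Rintegral fineK//; apply: integrable_fin_num;
  [|exact: integrable_section1].
Qed.

(** Domination by a product is how the two uses present themselves: a compactly supported weight in
    the frequency against [min 1 |y|] under [nu], or against [1] under [P]. *)
Lemma Rintegral_exchange :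
  \int[m1]_x \int[m2]_y f x y = \int[m2]_y \int[m1]_x f x y.
Proof.
have := Fubini if12 => /= /(congr1 fine).
rewrite /Rintegral => e.
transitivity (fine (\int[m1]_x \int[m2]_y (f x y)%:E)%E).
  congr fine; apply: eq_integral => x _; rewrite fineK//.
  by apply: integrable_fin_num => //; exact: integrable_section1.
rewrite e; congr fine; apply: eq_integral => y _; rewrite fineK//.
by apply: integrable_fin_num => //; exact: integrable_section2.
Qed.

End Rfubini.

(** Lebesgue measure and [a] times its image under multiplication by [a] agree on half-open
    intervals, hence everywhere. *)
Lemma ge0_integral_scale (R : realType) (a : R) (f : R -> \bar R) : 0 < a ->
  measurable_fun setT f -> (forall x, 0 <= f x)%E ->
  (\int[lebesgue_measure]_x f x =
   a%:E * \int[lebesgue_measure]_x f (a * x)%R)%E.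
Proof.
move=> a0 mf f0.
have ma : measurable_fun setT (fun x : measurableTypeR R => a * x : measurableTypeR R).
  exact: mulrl_measurable.
pose mua := pushforward (@lebesgue_measure R) (fun x : measurableTypeR R => a * x : measurableTypeR R).
pose p := NngNum (ltW a0).
have leb A : measurable A -> lebesgue_measure A = mscale p (mua : {measure set _ -> \bar R}) A.
  move=> mA; apply: lebesgue_measure_unique mA => _ [[x y] /= _ <-].
  rewrite /mscale/= /pushforward.
  have -> : (fun z : R => a * z) @^-1` `]x, y] = `]x / a, y / a]%classic.
    apply/seteqP; split => z/=; rewrite !in_itv/= ltr_pdivrMr// ler_pdivlMr//;
      by rewrite (mulrC z).
  rewrite !lebesgue_measure_itv/= !lte_fin ltr_pM2r ?invr_gt0//.
  case: ifPn => _; last by rewrite mule0.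
  by rewrite -!EFinB -EFinM -mulrBl mulrCA divff ?mulr1// gt_eqF.
rewrite (@eq_measure_integral _ _ _ _ (mscale p (mua : {measure set _ -> \bar R})))//; last first.
  by move=> A mA _; exact: leb.
rewrite ge0_integral_mscale//=; congr (_ * _)%E.
by rewrite ge0_integral_pushforward//= preimage_setT.
Qed.

(** * The Fejer integral of the absolute value *)

(** At [0] the value is [0] by the convention on inverses, not the limit [1/2]; one point does not
    affect the integrals. *)
Definition fejer (R : realType) (v : R) : R := (1 - cos v) / v ^+ 2.

Lemma fejer_ge0 (R : realType) (v : R) : 0 <= fejer v.
Proof. by rewrite divr_ge0 ?sqr_ge0// onem_cos_ge0. Qed.

Lemma fejer_le1 (R : realType) (v : R) : fejer v <= 1.
Proof.
rewrite /fejer; have [->|v0] := eqVneq v 0.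
  by rewrite expr0n/= invr0 mulr0.
by rewrite ler_pdivrMr ?exprn_even_gt0// mul1r onem_cos_le_sqr.
Qed.

Lemma fejer_le_inv (R : realType) (v : R) : 0 < v -> fejer v <= v^-1.
Proof.
move=> v0; rewrite ler_pdivrMr ?exprn_gt0// expr2 mulKf ?gt_eqF//.
by rewrite (le_trans (onem_cos_le_norm v))// gtr0_norm.
Qed.

Lemma fejer_le_inv2 (R : realType) (v : R) : fejer v <= 2 / v ^+ 2.
Proof. by rewrite ler_wpM2r ?invr_ge0 ?sqr_ge0// onem_cos_le2. Qed.

Lemma measurable_fejer (R : realType) : measurable_fun setT (@fejer R).
Proof.
apply: measurable_funM; last exact: measurable_invX2.
by apply: measurable_funB => //; exact: measurable_cos.
Qed.

Lemma integrable_bounded_itv (R : realType) (f : R -> R) (a b C : R) (x y : bool) :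
  measurable_fun setT f -> (forall u, `|f u| <= C) ->
  (@lebesgue_measure R).-integrable
    [set` Interval (BSide x a) (BSide y b)] (EFin \o f).
Proof.
move=> mf fC; apply: measurable_bounded_integrable => //.
- rewrite /= lebesgue_measure_itv/=; case: ifP => // _.
  by rewrite -EFinB ltry.
- exact: measurable_funS mf.
- exists C; split; first exact: num_real.
  by move=> M CM z _ /=; rewrite (le_trans (fC z))// ltW.
Qed.

Lemma integrable_fejer (R : realType) (a b : R) (x y : bool) :
  (@lebesgue_measure R).-integrable
    [set` Interval (BSide x a) (BSide y b)] (EFin \o @fejer R).
Proof.
apply: (@integrable_bounded_itv _ _ _ _ 1); first exact: measurable_fejer.
by move=> u; rewrite ger0_norm ?fejer_ge0 ?fejer_le1.
Qed.

Definition fejer_int (R : realType) (x : R) : R :=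
  \int[lebesgue_measure]_(v in `[0, x]) fejer v.

Lemma fejer_intB (R : realType) (x y : R) : 0 <= x -> x <= y ->
  fejer_int y - fejer_int x = \int[lebesgue_measure]_(v in `]x, y]) fejer v.
Proof.
move=> x0 xy; apply: Rintegral_itvB; rewrite ?bnd_simp//.
exact: integrable_fejer.
Qed.

Lemma fejer_int_nd (R : realType) (x y : R) : 0 <= x -> x <= y ->
  fejer_int x <= fejer_int y.
Proof.
move=> x0 xy; rewrite -subr_ge0 fejer_intB//; apply: Rintegral_ge0 => v _.
exact: fejer_ge0.
Qed.

Lemma fejer_int0 (R : realType) : fejer_int (0 : R) = 0.
Proof. by rewrite /fejer_int set_itv1 Rintegral_set1. Qed.

Lemma Rintegral_itv_cst (R : realType) (a b C : R) (x y : bool) : a <= b ->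
  \int[lebesgue_measure]_(v in [set` Interval (BSide x a) (BSide y b)]) C =
  C * (b - a).
Proof.
move=> ab; rewrite Rintegral_cst//= lebesgue_measure_itv/=; congr *%R.
case: ifPn => //; rewrite lte_fin -leNgt => ba.
by apply/esym/eqP; rewrite subr_eq0 eq_le ba.
Qed.

(** From [fejer v <= 1 / v]. This scale-invariant bound is what makes the Lipschitz constant of
    [kink] independent of the cut-off. *)
Lemma fejer_intB_le_div (R : realType) (x y : R) : 0 < x -> x <= y ->
  fejer_int y - fejer_int x <= (y - x) / x.
Proof.
move=> x0 xy; rewrite fejer_intB ?(ltW x0)//.
apply: (@le_trans _ _ (\int[lebesgue_measure]_(v in `]x, y]) x^-1)).
  apply: le_Rintegral => //; first exact: integrable_fejer.
    by apply: (@integrable_bounded_itv _ _ _ _ `|x^-1|).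
  move=> v /=; rewrite in_itv/= => /andP[xv vy].
  by rewrite (le_trans (fejer_le_inv (lt_trans x0 xv)))// lef_pV2 ?posrE ?ltW// (lt_trans x0).
by rewrite Rintegral_itv_cst// mulrC.
Qed.

(** From [fejer v <= 2 / v^2], with primitive [- 2 / v]. It gives the rate [1 / N] at which [kink N]
    approaches the absolute value. *)
Lemma fejer_intB_le_inv (R : realType) (x y : R) : 0 < x -> x <= y ->
  fejer_int y - fejer_int x <= 2 / x.
Proof.
move=> x0; rewrite le_eqVlt => /predU1P[<-|xy].
  by rewrite subrr divr_ge0 ?ltW.
rewrite fejer_intB ?(ltW x0) ?(ltW xy)//.
pose g (v : R) := 2 / v ^+ 2; pose F (v : R) := - (2 / v).
have dF (v : R) : 0 < v -> is_derive v 1 F (g v).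
  move=> v0; have vN : v != 0 by rewrite gt_eqF.
  have dV := @is_deriveV R id v 1 1 vN (is_derive_id v 1).
  rewrite /F; apply: is_derive_eq; rewrite /g /GRing.scale/=.
  by field.
have cg (v : R) : 0 < v -> {for v, continuous g}.
  move=> v0; apply: cvgMr; apply: cvgV; first by rewrite expf_neq0// gt_eqF.
  exact: exprn_continuous.
have gi : (\int[lebesgue_measure]_(v in `[x, y]) (g v)%:E = (F y)%:E - (F x)%:E)%E.
  apply: continuous_FTC2 => //.
  - apply: continuous_in_subspaceT => v; rewrite inE/= in_itv/= => /andP[xv _].
    exact: cg (lt_le_trans x0 xv).
  - have cF (v : R) : 0 < v -> {for v, continuous F}.
      move=> v0; apply: differentiable_continuous; apply/derivable1_diffP.
      by have [] := dF _ v0.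
    split.
    + by move=> v; rewrite in_itv/= => /andP[xv _]; have [] := dF _ (lt_trans x0 xv).
    + by apply: cvg_at_right_filter; exact: cF.
    + by apply: cvg_at_left_filter; exact: cF (lt_trans x0 xy).
  - move=> v; rewrite in_itv/= => /andP[xv _].
    by rewrite derive1E; have [_ ->] := dF _ (lt_trans x0 xv).
have ig : lebesgue_measure.-integrable `[x, y] (EFin \o g).
  apply: continuous_compact_integrable; first exact: segment_compact.
  apply: continuous_in_subspaceT => v; rewrite inE/= in_itv/= => /andP[xv _].
  exact: cg (lt_le_trans x0 xv).
have ig' : lebesgue_measure.-integrable `]x, y] (EFin \o g).
  by apply: integrableS ig => //; apply: subset_itvr; rewrite bnd_simp.
apply: (@le_trans _ _ (\int[lebesgue_measure]_(v in `]x, y]) g v)).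
  apply: le_Rintegral => //; first exact: integrable_fejer.
  by move=> v _; exact: fejer_le_inv2.
rewrite Rintegral_itv_obnd_cbnd// /Rintegral gi/= /F opprK addrC.
by rewrite lerBlDr lerDl divr_ge0// ltW// (lt_trans x0).
Qed.

(** Classically [pi / 2]. Only its positivity and the rate of approach of [fejer_int] are used, so a
    supremum spares the evaluation. *)
Definition fejer_cst (R : realType) : R :=
  sup [set fejer_int x | x in [set x : R | 0 <= x]].

Lemma has_sup_fejer_int (R : realType) :
  has_sup [set fejer_int x | x in [set x : R | 0 <= x]].
Proof.
split; first by exists (fejer_int 0), 0 => /=.
exists (fejer_int 1 + 2) => _ [x /= x0 <-].
have [x1|x1] := leP x 1.
  by have := fejer_int_nd x0 x1; lra.
by have := fejer_intB_le_inv (ltr01 : 0 < 1 :> R) (ltW x1); rewrite divr1; lra.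
Qed.

Lemma fejer_int_le_cst (R : realType) (x : R) : 0 <= x -> fejer_int x <= fejer_cst R.
Proof.
move=> x0; apply: sup_ubound; last by exists x.
by have [] := has_sup_fejer_int R.
Qed.

Lemma fejer_cst_le (R : realType) (x : R) : 0 < x -> fejer_cst R <= fejer_int x + 2 / x.
Proof.
move=> x0; apply: ge_sup; first by have [] := has_sup_fejer_int R.
move=> _ [y /= y0 <-]; have [yx|xy] := leP y x.
  have : 0 <= 2 / x by rewrite divr_ge0// ltW.
  by have := fejer_int_nd y0 yx; lra.
by have := fejer_intB_le_inv x0 (ltW xy); lra.
Qed.

(** On []0, 1]], [1 - cos v = 2 (sin (v/2))^2] and [sin w >= w cos 1] by the mean value theorem, so
    [fejer] is at least [(cos 1)^2 / 2] there. *)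
Lemma fejer_cst_gt0 (R : realType) : 0 < fejer_cst R.
Proof.
apply: (@lt_le_trans _ _ (fejer_int 1)); last exact: fejer_int_le_cst.
have -> : fejer_int 1 = \int[@lebesgue_measure R]_(v in `]0, 1]) fejer v.
  by rewrite -fejer_intB// fejer_int0 subr0.
apply: (@lt_le_trans _ _ (\int[@lebesgue_measure R]_(v in `]0, 1]) (cos 1 ^+ 2 / 2))).
  rewrite Rintegral_itv_cst// subr0 mulr1 divr_gt0// exprn_gt0// cos1_gt0//.
apply: le_Rintegral => //.
- exact: (@integrable_bounded_itv _ _ _ _ `|cos 1 ^+ 2 / 2|).
- exact: integrable_fejer.
move=> v /=; rewrite in_itv/= => /andP[v0 v1].
rewrite /fejer ler_pdivlMr ?exprn_gt0//.
set w := v / 2; have vw : v = w + w by rewrite /w; field.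
have -> : 1 - cos v = 2 * sin w ^+ 2.
  by rewrite vw cosD -!expr2 cos2sin2; ring.
have w0 : 0 <= w by rewrite divr_ge0// ltW.
have [c cw] := @MVT_segment R sin cos 0 w w0 (fun _ _ => _)
  (is_derive_continuous_within (fun=> _)).
rewrite sin0 !subr0 => ->; move: cw; rewrite in_itv/= => /andP[c0 cw].
have : cos 1 <= cos c.
  have w1 : w <= 1 / 2 by rewrite /w; lra.
  have := pi_ge2 R => pi2.
  have [->//|c1] := eqVneq c 1.
  apply/ltW; rewrite ltr_cos ?in_itv/= ?c0//; lra.
have := cos1_gt0 R; move: (cos 1) (cos c) => e f e0 ef.
have : e ^+ 2 <= f ^+ 2 by rewrite ler_sqr// nnegrE; lra.
rewrite vw => h; have -> : e ^+ 2 / 2 * (w + w) ^+ 2 = 2 * (e ^+ 2 * w ^+ 2) by field.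
by clearbody w; rewrite exprMn; have := ler_wpM2r (sqr_ge0 w) h; lra.
Qed.

(* [|z|] with the frequencies above [N] removed *)
Definition kink (R : realType) (N z : R) : R :=
  (fejer_cst R)^-1 *
  \int[lebesgue_measure]_(u in `[0, N]) ((1 - cos (u * z)) / u ^+ 2).

Lemma kinkE (R : realType) (N z : R) : 0 <= N ->
  kink N z = (fejer_cst R)^-1 * (`|z| * fejer_int (N * `|z|)).
Proof.
move=> N0; rewrite /kink; congr *%R.
have [->|z0] := eqVneq z 0.
  rewrite normr0 mul0r (_ : Rintegral _ _ _ = \int[lebesgue_measure]_(u in `[0%R, N]) 0).
    by rewrite Rintegral_itv_cst// mul0r.
  by apply: eq_Rintegral => u _; rewrite mulr0 cos0 subrr mul0r.
pose a : R := `|z|; have a0 : 0 < a by rewrite normr_gt0.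
(* The two factors [a] play different roles: the outer one leaves the integral, the inner one is the
   Jacobian of [v = a u]. *)
have -> : (fun u => (1 - cos (u * z)) / u ^+ 2) = (fun u => a * (a * fejer (a * u))).
  apply/funext => u; rewrite /fejer -(cos_norm (u * z)) normrM -/a.
  rewrite -(cos_norm (a * u)) normrM (gtr0_norm a0) (mulrC a `|u|) exprMn.
  have [->|u0] := eqVneq u 0; first by rewrite normr0 mul0r cos0 subrr !mul0r !mulr0.
  have aN : a != 0 by rewrite gt_eqF.
  by field; rewrite u0.
have ifa : lebesgue_measure.-integrable `[0, N] (EFin \o (fun u => a * fejer (a * u))).
  apply: (@integrable_bounded_itv _ _ _ _ (a * 1)).
    apply: measurable_funM => //; apply: measurableT_comp; first exact: measurable_fejer.
    exact: mulrl_measurable.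
  move=> u; have f0 := fejer_ge0 (a * u).
  rewrite ger0_norm; last exact: mulr_ge0 (ltW a0) f0.
  exact: ler_wpM2l (ltW a0) _ _ (fejer_le1 _).
rewrite RintegralZl// -/a; congr *%R.
rewrite /fejer_int /Rintegral; congr fine.
rewrite [RHS]integral_mkcond.
rewrite (@ge0_integral_scale _ a)//; last 2 first.
- apply/measurable_restrict => //; apply/measurable_EFinP/measurable_funTS.
  exact: measurable_fejer.
- move=> x; rewrite /patch; case: ifP => // _; rewrite lee_fin; exact: fejer_ge0.
under eq_integral do rewrite EFinM.
rewrite ge0_integralZl//; last 3 first.
- apply/measurable_EFinP/measurable_funTS; apply: measurableT_comp; first exact: measurable_fejer.
  exact: mulrl_measurable.
- by move=> x _; rewrite lee_fin fejer_ge0.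
- by rewrite lee_fin ltW.
congr (_ * _)%E; rewrite [LHS]integral_mkcond; apply: eq_integral => u _.
rewrite /patch !mem_setE !in_itv/= pmulr_rge0// (mulrC N) ler_pM2l//.
Qed.

Lemma kink_le (R : realType) (N z : R) : 0 <= N -> kink N z <= `|z|.
Proof.
move=> N0; rewrite kinkE// ler_pdivrMl ?fejer_cst_gt0// mulrC ler_wpM2r//.
by rewrite fejer_int_le_cst// mulr_ge0.
Qed.

Lemma kink_ge (R : realType) (N z : R) : 0 < N ->
  `|z| - 2 / (fejer_cst R * N) <= kink N z.
Proof.
move=> N0; have [->|z0] := eqVneq z 0.
  rewrite (kinkE _ (ltW N0)) normr0 mul0r mulr0 sub0r oppr_le0 divr_ge0//.
  by rewrite mulr_ge0 ?(ltW N0)// ltW// fejer_cst_gt0.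
have a0 : 0 < `|z| by rewrite normr_gt0.
have c0 := fejer_cst_gt0 R.
rewrite (kinkE _ (ltW N0)) ler_pdivlMl//.
have -> : fejer_cst R * (`|z| - 2 / (fejer_cst R * N)) =
  `|z| * (fejer_cst R - 2 / (N * `|z|)) by field; rewrite !gt_eqF.
rewrite ler_wpM2l// lerBlDr fejer_cst_le// mulr_gt0//.
Qed.

(** By evenness take [0 <= a <= b]. With [F = fejer_int], the difference of [z F(N z)] splits into
    [(b - a) F(N b)] and [a (F(N b) - F(N a))]; the second part is at most [b - a] whatever [N]
    is. *)
Lemma kink_lip (R : realType) (N x y : R) : 0 < N ->
  `|kink N y - kink N x| <= (1 + (fejer_cst R)^-1) * `|y - x|.
Proof.
move=> N0; have c0 := fejer_cst_gt0 R.
suff main (a b : R) : 0 <= a -> a <= b ->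
    0 <= kink N b - kink N a <= (1 + (fejer_cst R)^-1) * (b - a).
  have norm_kink z : kink N z = kink N `|z| by rewrite !(kinkE _ (ltW N0)) normr_id.
  have L0 : 0 <= 1 + (fejer_cst R)^-1 by rewrite addr_ge0// invr_ge0 ltW.
  rewrite (norm_kink x) (norm_kink y).
  have [xy|yx] := leP `|x| `|y|.
    have /andP[h1 h2] := main _ _ (normr_ge0 x) xy.
    by rewrite ger0_norm// (le_trans h2)// ler_wpM2l// lerB_dist.
  have /andP[h1 h2] := main _ _ (normr_ge0 y) (ltW yx).
  rewrite distrC ger0_norm// (le_trans h2)// ler_wpM2l// distrC lerB_dist//.
move=> a0 ab; have b0 : 0 <= b := le_trans a0 ab.
rewrite !(kinkE _ (ltW N0)) !ger0_norm// -mulrBr.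
have -> : b * fejer_int (N * b) - a * fejer_int (N * a) =
  (b - a) * fejer_int (N * b) + a * (fejer_int (N * b) - fejer_int (N * a)) by ring.
have fb0 : 0 <= fejer_int (N * b) by apply: Rintegral_ge0 => v _; exact: fejer_ge0.
have nd : fejer_int (N * a) <= fejer_int (N * b).
  by rewrite fejer_int_nd// ?mulr_ge0 ?(ltW N0)// ler_wpM2l// ltW.
apply/andP; split.
  rewrite mulr_ge0 ?invr_ge0 ?(ltW c0)// addr_ge0// mulr_ge0// subr_ge0//.
rewrite ler_pdivrMl//.
have -> : fejer_cst R * ((1 + (fejer_cst R)^-1) * (b - a)) =
  fejer_cst R * (b - a) + (b - a) by field; rewrite gt_eqF.
apply: lerD.
  by rewrite mulrC ler_wpM2r ?subr_ge0// fejer_int_le_cst// mulr_ge0// ltW.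
have [->|aN] := eqVneq a 0; first by rewrite mul0r subr0.
have ap : 0 < a by rewrite lt_def aN.
have := @fejer_intB_le_div R (N * a) (N * b).
rewrite mulr_gt0// ler_pM2l// => /(_ isT ab) h.
apply: (le_trans (ler_wpM2l a0 h)); rewrite le_eqVlt; apply/orP; left.
by apply/eqP; field; rewrite !gt_eqF.
Qed.

(** * Levy measures of finite variation *)

Definition fv_measure (R : realType) (nu : set R -> \bar R) : Prop :=
  nu.-integrable setT (EFin \o (fun y : R => Num.min 1 `|y|)).

Lemma measurable_min_norm (R : realType) (s : R) :
  measurable_fun setT (fun y : R => Num.min s `|y|).
Proof. by apply: measurable_minr => //; exact: normr_measurable. Qed.

Lemma fv_integrable (R : realType) (nu : {measure set R -> \bar R}) (f : R -> R)
    (C : R) : fv_measure nu -> measurable_fun setT f ->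
  (forall y, `|f y| <= C * Num.min 1 `|y|) -> nu.-integrable setT (EFin \o f).
Proof.
move=> fv mf fC; apply: (@integrable_dom _ _ _ _ _ _ (fun y : R => C * Num.min 1 `|y|)) => //.
exact: (integrableZl measurableT C fv).
Qed.

Lemma fv_integrable_min (R : realType) (nu : {measure set R -> \bar R}) (s : R) :
  0 <= s -> fv_measure nu ->
  nu.-integrable setT (EFin \o (fun y : R => Num.min s `|y|)).
Proof.
move=> s0 fv; apply: (@fv_integrable _ _ _ (1 + s)) => //.
  exact: measurable_min_norm.
move=> y; have y0 := normr_ge0 y.
have m0 : 0 <= Num.min s `|y| by rewrite le_min s0.
rewrite ger0_norm// /Num.min; case: ifPn; rewrite -?leNgt => h1;
  case: ifPn; rewrite -?leNgt => h2; nra.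
Qed.

(** The sets where [min 1 |y|] is at least [1/(n+1)] have finite mass by Markov's inequality. They
    miss only the origin, which is added to each of them and is null. *)
Lemma sigma_finite_fv (R : realType) (nu : {measure set R -> \bar R}) :
  nu [set 0] = 0%E -> fv_measure nu -> sigma_finite setT nu.
Proof.
move=> nu0 fv.
pose F n := [set y : R | n.+1%:R^-1 <= Num.min 1 `|y|] `|` [set 0].
have mF' n : measurable [set y : R | n.+1%:R^-1 <= Num.min 1 `|y|].
  rewrite -[X in measurable X]setTI.
  have -> : [set y : R | n.+1%:R^-1 <= Num.min 1 `|y|] =
    (fun y : R => Num.min 1 `|y|) @^-1` `[n.+1%:R^-1, +oo[.
    by apply/seteqP; split => y /=; rewrite in_itv/= andbT.
  exact: measurable_min_norm.
exists F; last first.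
  move=> n; split; first by apply: measurableU.
  apply: (@le_lt_trans _ _ (nu [set y : R | (n.+1%:R^-1 <= Num.min 1 `|y|)%R])).
    apply: (le_trans (measureU2 _ _ _)) => //.
    by rewrite -[leRHS]adde0 leeD// le_eqVlt; apply/orP; left; apply/eqP.
  set A := [set y : R | _]; have mA : measurable A by exact: mF'.
  rewrite -(setIT A) -(integral_indic nu measurableT mA).
  have ig := integrableZl measurableT n.+1%:R fv.
  apply: le_lt_trans (integrable_lty measurableT ig).
  apply: ge0_le_integral => //.
  - exact/measurable_EFinP.
  - exact: measurable_int ig.
  move=> y _; rewrite -EFinM lee_fin indicE.
  have m0 : 0 <= n.+1%:R * Num.min 1 `|y| by rewrite mulr_ge0// le_min ler01/=.
  have [|//] := boolP (y \in A); rewrite inE /A/= => h.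
  by rewrite -ler_pdivrMl ?ltr0n// mulr1.
apply/esym; rewrite -subTset => y _; have [->|y0] := eqVneq y 0.
  by exists 0%N => //; right.
have m0 : 0 < Num.min 1 `|y| by rewrite lt_min ltr01 normr_gt0.
have [n hn] := ltr_add_invr m0.
by exists n => //; left => /=; rewrite add0r in hn; exact: ltW.
Qed.

Definition fv_mod (R : realType) (nu : {measure set R -> \bar R}) (s : R) : R :=
  \int[nu]_y Num.min s `|y|.

Lemma fv_mod_ge0 (R : realType) (nu : {measure set R -> \bar R}) (s : R) :
  0 <= s -> 0 <= fv_mod nu s.
Proof. by move=> s0; apply: Rintegral_ge0 => y _; rewrite le_min s0/=. Qed.

(** The quantitative form of finite variation: a function that is both Lipschitz and bounded by a
    small [s] has a small [nu]-integral, even when [nu] has infinite mass near [0]. *)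
Lemma fv_mod_small (R : realType) (nu : {measure set R -> \bar R}) (e : R) :
  fv_measure nu -> 0 < e -> exists2 s : R, 0 < s & fv_mod nu s <= e.
Proof.
move=> fv e0.
have mmin n := @measurable_min_norm R n.+1%:R^-1.
have [] := @dominated_convergence _ _ _ nu setT measurableT
  (fun n y => (Num.min n.+1%:R^-1 `|y|)%:E) (cst 0%E)
  (EFin \o (fun y => Num.min 1 `|y|)).
- by move=> n; apply/measurable_EFinP.
- exact: measurable_cst.
- apply: aeW => y _; apply/fine_cvgP; split; first by apply: nearW.
  rewrite (_ : fine \o _ = (fun n => Num.min n.+1%:R^-1 `|y|)); last exact/funext.
  apply: (@squeeze_cvgr _ _ _ _ (cst 0) (fun n => n.+1%:R^-1)).
  + apply: nearW => n /=; rewrite le_min invr_ge0 ler0n normr_ge0/=.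
    by rewrite ge_min lexx.
  + exact: cvg_cst.
  + exact: cvg_harmonic.
- exact: fv.
- apply: aeW => y n _ /=; rewrite lee_fin ger0_norm; last first.
    by rewrite le_min invr_ge0 ler0n normr_ge0.
  rewrite le_min !ge_min lexx orbT andbT; apply/orP; left.
  by rewrite invf_le1 ?ltr0n// ler1n.
move=> _ _; rewrite integral_cst// mul0e => /fine_cvgP[_].
move=> /cvgrPdist_le /(_ e e0)[n _ /(_ n (leqnn n))] /=.
rewrite sub0r normrN => h.
exists n.+1%:R^-1; first by rewrite invr_gt0 ltr0n.
exact: le_trans (ler_norm _) h.
Qed.

Definition fv_re (R : realType) (nu : {measure set R -> \bar R}) (u : R) : R :=
  \int[nu]_y (cos (u * y) - 1).

Definition fv_im (R : realType) (nu : {measure set R -> \bar R}) (u : R) : R :=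
  \int[nu]_y sin (u * y).

Lemma measurable_cosM (R : realType) (u : R) :
  measurable_fun setT (fun y : R => cos (u * y)).
Proof.
apply: (measurableT_comp (@measurable_cos R)); exact: mulrl_measurable.
Qed.

Lemma measurable_sinM (R : realType) (u : R) :
  measurable_fun setT (fun y : R => sin (u * y)).
Proof.
apply: (measurableT_comp (@measurable_sin R)); exact: mulrl_measurable.
Qed.

Lemma min_normM (R : realType) (u y : R) :
  Num.min 2 `|u * y| <= (2 + `|u|) * Num.min 1 `|y|.
Proof.
rewrite normrM /Num.min; have := normr_ge0 u; have := normr_ge0 y.
case: ifPn; rewrite -?leNgt => h1; case: ifPn; rewrite -?leNgt => h2 h3 h4; nra.
Qed.

Lemma cosB1_le_min (R : realType) (x : R) : `|cos x - 1| <= Num.min 2 `|x|.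
Proof.
rewrite distrC ger0_norm ?onem_cos_ge0// le_min onem_cos_le2/=.
exact: onem_cos_le_norm.
Qed.

Lemma sin_le_min (R : realType) (x : R) : `|sin x| <= Num.min 2 `|x|.
Proof.
rewrite le_min sin_le_norm andbT (le_trans (sin_max _))//; lra.
Qed.

Lemma fv_integrable_re (R : realType) (nu : {measure set R -> \bar R}) (u : R) :
  fv_measure nu -> nu.-integrable setT (EFin \o (fun y : R => cos (u * y) - 1)).
Proof.
move=> fv; apply: (@fv_integrable _ _ _ (2 + `|u|)) => //.
  by apply: measurable_funB => //; exact: measurable_cosM.
by move=> y; rewrite (le_trans (cosB1_le_min _))// min_normM.
Qed.

Lemma fv_integrable_im (R : realType) (nu : {measure set R -> \bar R}) (u : R) :
  fv_measure nu -> nu.-integrable setT (EFin \o (fun y : R => sin (u * y))).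
Proof.
move=> fv; apply: (@fv_integrable _ _ _ (2 + `|u|)) => //.
  exact: measurable_sinM.
by move=> y; rewrite (le_trans (sin_le_min _))// min_normM.
Qed.

Lemma fv_re_le0 (R : realType) (nu : {measure set R -> \bar R}) (u : R) :
  fv_measure nu -> fv_re nu u <= 0.
Proof.
move=> fv; rewrite -oppr_ge0 /fv_re -[X in 0 <= X]mulN1r -RintegralZl//; last first.
  exact: fv_integrable_re.
apply: Rintegral_ge0 => y _; rewrite mulN1r opprB; exact: onem_cos_ge0.
Qed.

Lemma norm_Rintegral_le_integrable d (T : measurableType d) (R : realType)
    (mu : {measure set T -> \bar R}) (f g : T -> R) :
  mu.-integrable setT (EFin \o f) -> mu.-integrable setT (EFin \o g) ->
  (forall x, `|f x| <= g x) -> `|\int[mu]_x f x| <= \int[mu]_x g x.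
Proof.
move=> jf ig fg; apply: (le_trans (le_normr_Rintegral _ _)) => //.
by apply: le_Rintegral => //; exact: (integrable_norm jf).
Qed.

Lemma norm_Rintegral_le d (T : measurableType d) (R : realType)
    (mu : {measure set T -> \bar R}) (f g : T -> R) :
  measurable_fun setT f -> mu.-integrable setT (EFin \o g) ->
  (forall x, `|f x| <= g x) -> `|\int[mu]_x f x| <= \int[mu]_x g x.
Proof.
move=> mf ig fg; apply: norm_Rintegral_le_integrable => //.
exact: (integrable_dom _ _ ig).
Qed.

(** Both integrands are at most [min 2 |u y| <= (2/s + u) min s |y|]. Choosing [s] with
    [fv_mod nu s <= e] puts the slope below [e], at the price of the constant
    [A = (2/s) fv_mod nu s]. *)
Lemma fv_exponent_sublinear (R : realType) (nu : {measure set R -> \bar R}) (e : R) :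
  fv_measure nu -> 0 < e -> exists2 A : R, 0 <= A &
  forall u : R, 0 <= u -> `|fv_re nu u| <= A + e * u /\ `|fv_im nu u| <= A + e * u.
Proof.
move=> fv e0; have [s s0 hs] := fv_mod_small fv e0.
have ims : nu.-integrable setT (EFin \o (fun y : R => Num.min s `|y|)).
  by apply: fv_integrable_min => //; exact: ltW.
exists (2 / s * fv_mod nu s).
  by rewrite mulr_ge0 ?divr_ge0 ?(ltW s0)// fv_mod_ge0// ltW.
move=> u u0.
pose g (y : R) := (2 / s + u) * Num.min s `|y|.
have ig : nu.-integrable setT (EFin \o g).
  exact: (integrableZl measurableT _ ims).
have ming (y : R) : Num.min 2 `|u * y| <= g y.
  rewrite /g normrM (ger0_norm u0) (@minEle _ _ s).
  have y0 := normr_ge0 y.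
  case: ifPn; rewrite -?ltNge => h; rewrite mulrDl.
    rewrite divfK ?gt_eqF//; apply: (@le_trans _ _ 2).
      by rewrite ge_min lexx.
    by rewrite lerDl mulr_ge0// ltW.
  apply: (@le_trans _ _ (u * `|y|)); first by rewrite ge_min lexx orbT.
  by rewrite lerDr mulr_ge0// divr_ge0// ltW.
have gle : \int[nu]_y g y <= 2 / s * fv_mod nu s + e * u.
  rewrite RintegralZl// -/(fv_mod nu s) mulrDl lerD2l mulrC.
  by rewrite ler_wpM2r.
split; apply: le_trans gle; apply: norm_Rintegral_le => //.
- by apply: measurable_funB => //; exact: measurable_cosM.
- by move=> y; exact: le_trans (cosB1_le_min _) _.
- exact: measurable_sinM.
- by move=> y; exact: le_trans (sin_le_min _) _.
Qed.

(** * Small time expansions *)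

Lemma integrable_dom_lebesgue (R : realType) (f g : R -> R) :
  measurable_fun setT f -> (@lebesgue_measure R).-integrable setT (EFin \o g) ->
  (forall x, `|f x| <= g x) -> (@lebesgue_measure R).-integrable setT (EFin \o f).
Proof.
move=> mf ig fg.
exact: (@integrable_dom _ (measurableTypeR R) _ _ _ _ _ measurableT mf ig (fun x _ => fg x)).
Qed.

(** This is [max (|a| - |z|) 0], written as a second difference of absolute values so that the Fejer
    integral of [|z|] applies. *)
Definition tent (R : realType) (a z : R) : R :=
  (`|z + a| + `|z - a| - 2 * `|z|) / 2.

(** The truncated Fourier density of the tent: half the second difference in [z], with step [a], of
    [1 - cos (u z)] is [(1 - cos (u a)) cos (u z)]. *)
Definition tent_weight (R : realType) (a N u : R) : R :=
  \1_(`[0, N]%classic) u * ((1 - cos (u * a)) / u ^+ 2).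

Definition smooth_tent (R : realType) (a N z : R) : R :=
  \int[lebesgue_measure]_u (tent_weight a N u * cos (u * z)).

Lemma onem_cosM_div (R : realType) (a u : R) : (1 - cos (u * a)) / u ^+ 2 <= a ^+ 2.
Proof.
have [->|u0] := eqVneq u 0; first by rewrite mul0r cos0 subrr mul0r sqr_ge0.
by rewrite ler_pdivrMr ?exprn_even_gt0// -exprMn mulrC onem_cos_le_sqr// mulrC.
Qed.

Lemma tent_weight_ge0 (R : realType) (a N u : R) : 0 <= tent_weight a N u.
Proof. by rewrite !mulr_ge0 ?invr_ge0 ?sqr_ge0 ?onem_cos_ge0. Qed.

Lemma tent_weight_le (R : realType) (a N u : R) :
  tent_weight a N u <= a ^+ 2 * \1_(`[0, N]%classic) u.
Proof. by rewrite /tent_weight mulrC ler_wpM2r// onem_cosM_div. Qed.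

Lemma measurable_onem_cosM_div (R : realType) (a : R) :
  measurable_fun setT (fun u : R => (1 - cos (u * a)) / u ^+ 2).
Proof.
apply: measurable_funM; last exact: measurable_invX2.
apply: measurable_funB => //; apply: (measurableT_comp (@measurable_cos R)).
exact: mulrr_measurable.
Qed.

Lemma measurable_tent_weight (R : realType) (a N : R) :
  measurable_fun setT (@tent_weight R a N).
Proof.
apply: measurable_funM; first exact: measurable_indic.
exact: measurable_onem_cosM_div.
Qed.

Lemma integrable_indic_cst (R : realType) (C N : R) :
  (@lebesgue_measure R).-integrable setT
    (EFin \o (fun u => C * \1_(`[0, N]%classic) u)).
Proof. exact: (integrableZl measurableT C (integrable_indic_itv 0 N true false)). Qed.

Lemma smooth_tentE (R : realType) (a N z : R) : 0 <= N ->
  smooth_tent a N z =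
  fejer_cst R * ((kink N (z + a) + kink N (z - a) - 2 * kink N z) / 2).
Proof.
move=> N0; have c0 := fejer_cst_gt0 R.
pose q (z u : R) := (1 - cos (u * z)) / u ^+ 2.
have iq z' : lebesgue_measure.-integrable `[0, N] (EFin \o q z').
  apply: (@integrable_bounded_itv _ _ _ _ (z' ^+ 2)).
    exact: measurable_onem_cosM_div.
  move=> u; rewrite ger0_norm ?onem_cosM_div//.
  by rewrite divr_ge0 ?sqr_ge0 ?onem_cos_ge0.
have -> : fejer_cst R * ((kink N (z + a) + kink N (z - a) - 2 * kink N z) / 2) =
  \int[lebesgue_measure]_(u in `[0, N]) q (z + a) u / 2 +
  \int[lebesgue_measure]_(u in `[0, N]) q (z - a) u / 2 -
  \int[lebesgue_measure]_(u in `[0, N]) q z u.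
  rewrite /kink -/(q (z + a)) -/(q (z - a)) -/(q z).
  by field; rewrite gt_eqF.
rewrite -!RintegralZr//.
have iq2 z' : lebesgue_measure.-integrable `[0, N] (EFin \o (fun u => q z' u / 2)).
  exact: (integrableZr _ _ (iq z')).
rewrite -RintegralD// -RintegralB//; last exact: (integrableD _ (iq2 _) (iq2 _)).
rewrite /smooth_tent [RHS]Rintegral_mkcond; apply: eq_Rintegral => u _.
rewrite /tent_weight /patch indicE; case: ifPn => _ /=; last by rewrite !mul0r.
rewrite mul1r /q mulrDr mulrBr cosD cosB.
by move: (u ^- 2) (cos _) (cos _) (sin _) (sin _) => i *; field.
Qed.

Lemma smooth_tent_dist (R : realType) (a N z : R) : 0 < N ->
  `|(fejer_cst R)^-1 * smooth_tent a N z - tent a z| <= 4 / (fejer_cst R * N).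
Proof.
move=> N0; have c0 := fejer_cst_gt0 R.
rewrite (smooth_tentE _ _ (ltW N0)) mulKf ?gt_eqF// /tent.
have -> : 4 / (fejer_cst R * N) = 2 * (2 / (fejer_cst R * N)) by ring.
have h1 := kink_ge (z + a) N0; have h2 := kink_ge (z - a) N0; have h3 := kink_ge z N0.
have k1 := kink_le (z + a) (ltW N0); have k2 := kink_le (z - a) (ltW N0).
have k3 := kink_le z (ltW N0).
move: h1 h2 h3 k1 k2 k3; move: (2 / _) `|z + a| `|z - a| `|z| (kink _ _) (kink _ _) (kink _ _).
by move=> b x1 x2 x3 y1 y2 y3 *; rewrite ler_norml; apply/andP; split; lra.
Qed.

Lemma tent_lip (R : realType) (a x y : R) : `|tent a y - tent a x| <= 2 * `|y - x|.
Proof.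
rewrite /tent.
have h1 : `| `|y + a| - `|x + a| | <= `|y - x|.
  by rewrite (le_trans (ler_dist_dist _ _))// opprD addrACA subrr addr0.
have h2 : `| `|y - a| - `|x - a| | <= `|y - x|.
  by rewrite (le_trans (ler_dist_dist _ _))// (_ : y - a - (x - a) = y - x)//; ring.
have h3 : `| `|y| - `|x| | <= `|y - x| by exact: ler_dist_dist.
move: h1 h2 h3; rewrite !ler_norml => /andP[? ?] /andP[? ?] /andP[? ?].
by apply/andP; split; lra.
Qed.

Lemma smooth_tent_lip (R : realType) (a N x y : R) : 0 < N ->
  `|(fejer_cst R)^-1 * smooth_tent a N y - (fejer_cst R)^-1 * smooth_tent a N x| <=
  2 * (1 + (fejer_cst R)^-1) * `|y - x|.
Proof.
move=> N0; have c0 := fejer_cst_gt0 R.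
rewrite !(smooth_tentE _ _ (ltW N0)) !mulKf ?gt_eqF//.
have h1 := kink_lip (x + a) (y + a) N0.
have h2 := kink_lip (x - a) (y - a) N0.
have h3 := kink_lip x y N0.
have e1 : y + a - (x + a) = y - x by ring.
have e2 : y - a - (x - a) = y - x by ring.
move: h1 h2 h3; rewrite e1 e2 -[2 * _ * _]mulrA.
move: ((1 + _) * _) => b.
rewrite !ler_norml => /andP[? ?] /andP[? ?] /andP[? ?].
by apply/andP; split; lra.
Qed.

Lemma lip_measurable (R : realType) (f : R -> R) (L : R) :
  (forall x y, `|f y - f x| <= L * `|y - x|) -> measurable_fun setT f.
Proof.
move=> fL; apply: continuous_measurable_fun => x.
apply/cvgrPdist_le => e e0; near=> y.
rewrite distrC (le_trans (fL _ _))//.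
apply: (@le_trans _ _ ((`|L| + 1) * `|y - x|)).
  by rewrite ler_wpM2r// (le_trans (ler_norm _))// lerDl.
have L0 : 0 < `|L| + 1 by rewrite ltr_wpDl.
rewrite -ler_pdivlMl// mulrC distrC; near: y.
by apply: cvgr_dist_le => //; rewrite divr_gt0.
Unshelve. all: by end_near. Qed.

(* [W] has the characteristic function at time [h] of a finite variation Levy
   process with drift [c] and Levy measure [nu]; the phase [t] packs the real and
   imaginary parts into one identity. *)
Definition levy_cf (R : realType) (nu : {measure set R -> \bar R})
    d (Omega : measurableType d) (P : probability Omega R) (c h : R)
    (W : Omega -> R) : Prop :=
  measurable_fun setT W /\
  forall u t, \int[P]_w cos (u * W w + t) =
    expR (h * fv_re nu u) * cos (h * fv_im nu u + (u * (c * h) + t)).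

Lemma integrable_bounded d (T : measurableType d) (R : realType)
    (P : probability T R) (f : T -> R) (C : R) :
  measurable_fun setT f -> (forall w, `|f w| <= C) ->
  P.-integrable setT (EFin \o f).
Proof.
move=> mf fC; apply: measurable_bounded_integrable => //.
  exact: (fin_num_fun_lty (fin_num_measure P)).
exists C; split; first exact: num_real.
by move=> M CM z _ /=; rewrite (le_trans (fC z))// ltW.
Qed.

(** The threshold [u = A / e] is where the two parts of [A + e u] balance. Below it the square is at
    most [4 A^2] and the weight at most [a^2]; above it the square is at most [4 e^2 u^2], and [u^2]
    cancels against the denominator of the weight. *)
Lemma tent_weight_exponent (R : realType) (a N A e u : R) : 0 <= A -> 0 < e ->
  tent_weight a N u * (A + e * u) ^+ 2 <=
  4 * A ^+ 2 * a ^+ 2 * \1_(`[0, A / e]%classic) u +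
  8 * e ^+ 2 * \1_(`[0, N]%classic) u.
Proof.
move=> A0 e0; rewrite /tent_weight !indicE !mem_setE !in_itv/=.
case: (boolP (0 <= u <= N)) => [/andP[u0 uN]|_]; last first.
  rewrite !mul0r mulr0 addr0; move: (sqr_ge0 A) (sqr_ge0 a).
  by move: (A ^+ 2) (a ^+ 2) => p q p0 q0; rewrite !mulr_ge0.
rewrite mul1r mulr1 u0/= ler_pdivlMr//.
have q0 : 0 <= (1 - cos (u * a)) / u ^+ 2 by rewrite divr_ge0 ?sqr_ge0 ?onem_cos_ge0.
case: (leP (u * e) A) => h.
  apply: (@le_trans _ _ (a ^+ 2 * (4 * A ^+ 2))).
    rewrite ler_pM ?sqr_ge0 ?onem_cosM_div//.
    have -> : 4 * A ^+ 2 = (2 * A) ^+ 2 by ring.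
    by rewrite lerXn2r ?nnegrE ?addr_ge0 ?mulr_ge0 ?(ltW e0)//; lra.
  have : 0 <= e ^+ 2 by exact: sqr_ge0.
  by rewrite mulr1; lra.
have up : 0 < u by rewrite -(pmulr_lgt0 _ e0) (le_lt_trans A0 h).
apply: (@le_trans _ _ (2 / u ^+ 2 * (2 * (e * u)) ^+ 2)).
  rewrite ler_pM ?sqr_ge0//; first by rewrite ler_wpM2r ?invr_ge0 ?sqr_ge0// onem_cos_le2.
  by rewrite lerXn2r ?nnegrE ?addr_ge0 ?mulr_ge0 ?(ltW e0)//; lra.
rewrite mulr0 add0r le_eqVlt; apply/orP; left; apply/eqP.
by field; rewrite gt_eqF.
Qed.

(** After exchanging integrals, each frequency contributes the second-order remainder of
    [e^(h psi)], controlled by [expR_cos_taylor]. The constant [C] is fixed before [N] and [h], and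
    the dependence on [N] is linear with the small factor [e^2]; this permits [N] of order
    [1 / h]. *)
Lemma tent_fourier (R : realType) (nu : {sigma_finite_measure set R -> \bar R})
    (a e : R) : fv_measure nu -> 0 < e -> exists2 C : R, 0 <= C &
  forall d (Omega : measurableType d) (P : probability Omega R) (W : Omega -> R)
    (c h N x : R), 0 < h -> 0 < N -> levy_cf nu P c h W ->
  `| \int[P]_w smooth_tent a N (W w - x) - smooth_tent a N (c * h - x) -
     h * \int[nu]_y (smooth_tent a N (c * h + y - x) - smooth_tent a N (c * h - x)) |
  <= h ^+ 2 * (C + 32 * e ^+ 2 * N).
Proof.
move=> fv e0; have [A A0 hA] := fv_exponent_sublinear fv e0.
(* Four times the integral of the first term of [tent_weight_exponent]; the [32] of the statement is
   four times the [8] of its second term. The factor four is [2] from the Taylor bound times two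
   squares, real and imaginary. *)
exists (16 * A ^+ 2 * a ^+ 2 * (A / e)).
  move: (sqr_ge0 A) (sqr_ge0 a) (divr_ge0 A0 (ltW e0)).
  by move: (A ^+ 2) (a ^+ 2) (A / e) => *; rewrite !mulr_ge0.
move=> d Omega P W c h N x h0 N0 [mW cfW].
pose rho := @tent_weight R a N.
pose th u := u * (c * h - x).
have mrho : measurable_fun setT rho by exact: measurable_tent_weight.
have irho : (@lebesgue_measure R).-integrable setT (EFin \o rho).
  apply: (integrable_dom_lebesgue mrho (integrable_indic_cst (a ^+ 2) N)).
  by move=> u; rewrite ger0_norm ?tent_weight_ge0// tent_weight_le.
have mcos d' (T : measurableType d') (g : T -> R) : measurable_fun setT g ->
    measurable_fun setT (fun z => cos (g z)).
  exact: (measurableT_comp (@measurable_cos R)).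
have irhoc z : (@lebesgue_measure R).-integrable setT (EFin \o (fun u => rho u * cos (u * z))).
  apply: (integrable_dom_lebesgue _ irho).
    by apply: measurable_funM => //; apply: mcos; exact: mulrr_measurable.
  move=> u; rewrite normrM ger0_norm ?tent_weight_ge0//.
  by rewrite ler_piMr ?tent_weight_ge0// cos_max.
pose f1 u w := rho u * cos (u * (W w - x)).
have mf1 : measurable_fun setT (fun z : R * Omega => f1 z.1 z.2).
  apply: measurable_funM; first exact: measurableT_comp.
  apply: mcos; apply: measurable_funM => //.
  by apply: measurable_funB => //; exact: measurableT_comp.
have i1 : P.-integrable setT (EFin \o (fun=> 1)).
  by apply: (@integrable_bounded _ _ _ _ _ 1) => // w; rewrite normr1.
have b1 u w : `|f1 u w| <= rho u * 1.
  rewrite normrM ger0_norm ?tent_weight_ge0//.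
  by rewrite ler_wpM2l ?tent_weight_ge0// cos_max.
have E1 : \int[P]_w smooth_tent a N (W w - x) =
    \int[lebesgue_measure]_u \int[P]_w f1 u w.
  exact/esym/(@Rintegral_exchange _ _ _ _ _ (@lebesgue_measure R) P f1 rho (fun=> 1)).
have I1 : (@lebesgue_measure R).-integrable setT (EFin \o (fun u => \int[P]_w f1 u w)).
  exact: (@integrable_Rintegral1 _ _ _ _ _ (@lebesgue_measure R) P f1 rho (fun=> 1)).
have F1 u : \int[P]_w f1 u w = rho u * (expR (h * fv_re nu u) * cos (h * fv_im nu u + th u)).
  rewrite /f1 RintegralZl//; last first.
    apply: (@integrable_bounded _ _ _ _ _ 1); last by move=> w; exact: cos_max.
    by apply: mcos; apply: measurable_funM => //; exact: measurable_funB.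
  congr *%R; have := cfW u (- (u * x)).
  rewrite /th mulrBr => <-; apply: eq_Rintegral => w _.
  by rewrite mulrBr.
pose f2 u y := rho u * (cos (u * (c * h + y - x)) - cos (u * (c * h - x))).
have mf2 : measurable_fun setT (fun z : R * R => f2 z.1 z.2).
  apply: measurable_funM; first exact: measurableT_comp.
  apply: measurable_funB; apply: mcos; apply: measurable_funM => //.
  by apply: measurable_funB => //; exact: measurable_funD.
have icut : (@lebesgue_measure R).-integrable setT
    (EFin \o (fun u => a ^+ 2 * (2 + N) * \1_(`[0, N]%classic) u)).
  exact: integrable_indic_cst.
have b2 u y : `|f2 u y| <= a ^+ 2 * (2 + N) * \1_(`[0, N]%classic) u * Num.min 1 `|y|.
  rewrite normrM ger0_norm ?tent_weight_ge0// /rho /tent_weight indicE mem_setE in_itv/=.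
  case: (boolP (0 <= u <= N)) => [/andP[u0 uN]|_]; last by rewrite !(mul0r, mulr0).
  rewrite mul1r mulr1 -mulrA ler_pM ?onem_cosM_div//.
    by rewrite divr_ge0 ?sqr_ge0 ?onem_cos_ge0.
  have m0 : 0 <= Num.min 1 `|y| by rewrite le_min ler01/=.
  apply: (@le_trans _ _ ((2 + `|u|) * Num.min 1 `|y|)).
    apply: le_trans (min_normM u y); rewrite le_min; apply/andP; split.
      by rewrite (le_trans (ler_normB _ _))// (_ : 2 = 1 + 1)// lerD// cos_max.
    apply: (le_trans (cos_lip _ _)); rewrite -mulrBr.
    by rewrite (_ : c * h + y - x - (c * h - x) = y)//; ring.
  by rewrite ler_wpM2r// lerD2l ger0_norm.
have E2 : \int[nu]_y (smooth_tent a N (c * h + y - x) - smooth_tent a N (c * h - x)) =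
    \int[lebesgue_measure]_u \int[nu]_y f2 u y.
  rewrite (@Rintegral_exchange _ _ _ _ _ (@lebesgue_measure R) nu f2 _ (fun y => Num.min 1 `|y|) mf2 icut fv b2).
  apply: eq_Rintegral => y _; rewrite /smooth_tent -RintegralB//.
  by apply: eq_Rintegral => u _; rewrite /f2 [RHS]mulrBr.
have I2 : (@lebesgue_measure R).-integrable setT (EFin \o (fun u => \int[nu]_y f2 u y)).
  exact: (@integrable_Rintegral1 _ _ _ _ _ (@lebesgue_measure R) nu f2 _ (fun y => Num.min 1 `|y|) mf2 icut fv b2).
have F2 u : \int[nu]_y f2 u y = rho u * (fv_re nu u * cos (th u) - fv_im nu u * sin (th u)).
  have ir := fv_integrable_re u fv; have ii := fv_integrable_im u fv.
  have ir' : nu.-integrable setT (EFin \o (fun y => (cos (u * y) - 1) * cos (th u))).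
    exact: (integrableZr measurableT _ ir).
  have ii' : nu.-integrable setT (EFin \o (fun y => sin (u * y) * sin (th u))).
    exact: (integrableZr measurableT _ ii).
  rewrite /fv_re /fv_im -!RintegralZr// -RintegralB// -RintegralZl//; last first.
    exact: (integrableB measurableT ir' ii').
  apply: eq_Rintegral => y _; rewrite /f2 /th; congr *%R.
  have -> : u * (c * h + y - x) = u * y + u * (c * h - x) by ring.
  by rewrite cosD; ring.
have I0 := irhoc (c * h - x).
have I2h : (@lebesgue_measure R).-integrable setT (EFin \o (fun u => h * \int[nu]_y f2 u y)).
  exact: (integrableZl measurableT h I2).
have I10 : (@lebesgue_measure R).-integrable setT
    (EFin \o (fun u => \int[P]_w f1 u w - rho u * cos (u * (c * h - x)))).
  exact: (integrableB measurableT I1 I0).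
rewrite E1 E2 -RintegralZl// /smooth_tent -/rho -RintegralB// -RintegralB//.
pose B u := h ^+ 2 * (4 * (4 * A ^+ 2 * a ^+ 2 * \1_(`[0, A / e]%classic) u +
  8 * e ^+ 2 * \1_(`[0, N]%classic) u)).
have iB1 := integrable_indic_cst (4 * A ^+ 2 * a ^+ 2) (A / e).
have iB2 := integrable_indic_cst (8 * e ^+ 2) N.
have iB12 : (@lebesgue_measure R).-integrable setT (EFin \o (fun u : R =>
    4 * A ^+ 2 * a ^+ 2 * \1_(`[0, A / e]%classic) u + 8 * e ^+ 2 * \1_(`[0, N]%classic) u)).
  exact: (integrableD measurableT iB1 iB2).
have iB124 : (@lebesgue_measure R).-integrable setT (EFin \o (fun u : R =>
    4 * (4 * A ^+ 2 * a ^+ 2 * \1_(`[0, A / e]%classic) u + 8 * e ^+ 2 * \1_(`[0, N]%classic) u))).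
  exact: (integrableZl measurableT 4 iB12).
have iB : (@lebesgue_measure R).-integrable setT (EFin \o B).
  exact: (integrableZl measurableT (h ^+ 2) iB124).
apply: (@le_trans _ _ (\int[lebesgue_measure]_u B u)).
  apply: norm_Rintegral_le_integrable => //.
    exact: (integrableB measurableT I10 I2h).
  move=> u; rewrite F1 F2.
  have -> : rho u * (expR (h * fv_re nu u) * cos (h * fv_im nu u + th u)) -
      rho u * cos (u * (c * h - x)) -
      h * (rho u * (fv_re nu u * cos (th u) - fv_im nu u * sin (th u))) =
    rho u * (expR (h * fv_re nu u) * cos (h * fv_im nu u + th u) - cos (th u) -
      (h * fv_re nu u * cos (th u) - h * fv_im nu u * sin (th u))).
    by rewrite /th; ring.
  rewrite normrM (ger0_norm (tent_weight_ge0 _ _ _)).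
  have [u0|u0] := leP 0 u; last first.
    have -> : tent_weight a N u = 0.
      by rewrite /tent_weight indicE mem_setE in_itv/= [0 <= u]leNgt u0 mul0r.
    rewrite mul0r /B !indicE.
    move: (sqr_ge0 h) (sqr_ge0 A) (sqr_ge0 a) (sqr_ge0 e).
    move: (h ^+ 2) (A ^+ 2) (a ^+ 2) (e ^+ 2) => *.
    by rewrite mulr_ge0// mulr_ge0// addr_ge0// !mulr_ge0.
  have [ha hb] := hA u u0.
  apply: (@le_trans _ _ (rho u * (2 * ((h * fv_re nu u) ^+ 2 + (h * fv_im nu u) ^+ 2)))).
    rewrite ler_wpM2l ?tent_weight_ge0//; apply: expR_cos_taylor.
    by rewrite pmulr_rle0// fv_re_le0.
  have AE0 : 0 <= A + e * u by rewrite addr_ge0// mulr_ge0// ltW.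
  have sq (z : R) : `|z| <= A + e * u -> z ^+ 2 <= (A + e * u) ^+ 2.
    by move=> zA; rewrite -(real_normK (num_real z)) lerXn2r ?nnegrE.
  have := tent_weight_exponent a N u A0 e0; rewrite -/rho /B.
  move: (_ + 8 * _ * _) => b hb'.
  apply: (@le_trans _ _ (h ^+ 2 * (4 * (rho u * (A + e * u) ^+ 2)))); last first.
    by rewrite ler_wpM2l ?sqr_ge0// ler_wpM2l.
  have -> : h ^+ 2 * (4 * (rho u * (A + e * u) ^+ 2)) =
    rho u * (h ^+ 2 * (4 * (A + e * u) ^+ 2)) by ring.
  rewrite ler_wpM2l ?tent_weight_ge0//.
  have -> : 2 * ((h * fv_re nu u) ^+ 2 + (h * fv_im nu u) ^+ 2) =
    h ^+ 2 * (2 * (fv_re nu u ^+ 2 + fv_im nu u ^+ 2)) by ring.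
  rewrite ler_wpM2l ?sqr_ge0//; have := sq _ ha; have := sq _ hb; lra.
have indicI (M : R) : 0 <= M -> \int[lebesgue_measure]_u \1_(`[0, M]%classic) u = M :> R.
  move=> M0; rewrite -[RHS]mul1r -[X in 1 * X](subr0 M) -(Rintegral_itv_cst 1 true false M0).
  rewrite [RHS]Rintegral_mkcond; apply: eq_Rintegral => u _.
  by rewrite /patch indicE; case: ifP.
rewrite /B !RintegralZl// RintegralD// !RintegralZl//; last 2 first.
- exact: (integrable_indic_itv 0 N true false).
- exact: (integrable_indic_itv 0 (A / e) true false).
rewrite !indicI ?divr_ge0 ?(ltW e0) ?(ltW N0)//.
by rewrite le_eqVlt; apply/orP; left; apply/eqP; ring.
Qed.

(** * Test functions, stability of the expansion, and the tents *)

Definition bounded_lip (R : realType) (g : R -> R) : Prop :=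
  exists2 C : R, (forall z, `|g z| <= C) & forall x y, `|g y - g x| <= C * `|y - x|.

Lemma bounded_lip_measurable (R : realType) (g : R -> R) :
  bounded_lip g -> measurable_fun setT g.
Proof. by case=> C _; exact: lip_measurable. Qed.

Lemma bounded_lipD (R : realType) (f g : R -> R) :
  bounded_lip f -> bounded_lip g -> bounded_lip (fun z => f z + g z).
Proof.
move=> [C fC fL] [D gD gL]; exists (C + D) => [z|x y].
  by rewrite (le_trans (ler_normD _ _))// lerD.
by rewrite opprD addrACA mulrDl (le_trans (ler_normD _ _))// lerD.
Qed.

Lemma bounded_lipZ (R : realType) (k : R) (f : R -> R) :
  bounded_lip f -> bounded_lip (fun z => k * f z).
Proof.
move=> [C fC fL]; exists (`|k| * C) => [z|x y]; first by rewrite normrM ler_wpM2l.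
by rewrite -mulrBr normrM -mulrA ler_wpM2l.
Qed.

Lemma bounded_lip_cst (R : realType) (k : R) : bounded_lip (fun _ : R => k).
Proof.
exists `|k| => [//|x y]; rewrite subrr normr0 mulr_ge0//.
Qed.

Lemma bounded_lip_shift (R : realType) (q : R) (g : R -> R) :
  bounded_lip g -> bounded_lip (fun z => g (z + q)).
Proof.
move=> [C gC gL]; exists C => [//|x y].
by rewrite (le_trans (gL _ _))// opprD addrACA subrr addr0.
Qed.

(** Since [nu] may be infinite, [g] alone need not be integrable; boundedness and the Lipschitz
    property make [g - g 0] a multiple of [min 1 |y|] at most. *)
Lemma bounded_lip_integrable (R : realType) (nu : {measure set R -> \bar R})
    (g : R -> R) : fv_measure nu -> bounded_lip g ->
  nu.-integrable setT (EFin \o (fun y => g y - g 0)).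
Proof.
move=> fv bg; have [C gC gL] := bg.
apply: (@fv_integrable _ _ _ (2 * C)) => //.
  by apply: measurable_funB => //; exact: bounded_lip_measurable.
move=> y; have C0 : 0 <= C := le_trans (normr_ge0 _) (gC 0).
have h1 : `|g y - g 0| <= 2 * C.
  by rewrite (le_trans (ler_normB _ _))// mulrDl mul1r lerD.
have h2 : `|g y - g 0| <= C * `|y| by have := gL 0 y; rewrite subr0.
rewrite /Num.min; case: ifP => _; first by rewrite mulr1.
apply: (le_trans h2); have := normr_ge0 y; nra.
Qed.

Lemma bounded_lip_integrable_comp (R : realType) d (Omega : measurableType d)
    (P : probability Omega R) (W : Omega -> R) (g : R -> R) :
  measurable_fun setT W -> bounded_lip g -> P.-integrable setT (EFin \o (fun w => g (W w))).
Proof.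
move=> mW bg; have [C gC _] := bg; apply: (@integrable_bounded _ _ _ _ _ C) => //.
exact: (measurableT_comp (bounded_lip_measurable bg)).
Qed.

Lemma probability_Rintegral_cst d (Omega : measurableType d) (R : realType)
    (P : probability Omega R) (k : R) : \int[P]_w k = k.
Proof.
rewrite Rintegral_cst//; have -> : fine (P setT) = 1 by rewrite probability_setT.
by rewrite mulr1.
Qed.

(* [E g(W_h) = g(ch) + h * int (g(y) - g(0)) nu(dy) + o(h)], uniformly over all
   variables [W_h] with the prescribed characteristic function *)
Definition small_time (R : realType) (nu : {measure set R -> \bar R})
    d (Omega : measurableType d) (P : probability Omega R) (c : R) (g : R -> R) : Prop :=
  bounded_lip g /\
  forall e : R, 0 < e -> exists2 h0 : R, 0 < h0 &
  forall (h : R) W, 0 < h -> h < h0 -> levy_cf nu P c h W ->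
  `| \int[P]_w g (W w) - g (c * h) - h * \int[nu]_y (g y - g 0) | <= e * h.

Section small_time.
Context (R : realType) (nu : {sigma_finite_measure set R -> \bar R}).
Context d (Omega : measurableType d) (P : probability Omega R).
Variable c : R.
Hypothesis fv : fv_measure nu.

Lemma small_timeD (f g : R -> R) : small_time nu P c f -> small_time nu P c g ->
  small_time nu P c (fun z => f z + g z).
Proof.
move=> [bf hf] [bg hg]; split; first exact: bounded_lipD.
move=> e e0; have e20 : 0 < e / 2 by rewrite divr_gt0.
have [h1 h10 H1] := hf _ e20; have [h2 h20 H2] := hg _ e20.
exists (Num.min h1 h2); first by rewrite lt_min h10.
move=> h W h0; rewrite lt_min => /andP[hh1 hh2] cf.
have := H1 h W h0 hh1 cf; have := H2 h W h0 hh2 cf.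
have [mW _] := cf.
have -> : \int[nu]_y (f y + g y - (f 0 + g 0)) =
    \int[nu]_y (f y - f 0) + \int[nu]_y (g y - g 0).
  rewrite -RintegralD//; first by apply: eq_Rintegral => y _; ring.
  - exact: bounded_lip_integrable.
  - exact: bounded_lip_integrable.
have -> : \int[P]_w (f (W w) + g (W w)) = \int[P]_w f (W w) + \int[P]_w g (W w).
  by rewrite RintegralD//; exact: bounded_lip_integrable_comp.
move: (\int[P]_w f _) (\int[P]_w g _) (\int[nu]_y (f _ - _)) (\int[nu]_y (g _ - _)).
move=> p q r s; rewrite !ler_norml => /andP[? ?] /andP[? ?].
by apply/andP; split; lra.
Qed.

Lemma small_timeZ (k : R) (f : R -> R) : small_time nu P c f ->
  small_time nu P c (fun z => k * f z).
Proof.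
move=> [bf hf]; split; first exact: bounded_lipZ.
move=> e e0; have k0 : 0 < `|k| + 1 by rewrite ltr_wpDl.
have [h1 h10 H1] := hf _ (divr_gt0 e0 k0).
exists h1 => // h W h0 hh1 cf; have := H1 h W h0 hh1 cf.
have [mW _] := cf.
have -> : \int[nu]_y (k * f y - k * f 0) = k * \int[nu]_y (f y - f 0).
  rewrite -RintegralZl//; first by apply: eq_Rintegral => y _; ring.
  exact: bounded_lip_integrable.
rewrite RintegralZl//; last exact: bounded_lip_integrable_comp.
move: (\int[P]_w f _) (\int[nu]_y (f _ - _)) => p r H.
have -> : k * p - k * f (c * h) - h * (k * r) = k * (p - f (c * h) - h * r) by ring.
rewrite normrM; apply: (@le_trans _ _ ((`|k| + 1) * (e / (`|k| + 1) * h))).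
  by rewrite ler_pM// lerDl.
by rewrite le_eqVlt; apply/orP; left; apply/eqP; field; rewrite gt_eqF.
Qed.

Lemma small_time_cst (k : R) : small_time nu P c (fun _ => k).
Proof.
split; first exact: bounded_lip_cst.
move=> e e0; exists 1 => // h W h0 _ _.
have -> : \int[nu]_y (k - k) = 0.
  rewrite (_ : (fun _ => _) = (fun=> 0)); last by apply/funext => y; rewrite subrr.
  by rewrite Rintegral_cst// mul0r.
rewrite probability_Rintegral_cst subrr mulr0 subrr normr0.
by rewrite mulr_ge0// ltW.
Qed.

Lemma small_timeB (f g : R -> R) : small_time nu P c f -> small_time nu P c g ->
  small_time nu P c (fun z => f z - g z).
Proof.
move=> sf sg; have := small_timeD sf (small_timeZ (-1) sg).
by congr (small_time _ _ _ _); apply/funext => z; rewrite mulN1r.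
Qed.

(** The leading terms of the three expansions coincide because the functions agree at [c h]; the
    terms linear in [h] differ by at most [e h]. Agreement for [h = 0] orders the differences
    [g - g 0] under [nu]. *)
Lemma small_time_sandwich (g : R -> R) : bounded_lip g ->
  (forall e : R, 0 < e -> exists g1 g2, [/\ small_time nu P c g1, small_time nu P c g2,
    (forall z, g1 z <= g z <= g2 z),
    (exists2 h1 : R, 0 < h1 & forall h : R, 0 <= h -> h < h1 ->
      g1 (c * h) = g (c * h) /\ g2 (c * h) = g (c * h)) &
    \int[nu]_y (g2 y - g2 0) <= \int[nu]_y (g1 y - g1 0) + e]) ->
  small_time nu P c g.
Proof.
move=> bg hyp; split => // e e0; have e20 : 0 < e / 2 by rewrite divr_gt0.
have [g1 [g2 [[b1 s1] [b2 s2] g12 [h1 h10 geq] int12]]] := hyp _ e20.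
have [h2 h20 H2] := s1 _ e20; have [h3 h30 H3] := s2 _ e20.
exists (Num.min h1 (Num.min h2 h3)); first by rewrite !lt_min h10 h20.
move=> h W h0; rewrite !lt_min => /and3P[hh1 hh2 hh3] cf.
have [mW _] := cf.
have [e1 e2] := geq h (ltW h0) hh1.
have [e10 e20'] := geq 0 (lexx _) h10; rewrite mulr0 in e10 e20'.
have := H2 h W h0 hh2 cf; have := H3 h W h0 hh3 cf.
have P1 : \int[P]_w g1 (W w) <= \int[P]_w g (W w).
  apply: le_Rintegral => //; try exact: bounded_lip_integrable_comp.
  by move=> w _; have /andP[] := g12 (W w).
have P2 : \int[P]_w g (W w) <= \int[P]_w g2 (W w).
  apply: le_Rintegral => //; try exact: bounded_lip_integrable_comp.
  by move=> w _; have /andP[] := g12 (W w).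
have N1 : \int[nu]_y (g1 y - g1 0) <= \int[nu]_y (g y - g 0).
  apply: le_Rintegral => //; try exact: bounded_lip_integrable.
  by move=> y _; rewrite e10 lerB//; have /andP[] := g12 y.
have N2 : \int[nu]_y (g y - g 0) <= \int[nu]_y (g2 y - g2 0).
  apply: le_Rintegral => //; try exact: bounded_lip_integrable.
  by move=> y _; rewrite e20' lerB//; have /andP[] := g12 y.
move: P1 P2 N1 N2 int12; rewrite e1 e2.
move: (\int[P]_w g1 _) (\int[P]_w g2 _) (\int[P]_w g _).
move: (\int[nu]_y (g1 _ - _)) (\int[nu]_y (g2 _ - _)) (\int[nu]_y (g _ - _)).
move=> n1 n2 n p1 p2 p P1 P2 N1 N2 N12.
have M1 := ler_wpM2l (ltW h0) N1; have M2 := ler_wpM2l (ltW h0) N2.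
have M3 := ler_wpM2l (ltW h0) N12.
rewrite !ler_norml => /andP[? ?] /andP[? ?].
by apply/andP; split; nra.
Qed.

Lemma tent_ge0 (a z : R) : 0 <= tent a z.
Proof.
rewrite /tent divr_ge0// subr_ge0.
have := ler_normD (z + a) (z - a).
by rewrite addrACA subrr addr0 -mulr2n normrMn mulr_natl.
Qed.

Lemma tent_le (a z : R) : tent a z <= `|a|.
Proof.
rewrite /tent ler_pdivrMr//.
have := ler_normD z a; have := ler_normB z a; lra.
Qed.

Lemma bounded_lip_tent (a x : R) : bounded_lip (fun z => tent a (z - x)).
Proof.
exists (`|a| + 2) => [z|y z].
  by rewrite ger0_norm ?tent_ge0// (le_trans (tent_le _ _))// lerDl.
apply: (le_trans (tent_lip _ _ _)); rewrite opprB addrA subrK.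
by rewrite ler_wpM2r// lerDr.
Qed.

Lemma small_time_tent (a x : R) : small_time nu P c (fun z => tent a (z - x)).
Proof.
split; first exact: bounded_lip_tent.
move=> e e0; pose g z := tent a (z - x).
have c0 := fejer_cst_gt0 R; set ci := (fejer_cst R)^-1.
have ci0 : 0 < ci by rewrite invr_gt0.
(* With [N = 1 / (eta h)], this makes the smoothing error [b = 4 ci / N] equal to [e h / 10]. *)
pose eta := e / (40 * ci); have eta0 : 0 < eta by rewrite divr_gt0// mulr_gt0.
(* Chosen so that [32 ci e'^2 / eta <= e / 5] once [e'^2 <= q]: the part of the Fourier remainder
   that is linear in [N]. *)
pose q := e * eta / (160 * ci); have q0 : 0 < q by rewrite divr_gt0// mulr_gt0.
pose e' := Num.min 1 q; have e'0 : 0 < e' by rewrite lt_min ltr01.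
have e'q : e' ^+ 2 <= q.
  rewrite expr2 (le_trans (ler_piMr (ltW e'0) _))// ge_min lexx ?orbT//.
have [C C0 HC] := tent_fourier a fv e'0.
(* A Lipschitz constant of smoothed tent minus tent, independent of [N] and therefore of [h]. *)
pose L := 2 * (1 + ci) + 2; have L0 : 0 < L by rewrite /L; lra.
have [s1 s10 hs1] := fv_mod_small fv (divr_gt0 e0 (mulr_gt0 (ltr0n R 5) L0)).
have [s2 s20 hs2] := fv_mod_small fv (divr_gt0 e0 (ltr0n R 20)).
pose h1 := e / (5 * (ci * C + 1)).
have ciC0 : 0 < ci * C + 1 by rewrite ltr_wpDl// mulr_ge0// ltW.
have h10 : 0 < h1 by rewrite divr_gt0// mulr_gt0.
pose h2 := 5 * s1 / e; have h20 : 0 < h2 by rewrite divr_gt0// mulr_gt0.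
pose h3 := s2 / (`|c| + 1).
have cc0 : 0 < `|c| + 1 by rewrite ltr_wpDl.
have h30 : 0 < h3 by rewrite divr_gt0.
exists (Num.min h1 (Num.min h2 h3)); first by rewrite !lt_min h10 h20.
move=> h W h0; rewrite !lt_min => /and3P[hh1 hh2 hh3] cf.
have [mW _] := cf.
pose N := (eta * h)^-1; have N0 : 0 < N by rewrite invr_gt0 mulr_gt0.
pose st z := ci * smooth_tent a N (z - x).
pose D z := st z - g z.
pose b := 4 / (fejer_cst R * N).
have bE : b = e / 10 * h.
  rewrite /b /N /eta /ci; field.
  by rewrite !gt_eqF// /eta /ci ?mulr_gt0 ?divr_gt0 ?invr_gt0 ?mulr_gt0 ?invr_gt0.
have b0 : 0 <= b by rewrite bE mulr_ge0 ?(ltW h0)// divr_ge0// ltW.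
have Db z : `|D z| <= b by exact: smooth_tent_dist.
have stL y z : `|st z - st y| <= 2 * (1 + ci) * `|z - y|.
  rewrite /st (le_trans (smooth_tent_lip _ _ _ N0))//.
  by rewrite (_ : z - x - (y - x) = z - y)//; ring.
have gL y z : `|g z - g y| <= 2 * `|z - y|.
  rewrite /g (le_trans (tent_lip _ _ _))//.
  by rewrite (_ : z - x - (y - x) = z - y)//; ring.
have DL y z : `|D z - D y| <= L * `|z - y|.
  rewrite /D (_ : st z - g z - (st y - g y) = (st z - st y) - (g z - g y)); last by ring.
  by rewrite (le_trans (ler_normB _ _))// /L mulrDl lerD.
have bst : bounded_lip st.
  have [G gG _] := bounded_lip_tent a x.
  exists (b + G + 2 * (1 + ci)) => [z|y z].
    have -> : st z = D z + g z by rewrite /D subrK.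
    rewrite (le_trans (ler_normD _ _))//.
    by have := Db z; have := gG z; rewrite -/(g z); lra.
  rewrite (le_trans (stL _ _))// ler_wpM2r// lerDr addr_ge0//.
  exact: le_trans (normr_ge0 _) (gG 0).
have bD : bounded_lip D.
  by exists (b + L) => [z|y z]; [rewrite ler_wpDr// ltW|rewrite (le_trans (DL _ _))// ler_wpM2r// lerDr].
have bg : bounded_lip g by exact: bounded_lip_tent.
have shift f : bounded_lip f -> bounded_lip (fun y => f (c * h + y)).
  by move=> bf; have := bounded_lip_shift (c * h) bf; congr bounded_lip; apply/funext => y; rewrite addrC.
have ishift f : bounded_lip f -> nu.-integrable setT (EFin \o (fun y => f (c * h + y) - f (c * h))).
  move=> bf; have := bounded_lip_integrable fv (shift _ bf).
  by apply: eq_integrable => // y _ /=; rewrite addr0.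
have bs : bounded_lip (fun z => smooth_tent a N (z - x)).
  have := bounded_lipZ (fejer_cst R) bst; congr bounded_lip.
  by apply/funext => z; rewrite /st mulVKf// gt_eqF.
have T1 := HC d Omega P W c h N x h0 N0 cf.
pose r1 := \int[P]_w st (W w) - st (c * h) - h * \int[nu]_y (st (c * h + y) - st (c * h)).
have T1' : `|r1| <= e / 5 * h + e / 5 * h.
  have -> : r1 = ci * (\int[P]_w smooth_tent a N (W w - x) - smooth_tent a N (c * h - x) -
     h * \int[nu]_y (smooth_tent a N (c * h + y - x) - smooth_tent a N (c * h - x))).
    rewrite /r1 mulrBr mulrBr mulrCA; congr (_ - _ - _ * _).
      by rewrite -RintegralZl//; exact: (bounded_lip_integrable_comp P mW bs).
    rewrite -RintegralZl//; last exact: (ishift _ bs).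
    by apply: eq_Rintegral => y _; rewrite mulrBr.
  rewrite normrM (gtr0_norm ci0).
  apply: (le_trans (ler_wpM2l (ltW ci0) T1)).
  have -> : ci * (h ^+ 2 * (C + 32 * e' ^+ 2 * N)) =
      (ci * C) * h * h + 32 * ci * e' ^+ 2 / eta * h.
    rewrite /N; field; rewrite !gt_eqF//.
  apply: lerD; rewrite ler_wpM2r// ?(ltW h0)//.
    apply: (@le_trans _ _ ((ci * C + 1) * h1)); last first.
      by rewrite /h1 le_eqVlt; apply/orP; left; apply/eqP; field; rewrite !gt_eqF.
    by rewrite ler_pM// ?mulr_ge0 ?(ltW ci0) ?(ltW h0)// ?lerDl// ltW.
  rewrite ler_pdivrMr//.
  apply: (le_trans (ler_wpM2l _ e'q)); first by rewrite mulr_ge0// ltW.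
  by rewrite /q le_eqVlt; apply/orP; left; apply/eqP; field; rewrite gt_eqF.
pose r2 := \int[P]_w D (W w).
have T2 : `|r2| <= e / 10 * h.
  rewrite -bE; apply: (@le_trans _ _ (\int[P]_w b)).
    apply: norm_Rintegral_le_integrable => //; first exact: bounded_lip_integrable_comp.
    by apply: (@integrable_bounded _ _ _ _ _ `|b|).
  by rewrite probability_Rintegral_cst.
have T3 := Db (c * h); rewrite bE in T3.
pose r4 := \int[nu]_y (D (c * h + y) - D (c * h)).
(* Jumps larger than [s1] are handled by the uniform bound [2 b <= s1], smaller ones by the
   Lipschitz constant [L]; together they give [L min s1 |y|]. *)
have T4 : `|r4| <= e / 5.
  apply: (@le_trans _ _ (\int[nu]_y (L * Num.min s1 `|y|))).
    apply: norm_Rintegral_le_integrable; first exact: ishift.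
      exact: (integrableZl measurableT L (fv_integrable_min (ltW s10) fv)).
    move=> y; rewrite minEle; case: ifP => _.
      apply: (@le_trans _ _ s1).
        apply: (@le_trans _ _ (b + b)).
          by rewrite (le_trans (ler_normB _ _))// lerD.
        rewrite bE; move: hh2; rewrite /h2 ltr_pdivlMr//; lra.
      by rewrite ler_peMl ?(ltW s10)// /L; lra.
    by rewrite (le_trans (DL _ _))// addrC addKr.
  rewrite RintegralZl//; last exact: (fv_integrable_min (ltW s10) fv).
  apply: (le_trans (ler_wpM2l (ltW L0) hs1)).
  by rewrite le_eqVlt; apply/orP; left; apply/eqP; field; rewrite gt_eqF.
pose r5 := \int[nu]_y ((g (c * h + y) - g (c * h)) - (g y - g 0)).
(* Cost of moving the base point from [0] to [c h]. For large jumps the four values are paired by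
   their shift [c h], at most [s2]; for small ones they are paired by the jump [y]. *)
have T5 : `|r5| <= e / 5.
  apply: (@le_trans _ _ (\int[nu]_y (4 * Num.min s2 `|y|))).
    apply: norm_Rintegral_le_integrable.
    - exact: (integrableB measurableT (ishift _ bg) (bounded_lip_integrable fv bg)).
    - exact: (integrableZl measurableT 4 (fv_integrable_min (ltW s20) fv)).
    move=> y; rewrite minEle; case: ifP => _.
      rewrite (_ : _ - _ = (g (c * h + y) - g y) - (g (c * h) - g 0)); last by ring.
      apply: (le_trans (ler_normB _ _)).
      have k1 := gL y (c * h + y); have k2 := gL 0 (c * h).
      rewrite subr0 in k2; rewrite addrK in k1.
      have : `|c * h| <= s2.
        rewrite normrM (gtr0_norm h0); move: hh3; rewrite /h3 ltr_pdivlMr//.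
        have := normr_ge0 c; nra.
      lra.
    apply: (le_trans (ler_normB _ _)).
    have k1 := gL (c * h) (c * h + y); have k2 := gL 0 y.
    rewrite subr0 in k2; rewrite (addrC (c * h)) addrK in k1; rewrite (addrC (c * h)).
    lra.
  rewrite RintegralZl//; last exact: (fv_integrable_min (ltW s20) fv).
  apply: (le_trans (ler_wpM2l _ hs2)) => //; lra.
(* The total error: Fourier remainder [2e/5], smoothing under [P] and at [c h] each [e/10],
   smoothing and shift under [nu] each [e/5], all times [h]. *)
have eq : \int[P]_w g (W w) - g (c * h) - h * \int[nu]_y (g y - g 0) =
    r1 - r2 + D (c * h) + h * (r4 + r5).
  rewrite /r1 /r2 /r4 /r5.
  have -> : \int[P]_w D (W w) = \int[P]_w st (W w) - \int[P]_w g (W w).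
    by rewrite -RintegralB//; exact: bounded_lip_integrable_comp.
  have -> : \int[nu]_y (D (c * h + y) - D (c * h)) =
     \int[nu]_y (st (c * h + y) - st (c * h)) - \int[nu]_y (g (c * h + y) - g (c * h)).
    rewrite -RintegralB//; try exact: ishift.
    by apply: eq_Rintegral => y _; rewrite /D; ring.
  have -> : \int[nu]_y (g (c * h + y) - g (c * h) - (g y - g 0)) =
     \int[nu]_y (g (c * h + y) - g (c * h)) - \int[nu]_y (g y - g 0).
    by rewrite RintegralB//; [exact: ishift|exact: bounded_lip_integrable].
  by rewrite /D; ring.
rewrite eq; have T45 : `|h * (r4 + r5)| <= 2 * e / 5 * h.
  rewrite normrM (gtr0_norm h0) mulrC ler_wpM2r ?(ltW h0)//.
  by rewrite (le_trans (ler_normD _ _))//; lra.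
move: T1' T2 T3 T45; rewrite !ler_norml => /andP[? ?] /andP[? ?] /andP[? ?] /andP[? ?].
by apply/andP; split; lra.
Qed.

End small_time.

(** * From tents to the put payoff *)

Definition clamp (R : realType) (a z : R) : R := (`|z| - `|z + a| + a) / 2.

Lemma clampE (R : realType) (a z : R) : 0 <= a ->
  clamp a z = if 0 <= z then 0 else if z <= - a then a else - z.
Proof.
move=> a0; rewrite /clamp; case: (leP 0 z) => z0.
  by rewrite !ger0_norm ?addr_ge0//; lra.
rewrite (ltr0_norm z0); case: (leP z (- a)) => za.
  by rewrite ler0_norm; lra.
by rewrite ger0_norm; lra.
Qed.

Lemma clamp_ge0 (R : realType) (a z : R) : 0 <= a -> 0 <= clamp a z.
Proof.
by move=> a0; rewrite clampE//; case: ifPn => //; case: ifPn => //;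
  rewrite -?ltNge => *; lra.
Qed.

Lemma clamp_le (R : realType) (a z : R) : 0 <= a -> clamp a z <= a.
Proof.
by move=> a0; rewrite clampE//; case: ifPn => //; case: ifPn => //;
  rewrite -?ltNge => *; lra.
Qed.

Lemma clamp_lip (R : realType) (a x y : R) : `|clamp a y - clamp a x| <= `|y - x|.
Proof.
rewrite /clamp.
have h1 : `| `|y + a| - `|x + a| | <= `|y - x|.
  by rewrite (le_trans (ler_dist_dist _ _))// opprD addrACA subrr addr0.
have h3 : `| `|y| - `|x| | <= `|y - x| by exact: ler_dist_dist.
move: h1 h3; rewrite !ler_norml => /andP[? ?] /andP[? ?].
by apply/andP; split; lra.
Qed.

(** Consequently tents translated by multiples of [a] telescope into a difference of two far apart
    clamps, a trapezoid. *)
Lemma tent_clamp (R : realType) (a z : R) : tent a z = clamp a (z - a) - clamp a z.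
Proof. by rewrite /tent /clamp subrK; ring. Qed.

Lemma bounded_lip_clamp (R : realType) (a q : R) : 0 <= a ->
  bounded_lip (fun z => clamp a (z + q)).
Proof.
move=> a0; apply: (@bounded_lip_shift _ q (clamp a)); exists (a + 1) => [z|x y].
  by rewrite ger0_norm ?clamp_ge0// (le_trans (clamp_le _ a0))// lerDl.
by rewrite (le_trans (clamp_lip _ _ _))// ler_peMl// lerDr.
Qed.

(** Dominated convergence for perturbations that escape to infinity: each point is eventually
    outside the support, and the bound [C min 1 |y|] is integrable. *)
Lemma fv_tail (R : realType) (nu : {measure set R -> \bar R}) (f : nat -> R -> R)
    (C e : R) : fv_measure nu -> (forall n, measurable_fun setT (f n)) ->
  (forall n y, `|f n y| <= C * Num.min 1 `|y|) ->
  (forall y, \forall n \near \oo, f n y = 0) -> 0 < e ->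
  \forall n \near \oo, \int[nu]_y f n y <= e.
Proof.
move=> fv mf fC f0 e0.
have [] := @dominated_convergence _ _ _ nu setT measurableT
  (fun n y => (f n y)%:E) (cst 0%E) (EFin \o (fun y : R => C * Num.min 1 `|y|)).
- by move=> n; apply/measurable_EFinP.
- exact: measurable_cst.
- apply: aeW => y _; apply: cvg_near_cst.
  by apply: filterS (f0 y) => n ->.
- exact: (integrableZl measurableT C fv).
- by apply: aeW => y n _ /=; rewrite lee_fin.
move=> _ _; rewrite integral_cst// mul0e => /fine_cvgP[_].
move=> /cvgrPdist_le /(_ e e0); apply: filterS => n /=.
by rewrite sub0r normrN; apply: le_trans; exact: ler_norm.
Qed.

Section small_time_clamp.
Context (R : realType) (nu : {sigma_finite_measure set R -> \bar R}).
Context d (Omega : measurableType d) (P : probability Omega R).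
Variable c : R.
Hypothesis fv : fv_measure nu.
Hypothesis c0 : 0 <= c.

Lemma small_time_trapeze (a q : R) (n : nat) :
  small_time nu P c (fun z => clamp a (z + q) - clamp a (z + (q + a *+ n))).
Proof.
elim: n => [|n IHn].
  have := small_time_cst nu P c 0; congr (small_time _ _ _ _).
  by apply/funext => z; rewrite mulr0n addr0 subrr.
have := small_timeD fv IHn (small_time_tent P c fv a (- (q + a *+ n.+1))).
congr (small_time _ _ _ _); apply/funext => z.
by rewrite tent_clamp opprK mulrS (_ : z + (q + (a + a *+ n)) - a = z + (q + a *+ n)); ring.
Qed.

(** A clamp does not vanish at minus infinity, so no finite sum of tents equals it. It is squeezed
    between a trapezoid that returns to [0] far on the left and a function that exceeds it only far
    on the right; both corrections have small [nu]-integral. *)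
Lemma small_time_clamp (a q : R) : 0 < a -> 0 <= q ->
  small_time nu P c (fun z => clamp a (z + q)).
Proof.
move=> a0 q0; have a0' := ltW a0.
have bc q' := bounded_lip_clamp q' a0'.
have mc q' : measurable_fun setT (fun z : R => clamp a (z + q')).
  exact: bounded_lip_measurable (bc q').
have far (y : R) : \forall n \near \oo, `|y| + a + q <= a *+ n.
  near=> n; rewrite -mulr_natr -ler_pdivrMl//; near: n.
  exact: nbhs_infty_ger.
apply: small_time_sandwich => // e e0.
have e20 : 0 < e / 2 by rewrite divr_gt0.
have t1 : \forall n \near \oo, \int[nu]_y clamp a (y + (q + a *+ n)) <= e / 2.
  apply: (@fv_tail _ _ _ (a + 1)) => //.
    move=> n y; rewrite ger0_norm ?clamp_ge0//.
    have q1 : 0 <= q + a *+ n by rewrite addr_ge0// mulrn_wge0.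
    have k1 : clamp a (y + (q + a *+ n)) <= a by exact: clamp_le.
    have k2 : clamp a (y + (q + a *+ n)) <= `|y|.
      have := clamp_lip a (q + a *+ n) (y + (q + a *+ n)).
      rewrite addrK [clamp a (q + _)]clampE// q1 subr0.
      by apply: le_trans; exact: ler_norm.
    rewrite minEle; case: ifP => _; have := normr_ge0 y; nra.
  move=> y; near=> n; rewrite clampE// ifT//.
  have : `|y| + a + q <= a *+ n by near: n; exact: far.
  have := ler_norm (- y); rewrite normrN; lra.
have t2 : \forall n \near \oo, \int[nu]_y (a - clamp a (y + (q - a *+ n))) <= e / 2.
  (* The correction vanishes at [y = 0] only when [q + a <= a n]; the case distinction discards the
     earlier [n], for which no bound by [min 1 |y|] holds. *)
  pose f n y := if q + a <= a *+ n then a - clamp a (y + (q - a *+ n)) else 0.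
  have : \forall n \near \oo, \int[nu]_y f n y <= e / 2.
    apply: (@fv_tail _ _ _ (a + 1)) => //.
    - move=> n; rewrite /f; case: (q + a <= a *+ n) => //; exact: measurable_funB.
    - move=> n y; rewrite /f; case: ifPn => [qan|_]; last first.
        by rewrite normr0 mulr_ge0 ?addr_ge0// le_min ler01/=.
      have k1 : a - clamp a (y + (q - a *+ n)) <= a.
        by rewrite lerBlDr lerDl clamp_ge0.
      have k3 : clamp a (y + (q - a *+ n)) <= a by exact: clamp_le.
      have k2 : a - clamp a (y + (q - a *+ n)) <= `|y|.
        have := clamp_lip a (q - a *+ n) (y + (q - a *+ n)).
        rewrite addrK [clamp a (q - _)]clampE// ifF; last by apply/negbTE; rewrite -ltNge; lra.
        by rewrite ifT; [apply: le_trans; rewrite distrC; exact: ler_norm|lra].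
      rewrite ger0_norm ?subr_ge0//.
      rewrite minEle; case: ifP => _; have := normr_ge0 y; nra.
    move=> y; near=> n; rewrite /f; case: ifPn => // qan.
    have : `|y| + a + q <= a *+ n by near: n; exact: far.
    move=> yan; have := ler_norm y => yy.
    rewrite clampE// ifF; last by apply/negbTE; rewrite -ltNge; lra.
    by rewrite ifT ?subrr//; lra.
  have qan : \forall n \near \oo, q + a <= a *+ n.
    by have := far 0; apply: filterS => n; rewrite normr0; lra.
  by apply: filterS2 qan => n qan; rewrite /f qan.
have t3 : \forall n \near \oo, c + q + a <= a *+ n.
  have := far c; apply: filterS => n; rewrite ger0_norm//; lra.
near \oo => n.
have t1n : \int[nu]_y clamp a (y + (q + a *+ n)) <= e / 2 by near: n; exact: t1.
have t2n : \int[nu]_y (a - clamp a (y + (q - a *+ n))) <= e / 2 by near: n; exact: t2.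
have t3n : c + q + a <= a *+ n by near: n; exact: t3.
have an0 : 0 <= a *+ n by rewrite mulrn_wge0.
pose g1 z := clamp a (z + q) - clamp a (z + (q + a *+ n)).
pose g2 z := a - (clamp a (z + (q - a *+ n)) - clamp a (z + q)).
exists g1, g2; split.
- exact: small_time_trapeze.
- apply: small_timeB => //; first exact: small_time_cst.
  have := small_time_trapeze a (q - a *+ n) n.
  by congr (small_time _ _ _ _); apply/funext => z; rewrite subrK.
- move=> z; rewrite /g1 /g2.
  have := clamp_ge0 (z + (q + a *+ n)) a0'; have := clamp_le (z + (q - a *+ n)) a0'.
  by move=> *; apply/andP; split; lra.
- exists 1 => // h h0 h1; rewrite /g1 /g2.
  have ch0 : 0 <= c * h by rewrite mulr_ge0.
  have ch1 : c * h <= c by rewrite ler_piMr// ltW.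
  split.
    by rewrite [X in _ - X]clampE// ifT ?subr0// addr_ge0// addr_ge0.
  rewrite [clamp a (_ + (_ - _))]clampE// ifF; last by apply/negbTE; rewrite -ltNge; lra.
  by rewrite ifT; lra.
have z1 : clamp a (0 + (q + a *+ n)) = 0 by rewrite clampE// ifT// add0r addr_ge0.
have z2 : clamp a (0 + (q - a *+ n)) = a.
  have qan : q - a *+ n <= - a by move: c0 t3n; move: (a *+ n) => w *; lra.
  rewrite add0r clampE// ifF; last by apply/negbTE; rewrite -ltNge; lra.
  by rewrite ifT.
have i0 := bounded_lip_integrable fv (bc q).
have i1 : nu.-integrable setT (EFin \o (fun y => clamp a (y + (q + a *+ n)))).
  have := bounded_lip_integrable fv (bc (q + a *+ n)).
  by apply: eq_integrable => // y _ /=; rewrite z1 subr0.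
have i2 : nu.-integrable setT (EFin \o (fun y => a - clamp a (y + (q - a *+ n)))).
  have := integrableN (bounded_lip_integrable fv (bc (q - a *+ n))).
  by apply: eq_integrable => // y _ /=; rewrite z2 opprB.
have -> : \int[nu]_y (g1 y - g1 0) = \int[nu]_y (clamp a (y + q) - clamp a (0 + q)) -
    \int[nu]_y clamp a (y + (q + a *+ n)).
  by rewrite -RintegralB//; apply: eq_Rintegral => y _; rewrite /g1 z1; ring.
have -> : \int[nu]_y (g2 y - g2 0) = \int[nu]_y (clamp a (y + q) - clamp a (0 + q)) +
    \int[nu]_y (a - clamp a (y + (q - a *+ n))).
  by rewrite -RintegralD//; apply: eq_Rintegral => y _; rewrite /g2 z2; ring.
by lra.
Unshelve. all: by end_near. Qed.

Definition put_payoff (z : R) : R := Num.max (1 - expR z) 0.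

Lemma put_payoff_le (y : R) : put_payoff y <= Num.min 1 `|y|.
Proof.
have := expR_ge1Dx y; have := expR_gt0 y; have := ler_norm (- y); rewrite normrN.
have := normr_ge0 y.
by rewrite /put_payoff ge_max !le_min => *; apply/andP; split; apply/andP; split; lra.
Qed.

Lemma put_payoff_ge0 (y : R) : 0 <= put_payoff y.
Proof. by rewrite /put_payoff le_max lexx orbT. Qed.

Lemma put_payoff_pos (y : R) : 0 <= y -> put_payoff y = 0.
Proof.
move=> y0; have := expR_ge1Dx y => h; apply/max_idPr; lra.
Qed.

Lemma put_payoff_lip (x y : R) : `|put_payoff y - put_payoff x| <= `|y - x|.
Proof.
wlog xy : x y / x <= y.
  move=> H; have [/H//|/ltW/H] := leP x y; by rewrite distrC (distrC x).
have mono : expR x <= expR y by rewrite ler_expR.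
rewrite (ger0_norm (_ : 0 <= y - x)) ?subr_ge0//.
have h1 : put_payoff y <= put_payoff x.
  by rewrite /put_payoff ge_max !le_max; apply/andP; split; apply/orP; [left; lra|right].
rewrite ler0_norm ?subr_le0// opprB.
have := put_payoff_ge0 y => y0.
rewrite lerBlDr {1}/put_payoff ge_max; apply/andP; split; last by rewrite addr_ge0// subr_ge0.
have [x0|x0] := leP 0 x.
  by have := expR_ge1Dx x; lra.
have e1 : 1 - expR y <= put_payoff y by rewrite /put_payoff le_max lexx.
have [yy|yy] := leP y 0; last by have := expR_ge1Dx x; lra.
have := expR_ge1Dx (x - y); rewrite expRD expRN => h.
have : expR y - expR x <= (y - x) * expR y.
  have := ler_wpM2r (expR_ge0 y) h; rewrite mulfVK ?gt_eqF ?expR_gt0//; lra.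
have : expR y <= 1 by rewrite -(expR0 R) ler_expR.
have := expR_gt0 y; nra.
Qed.

Lemma bounded_lip_put : bounded_lip put_payoff.
Proof.
exists 1 => [z|x y]; last by rewrite mul1r put_payoff_lip.
by rewrite ger0_norm ?put_payoff_ge0// (le_trans (put_payoff_le _))// ge_min lexx.
Qed.

(* A Riemann sum for [1 - e^z = \int_0^{-z} e^{-s} ds]. *)
Definition clamp_sum (a : R) (n : nat) (z : R) : R :=
  \sum_(j < n) expR (- (a *+ j.+1)) * clamp a (z + a *+ j).

Lemma small_time_clamp_sum (a : R) (n : nat) : 0 < a ->
  small_time nu P c (clamp_sum a n).
Proof.
move=> a0; elim: n => [|n IHn].
  have := small_time_cst nu P c 0; congr (small_time _ _ _ _).
  by apply/funext => z; rewrite /clamp_sum big_ord0.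
have anp : 0 <= a *+ n by rewrite mulrn_wge0// ltW.
have := small_timeD fv IHn (small_timeZ fv (expR (- (a *+ n.+1))) (small_time_clamp a0 anp)).
by congr (small_time _ _ _ _); apply/funext => z; rewrite /clamp_sum big_ord_recr.
Qed.

Lemma clamp_sum_ge0 (a : R) n z : 0 <= a -> 0 <= clamp_sum a n z.
Proof.
by move=> a0; apply: sumr_ge0 => j _; rewrite mulr_ge0 ?expR_ge0 ?clamp_ge0.
Qed.

(** Lowering the truncation level from [- a n] to [- a (n + 1)] adds [e^(- a n) (1 - e^(- k))] to
    the payoff, [k] being the clamp at that level. For [0 <= k <= a] the second factor lies between
    [e^(- a) k] and [k], whence the relative error [e^a]. *)
Lemma clamp_sum_bounds (a : R) n z : 0 < a ->
  clamp_sum a n z <= put_payoff (Num.max z (- (a *+ n))) <= expR a * clamp_sum a n z.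
Proof.
move=> a0; elim: n => [|n /andP[IH1 IH2]].
  rewrite /clamp_sum big_ord0 mulr0 mulr0n oppr0 put_payoff_pos ?lexx//.
  by rewrite le_max lexx orbT.
rewrite /clamp_sum big_ord_recr/= -/(clamp_sum a n z).
set k := clamp a (z + a *+ n); have anp : 0 <= a *+ n by rewrite mulrn_wge0// ltW.
have an1 : a *+ n.+1 = a + a *+ n by rewrite mulrS.
have k0 : 0 <= k by rewrite clamp_ge0// ltW.
have ka : k <= a by rewrite clamp_le// ltW.
have step : put_payoff (Num.max z (- (a *+ n.+1))) =
    put_payoff (Num.max z (- (a *+ n))) + expR (- (a *+ n)) * (1 - expR (- k)).
  rewrite /k (clampE _ (ltW a0)); case: (leP 0 (z + a *+ n)) => zn.
    rewrite oppr0 expR0 subrr mulr0 addr0; congr put_payoff.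
    by rewrite !max_l; lra.
  have pn : put_payoff (Num.max z (- (a *+ n))) = 1 - expR (- (a *+ n)).
    rewrite max_r; last by lra.
    by apply/max_idPl; rewrite subr_ge0 -(expR0 R) ler_expR; lra.
  rewrite pn; case: (leP (z + a *+ n) (- a)) => zna.
    rewrite max_r; last by rewrite an1; lra.
    rewrite mulrBr mulr1 -expRD -opprD [a *+ n + a]addrC -an1.
    rewrite /put_payoff; rewrite (_ : 1 - expR (- (a *+ n)) + _ = 1 - expR (- (a *+ n.+1))); last by ring.
    by apply/max_idPl; rewrite subr_ge0 -(expR0 R) ler_expR an1; lra.
  rewrite max_l; last by rewrite an1; lra.
  rewrite opprK mulrBr mulr1 -expRD (_ : - (a *+ n) + (z + a *+ n) = z); last by ring.
  rewrite (_ : 1 - expR (- (a *+ n)) + _ = 1 - expR z); last by ring.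
  by apply/max_idPl; rewrite subr_ge0 -(expR0 R) ler_expR; lra.
have E0 := expR_gt0 (- (a *+ n)).
have u1 : 1 - expR (- k) <= k by have := expR_ge1Dx (- k); lra.
have u2 : expR (- a) * k <= 1 - expR (- k).
  have h1 : expR (- a) <= expR (- k) by rewrite ler_expR lerN2.
  apply: (le_trans (ler_wpM2r k0 h1)).
  have := expR_ge1Dx k; have := expR_gt0 (- k).
  have : expR (- k) * expR k = 1 by rewrite -expRD addNr expR0.
  nra.
have e1 : expR (- (a *+ n.+1)) = expR (- (a *+ n)) * expR (- a).
  by rewrite -expRD an1 opprD addrC.
have e2 : expR a * expR (- (a *+ n.+1)) = expR (- (a *+ n)).
  by rewrite -expRD an1; congr expR; ring.
rewrite step; apply/andP; split.
  by rewrite lerD// e1 -mulrA ler_wpM2l// ltW.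
by rewrite [leRHS]mulrDr lerD// mulrA e2 ler_wpM2l// ltW.
Qed.

(** Truncation at [- a n] loses at most [e^(- a n)], and only where the clamp equals [a]. Writing
    the loss as a multiple of a clamp keeps the upper bound among functions with a known expansion
    that vanish on the nonnegative axis. *)
Lemma put_payoff_tail (a : R) n z : 0 < a -> (0 < n)%N ->
  put_payoff z <= put_payoff (Num.max z (- (a *+ n))) +
    expR (- (a *+ n)) / a * clamp a z.
Proof.
move=> a0 n0; have an : a <= a *+ n by rewrite -[leLHS]mulr1n ler_pMn2l.
have E0 := expR_gt0 (- (a *+ n)).
have k0 : 0 <= clamp a z by rewrite clamp_ge0// ltW.
case: (leP (- (a *+ n)) z) => zn.
  by rewrite lerDl mulr_ge0// divr_ge0// ltW.
rewrite {2}/put_payoff max_l; last first.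
  by rewrite subr_ge0 -(expR0 R) ler_expR; lra.
rewrite (clampE _ (ltW a0)) ifF; last by apply/negbTE; rewrite -ltNge; lra.
rewrite ifT; last by lra.
rewrite divfK ?gt_eqF// subrK (le_trans (put_payoff_le _))// ge_min lexx//.
Qed.

Lemma small_time_put : small_time nu P c put_payoff.
Proof.
apply: small_time_sandwich => //; first exact: bounded_lip_put.
move=> e e0.
have ip : nu.-integrable setT (EFin \o put_payoff).
  apply: (@fv_integrable _ _ _ 1) => //.
    exact: (bounded_lip_measurable bounded_lip_put).
  by move=> y; rewrite mul1r ger0_norm ?put_payoff_ge0// put_payoff_le.
set I := \int[nu]_y put_payoff y.
have I0 : 0 <= I by apply: Rintegral_ge0 => y _; exact: put_payoff_ge0.
(* The mesh makes the relative error small: [e^a - 1 <= 2 a] for [a <= 1/2], and [2 a I <= e / 2].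
   The other half of [e] pays for the tail. *)
pose a := Num.min (1 / 2) (e / (4 * (I + 1))).
have a0 : 0 < a by rewrite lt_min divr_gt0//= divr_gt0// mulr_gt0// ltr_wpDl.
have a12 : a <= 1 / 2 by rewrite ge_min lexx.
have aI : 2 * a * I <= e / 2.
  have : a <= e / (4 * (I + 1)) by rewrite ge_min lexx orbT.
  rewrite ler_pdivlMr; last by rewrite mulr_gt0// ltr_wpDl.
  by nra.
have ea : expR a - 1 <= 2 * a.
  have : expR a * expR (- a) = 1 by rewrite -expRD subrr expR0.
  have := expR_ge1Dx (- a); have := expR_gt0 a; nra.
have ic : nu.-integrable setT (EFin \o (clamp a)).
  have := bounded_lip_integrable fv (bounded_lip_clamp 0 (ltW a0)).
  by apply: eq_integrable => // y _ /=; rewrite !addr0 [clamp a 0](clampE _ (ltW a0)) lexx subr0.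
set J := \int[nu]_y clamp a y.
have J0 : 0 <= J by apply: Rintegral_ge0 => y _; rewrite clamp_ge0// ltW.
have [n n0 hn] : exists2 n, (0 < n)%N & expR (- (a *+ n)) / a * J <= e / 2.
  near \oo => n; exists n; first by near: n; exact: nbhs_infty_gt.
  have : 2 * J / (a ^+ 2 * e) <= n%:R by near: n; exact: nbhs_infty_ger.
  rewrite ler_pdivrMr; last by rewrite mulr_gt0// exprn_gt0.
  move=> hn; rewrite -mulrA expRN.
  rewrite ler_pdivrMl ?expR_gt0// ler_pdivrMl//.
  have := expR_ge1Dx (a *+ n); rewrite -mulr_natl; move: (expR _) => E hE.
  have : n%:R * (a * a) * e <= E * (a * e); last by nra.
  by have := mulr_gt0 a0 e0; nra.
exists (clamp_sum a n), (fun z => expR a * clamp_sum a n z + expR (- (a *+ n)) / a * clamp a (z + 0)).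
have sc : small_time nu P c (clamp_sum a n) by exact: small_time_clamp_sum.
have b1 z : clamp_sum a n z <= put_payoff z.
  have /andP[h _] := clamp_sum_bounds n z a0; apply: (le_trans h).
  have mono : expR z <= expR (Num.max z (- (a *+ n))) by rewrite ler_expR le_max lexx.
  by rewrite /put_payoff ge_max !le_max; apply/andP; split; apply/orP; [left; lra|right].
have b2 z : put_payoff z <= expR a * clamp_sum a n z + expR (- (a *+ n)) / a * clamp a z.
  have /andP[_ h] := clamp_sum_bounds n z a0.
  by rewrite (le_trans (put_payoff_tail z a0 n0))// lerD2r.
have zero z : 0 <= z -> clamp_sum a n z = 0.
  move=> z0; apply/eqP; rewrite eq_le clamp_sum_ge0 ?(ltW a0)// andbT.
  by rewrite (le_trans (b1 z))// put_payoff_pos.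
have s00 : clamp_sum a n 0 = 0 by exact: zero.
have c00 : clamp a 0 = 0 by rewrite (clampE _ (ltW a0)) lexx.
have zeroc z : 0 <= z -> clamp a z = 0 by move=> z0; rewrite (clampE _ (ltW a0)) z0.
split => //.
- by apply: small_timeD => //; apply: small_timeZ => //; exact: small_time_clamp.
- by move=> z; rewrite addr0 b1 b2.
- exists 1 => // h h0 _; have ch0 : 0 <= c * h by rewrite mulr_ge0.
  by rewrite addr0 zero// zeroc// put_payoff_pos// !mulr0 addr0.
have js : nu.-integrable setT (EFin \o clamp_sum a n).
  have := bounded_lip_integrable fv sc.1.
  by apply: eq_integrable => // y _ /=; rewrite s00 subr0.
have -> : \int[nu]_y (clamp_sum a n y - clamp_sum a n 0) = \int[nu]_y clamp_sum a n y.
  by apply: eq_Rintegral => y _; rewrite s00 subr0.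
have js' : nu.-integrable setT (EFin \o (fun y => expR a * clamp_sum a n y)).
  exact: (integrableZl measurableT _ js).
have ic' : nu.-integrable setT (EFin \o (fun y => expR (- (a *+ n)) / a * clamp a y)).
  exact: (integrableZl measurableT _ ic).
rewrite (_ : Rintegral _ _ _ = expR a * \int[nu]_y clamp_sum a n y + expR (- (a *+ n)) / a * J); last first.
  rewrite -!RintegralZl// -RintegralD//; apply: eq_Rintegral => y _.
  by rewrite !addr0 s00 c00 !mulr0 addr0 subr0.
have sI : \int[nu]_y clamp_sum a n y <= I by apply: le_Rintegral => // y _.
have s0 : 0 <= \int[nu]_y clamp_sum a n y.
  by apply: Rintegral_ge0 => y _; rewrite clamp_sum_ge0// ltW.
move: hn sI s0; move: (\int[nu]_y clamp_sum _ _ _) (_ / a * J) => S k hn sI s0.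
have : (expR a - 1) * S <= 2 * a * I.
  apply: (@le_trans _ _ (2 * a * S)); first by rewrite ler_wpM2r.
  by rewrite ler_wpM2l// mulr_ge0// ltW.
by lra.
Unshelve. all: by end_near. Qed.

End small_time_clamp.

(** * Independence of increments and the augmented filtration *)

Lemma Rintegral_distribution d d' (Omega : measurableType d) (T : measurableType d')
    (R : realType) (P : probability Omega R) (U : {mfun Omega >-> T}) (f : T -> R) (C : R) :
  measurable_fun setT f -> (forall x, `|f x| <= C) ->
  \int[P]_w f (U w) = \int[distribution P U]_x f x.
Proof.
move=> mf fC; rewrite /Rintegral; congr fine.
have mU : measurable_fun setT U by [].
rewrite (integral_pushforward mU); rewrite ?preimage_setT//.
  exact/measurable_EFinP.
apply: (@integrable_bounded _ _ _ P (f \o U) C) => [|w]; last exact: fC.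
exact: measurableT_comp.
Qed.

(** Independence identifies the joint law of [(U, V)] with the product of the two laws on
    rectangles, hence everywhere; Fubini then factors the integral. *)
Lemma indep_Rintegral d (Omega : measurableType d) (R : realType)
    (P : probability Omega R) (U V : Omega -> R) (f g : R -> R) (Cf Cg : R) :
  measurable_fun setT U -> measurable_fun setT V ->
  measurable_fun setT f -> measurable_fun setT g ->
  (forall x, `|f x| <= Cf) -> (forall x, `|g x| <= Cg) ->
  (forall A B, measurable A -> measurable B ->
    P (U @^-1` A `&` V @^-1` B) = (P (U @^-1` A) * P (V @^-1` B))%E) ->
  \int[P]_w (f (U w) * g (V w)) = (\int[P]_w f (U w)) * (\int[P]_w g (V w)).
Proof.
move=> mU mV mf mg fC gC ind.
have mW : measurable_fun setT (fun w => (U w, V w)) by exact: measurable_fun_pair.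
pose U' : {mfun Omega >-> R} := mfun_Sub (mem_set mU).
pose V' : {mfun Omega >-> R} := mfun_Sub (mem_set mV).
pose W' : {mfun Omega >-> (R * R)%type} := mfun_Sub (mem_set mW).
pose k (z : R * R) := f z.1 * g z.2.
have mk : measurable_fun setT k.
  by apply: measurable_funM; exact: measurableT_comp.
have kC z : `|k z| <= Cf * Cg by rewrite normrM ler_pM.
have prodE A : measurable A ->
    (distribution P U' \x distribution P V')%E A = distribution P W' A.
  move=> mA; apply: product_measure_unique mA => B C mB mC.
  by rewrite /= /distribution /pushforward/= -ind.
have ik : (distribution P U' \x distribution P V')%E.-integrable setT (EFin \o k).
  have : (distribution P W').-integrable setT (EFin \o k).
    exact: (@integrable_bounded _ _ _ _ _ (Cf * Cg)).
  move=> /integrableP[_ h]; apply/integrableP; split; first exact/measurable_EFinP.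
  rewrite (eq_measure_integral (distribution P W'))// => A mA _.
  exact: prodE.
have ig : (distribution P V').-integrable setT (EFin \o g).
  exact: (@integrable_bounded _ _ _ _ _ Cg).
have if_ : (distribution P U').-integrable setT (EFin \o f).
  exact: (@integrable_bounded _ _ _ _ _ Cf).
transitivity (\int[distribution P W']_z k z).
  by rewrite -(@Rintegral_distribution _ _ _ _ _ P W' k (Cf * Cg)).
rewrite (@Rintegral_distribution _ _ _ _ _ P U' f Cf)//.
rewrite (@Rintegral_distribution _ _ _ _ _ P V' g Cg)//.
transitivity (\int[(distribution P U' \x distribution P V')%E]_z k z).
  by rewrite /Rintegral; congr fine; apply: eq_measure_integral => A mA _; exact/esym/prodE.
transitivity (fine (\int[distribution P U']_x fubini_F (distribution P V') (EFin \o k) x)%E).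
  by rewrite integral12_prod_meas1.
rewrite -RintegralZr// /Rintegral; congr fine; apply: eq_integral => x _.
transitivity ((f x)%:E * \int[distribution P V']_y (g y)%:E)%E.
  exact: (integralZl measurableT ig (f x)).
by rewrite EFinM fineK//; exact: integrable_fin_num.
Qed.

Definition indep_of (R : realType) d (Omega : measurableType d)
    (P : probability Omega R) (V : Omega -> R) (A : set Omega) : Prop :=
  measurable A /\
  forall B, measurable B -> P (A `&` V @^-1` B) = (P A * P (V @^-1` B))%E.

Lemma lambda_system_indep_of (R : realType) d (Omega : measurableType d)
    (P : probability Omega R) (V : Omega -> R) : measurable_fun setT V ->
  lambda_system setT (indep_of P V).
Proof.
move=> mV.
have mVB B : measurable B -> measurable (V @^-1` B).
  by move=> mB; rewrite -[X in measurable X]setTI; exact: mV.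
have fin A : measurable A -> P A \is a fin_num by move=> mA; exact: fin_num_measure.
split => //.
- by split => // B mB; rewrite setTI probability_setT mul1e.
- move=> A B BA [mA iA] [mB iB]; split; first exact: measurableD.
  move=> C mC; have mVC := mVB C mC.
  have -> : (A `\` B) `&` V @^-1` C = (A `&` V @^-1` C) `\` (B `&` V @^-1` C).
    by apply/seteqP; split => w /=; tauto.
  have PD X Y : measurable X -> measurable Y -> Y `<=` X -> P (X `\` Y) = (P X - P Y)%E.
    move=> mX mY YX; rewrite measureD//; first by rewrite (setIidr YX).
    by rewrite ltey_eq fin.
  rewrite PD//; [|exact: measurableI|exact: measurableI|by move=> w /= [/BA]].
  rewrite iA// iB// PD// -(fineK (fin _ mA)) -(fineK (fin _ mB)) -(fineK (fin _ mVC)).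
  exact: (congr1 EFin (esym (mulrBl _ _ _))).
- move=> F ndF iF.
  have mF i : measurable (F i) by have [] := iF i.
  have mUF : measurable (\bigcup_i F i) by exact: bigcup_measurable.
  split => // B mB; have mVC := mVB B mB.
  have c1 := nondecreasing_cvg_mu (mu := P) mF mUF ndF.
  have ndF' : {homo (fun i => F i `&` V @^-1` B) : n m / (n <= m)%N >-> (n <= m)%O}.
    by move=> n m nm; apply/subsetPset; apply: setSI; apply/subsetPset; exact: ndF.
  have c2 := nondecreasing_cvg_mu (mu := P) (fun i => measurableI _ _ (mF i) mVC)
    (bigcup_measurable (fun i _ => measurableI _ _ (mF i) mVC)) ndF'.
  rewrite setI_bigcupl; apply: (cvg_unique _ c2) => //.
  have -> : P \o (fun i => F i `&` V @^-1` B) = (fun i => (P (F i) * P (V @^-1` B))%E).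
    by apply/funext => i /=; have [_ ->] := iF i.
  by rewrite -(fineK (fin _ mVC)); apply: cvgeZr.
Qed.

Lemma indep_of_sigma (R : realType) d (Omega : measurableType d)
    (P : probability Omega R) (V : Omega -> R) (G : set (set Omega)) :
  measurable_fun setT V -> setI_closed G -> G `<=` indep_of P V ->
  <<s G >> `<=` indep_of P V.
Proof.
move=> mV GI GV; apply: lambda_system_subset => //.
exact: lambda_system_indep_of.
Qed.

Definition indep_increments (R : realType) d (Omega : measurableType d)
    (P : probability Omega R) (X : R -> Omega -> R) : Prop :=
  forall (n : nat) (tt : nat -> R) (B : nat -> set R),
    0 <= tt 0%N -> (forall i, tt i <= tt i.+1) -> (forall i, measurable (B i)) ->
    P [set w | forall i, (i < n)%N -> B i (X (tt i.+1) w - X (tt i) w)] =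
    (\prod_(i < n) P [set w | B i (X (tt i.+1) w - X (tt i) w)%R])%E.

Definition increment_rect (R : realType) (Omega : Type) (X : R -> Omega -> R)
    (tt : nat -> R) (n : nat) : set (set Omega) :=
  [set A | exists B : nat -> set R, (forall i, measurable (B i)) /\
    A = [set w | forall i, (i < n)%N -> B i (X (tt i.+1) w - X (tt i) w)]].

Lemma measurable_forall_lt d (Omega : measurableType d) (F : nat -> set Omega) n :
  (forall i, (i < n)%N -> measurable (F i)) ->
  measurable [set w | forall i, (i < n)%N -> F i w].
Proof.
move=> mF.
have -> : [set w | forall i, (i < n)%N -> F i w] =
    \bigcap_i (if (i < n)%N then F i else setT).
  apply/seteqP; split => [w h i _|w h i ni]; first by case: ifP => // /h.
  by have := h i Logic.I; rewrite ni.
by apply: bigcapT_measurable => i; case: ifP => // /mF.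
Qed.

Lemma setI_closed_increment_rect (R : realType) (Omega : Type) (X : R -> Omega -> R)
    (tt : nat -> R) (n : nat) : setI_closed (increment_rect X tt n).
Proof.
move=> _ _ [B [mB ->]] [C [mC ->]]; exists (fun i => B i `&` C i); split.
  by move=> i; exact: measurableI.
apply/seteqP; split => [w [hB hC] i ni|w h]; first by split; [exact: hB|exact: hC].
by split => i ni; have [] := h i ni.
Qed.

Section natural_filtration.
Context (R : realType) d (Omega : measurableType d) (P : probability Omega R).
Variable X : R -> Omega -> R.
Hypothesis mX : forall t, measurable_fun setT (X t).
Hypothesis indX : indep_increments P X.

Let mD s t : measurable_fun setT (fun w => X t w - X s w).
Proof. exact: measurable_funB. Qed.

(** The product formula is applied twice, to the [n] increments and to these followed by the
    increment of length [h]; the grid is extended by the constant time [tt n + h]. *)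
Lemma increment_rect_indep (tt : nat -> R) (n : nat) (h : R) :
  0 <= tt 0%N -> (forall i, tt i <= tt i.+1) -> 0 <= h ->
  increment_rect X tt n `<=` indep_of P (fun w => X (tt n + h) w - X (tt n) w).
Proof.
move=> tt0 ttS h0 _ [B [mB ->]].
have mpre i C : measurable C -> measurable [set w | C (X (tt i.+1) w - X (tt i) w)].
  move=> mC; rewrite -[X in measurable X]setTI; exact: mD.
split; first by apply: measurable_forall_lt => i _; exact: mpre.
move=> C mC; rewrite indX//.
pose tt' i := if (i <= n)%N then tt i else tt n + h.
pose B' i := if (i < n)%N then B i else C.
have tt'S i : tt' i <= tt' i.+1.
  rewrite /tt'; case: (ltngtP i n) => [ni|ni|->].
  - exact: ttS.
  - exact: lexx.
  - by rewrite lerDl.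
have := indX n.+1 (tt := tt') (B := B') tt0 tt'S.
have mB' i : measurable (B' i) by rewrite /B'; case: ifP.
move=> /(_ mB'); rewrite big_ord_recr/=.
have -> : [set w | forall i, (i < n.+1)%N -> B' i (X (tt' i.+1) w - X (tt' i) w)] =
    [set w | forall i, (i < n)%N -> B i (X (tt i.+1) w - X (tt i) w)] `&`
    (fun w => X (tt n + h) w - X (tt n) w) @^-1` C.
  apply/seteqP; split => [w H|w [H1 H2] i].
    split => [i ni|].
      by have := H i (ltnW ni); rewrite /B' /tt' ni (ltnW ni).
    by have := H n (ltnSn n); rewrite /B' /tt' ltnn leqnn.
  rewrite ltnS leq_eqVlt => /predU1P[->|ni]; rewrite /B' /tt'.
    by rewrite ltnn leqnn.
  by rewrite ni (ltnW ni); exact: H1.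
move=> ->; congr (_ * _)%E.
  by apply: eq_bigr => i _; rewrite /B' /tt' ltn_ord (ltnW (ltn_ord i)).
by rewrite /B' /tt' ltnn leqnn.
Qed.

Lemma increment_sigma (tt : nat -> R) (n k : nat) (B : set R) :
  (k <= n)%N -> measurable B ->
  <<s increment_rect X tt n >> [set w | B (X (tt k) w - X (tt 0%N) w)].
Proof.
move=> kn mB.
pose GT := g_sigma_algebraType (increment_rect X tt n).
have mDi i : (i < n)%N -> measurable_fun [set: GT] (fun w : GT => X (tt i.+1) w - X (tt i) w).
  move=> ni _ C mC; rewrite setTI; apply: sub_sigma_algebra.
  exists (fun j => if j == i then C else setT); split; first by move=> j; case: ifP.
  apply/seteqP; split => [w /= h j nj|w /= h]; first by case: eqP => // ->.
  by have := h i ni; rewrite eqxx.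
have mZ : forall k', (k' <= n)%N -> measurable_fun [set: GT] (fun w : GT => X (tt k') w - X (tt 0%N) w).
  elim => [_|j IHj jn].
    by rewrite (_ : (fun _ => _) = (fun=> 0))//; apply/funext => w; rewrite subrr.
  rewrite (_ : (fun _ => _) = (fun w : GT => (X (tt j.+1) w - X (tt j) w) + (X (tt j) w - X (tt 0%N) w))).
    by apply: measurable_funD; [exact: mDi|apply: IHj; exact: ltnW].
  by apply/funext => w; ring.
by have := mZ k kn measurableT B mB; rewrite setTI.
Qed.

(** Values are taken relative to [X 0], which vanishes only almost surely: such differences are sums
    of increments, to which independence applies without exceptional sets. *)
Definition natural_gen (t : R) : set (set Omega) :=
  [set A | exists s B, [/\ 0 <= s <= t, measurable B &
    A = [set w | B (X s w - X 0 w)]]].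

Lemma natural_cylinder_indep (t h : R) (m : nat) (s : nat -> R) (B : nat -> set R) :
  0 <= t -> 0 <= h -> (forall i, 0 <= s i <= t) -> (forall i, measurable (B i)) ->
  indep_of P (fun w => X (t + h) w - X t w)
    [set w | forall i, (i < m)%N -> B i (X (s i) w - X 0 w)].
Proof.
move=> t0 h0 st mB.
pose S := sort <=%R [seq s i | i <- iota 0 m].
have szS : size S = m by rewrite size_sort size_map size_iota.
have St x : x \in S -> 0 <= x <= t.
  by rewrite mem_sort => /mapP[i _ ->].
(* The default value [t] of [nth] closes the grid: past the sorted times it stays at [t], so the
   sequence is nondecreasing and its entry [m + 1] is [t]. *)
pose tt i := nth t (0 :: S) i.
have tt_le i : tt i <= t.
  case: i => [//|i]; rewrite /tt/=.
  have [iS|iS] := ltnP i (size S); last by rewrite nth_default.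
  by have /andP[] := St _ (mem_nth t iS).
have ttS i : tt i <= tt i.+1.
  have [iS|iS] := ltnP i (size S); last by rewrite [leRHS]nth_default// tt_le.
  case: i iS => [|i] iS; first by rewrite /tt/=; have /andP[] := St _ (mem_nth t iS).
  rewrite /tt/=; have : sorted <=%R S by apply: sort_sorted; exact: le_total.
  by move=> /(sortedP t)/(_ i iS).
have ttn : tt m.+1 = t by rewrite /tt/= nth_default// szS.
have := @increment_rect_indep tt m.+1 h (lexx 0) ttS h0; rewrite ttn => rectV.
apply: (indep_of_sigma _ _ rectV); first exact: mD.
  exact: setI_closed_increment_rect.
pose GT := g_sigma_algebraType (increment_rect X tt m.+1).
apply: (@measurable_forall_lt _ GT (fun i => [set w | B i (X (s i) w - X 0 w)])) => i im.
have sS : s i \in S by rewrite mem_sort map_f// mem_iota.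
have -> : s i = tt (index (s i) S).+1 by rewrite /tt/= nth_index.
apply: increment_sigma => //.
by rewrite ltnS -szS index_size.
Qed.

(** The generators alone are not stable under intersection; the finite cylinders are, and they
    generate the same sigma-algebra. *)
Lemma natural_indep (t h : R) : 0 <= t -> 0 <= h ->
  <<s natural_gen t >> `<=` indep_of P (fun w => X (t + h) w - X t w).
Proof.
move=> t0 h0.
pose Cyl := [set A | exists (m : nat) (s : nat -> R) (B : nat -> set R),
  [/\ (forall i, 0 <= s i <= t), (forall i, measurable (B i)) &
    A = [set w | forall i, (i < m)%N -> B i (X (s i) w - X 0 w)]]].
have CylV : Cyl `<=` indep_of P (fun w => X (t + h) w - X t w).
  by move=> _ [m [s [B [st mB ->]]]]; exact: natural_cylinder_indep.
have CylI : setI_closed Cyl.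
  move=> _ _ [m [s [B [st mB ->]]]] [m' [s' [B' [st' mB' ->]]]].
  exists (m + m')%N, (fun i => if (i < m)%N then s i else s' (i - m)%N),
    (fun i => if (i < m)%N then B i else B' (i - m)%N).
  split; [by move=> i; case: ifP|by move=> i; case: ifP|].
  apply/seteqP; split => [w [h1 h2] i|w H].
    case: (ltnP i m) => im im'; first exact: h1.
    by apply: h2; rewrite ltn_subLR.
  split => i im.
    by have := H i (ltn_addr _ im); rewrite im.
  have := H (m + i)%N; rewrite ltn_add2l => /(_ im).
  by rewrite ltnNge leq_addr/= addKn.
apply: subset_trans (indep_of_sigma _ CylI CylV); last exact: mD.
apply: smallest_sub; first exact: smallest_sigma_algebra.
move=> _ [s [B [st mB ->]]]; apply: sub_sigma_algebra.
exists 1%N, (fun=> s), (fun=> B); split => //.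
by apply/seteqP; split => [w h' i _//|w h'] /=; exact: (h' 0%N).
Qed.

Hypothesis X0 : {ae P, forall w, X 0 w = 0}.

Lemma measure_bigcup0 (M : nat -> set Omega) :
  (forall n, measurable (M n) /\ P (M n) = 0%E) ->
  measurable (\bigcup_n M n) /\ P (\bigcup_n M n) = 0%E.
Proof.
move=> hM; have mM : measurable (\bigcup_n M n).
  by apply: bigcup_measurable => n _; have [] := hM n.
split => //; apply/eqP; rewrite -measure_le0.
have := measure_sigma_subadditive P (fun n => (hM n).1) mM (@subset_refl _ _).
by move/le_trans; apply; rewrite eseries0// => n _ _; have [] := hM n.
Qed.

(* Null sets are removed because independence of the increments is only available
   for the raw filtration of [X - X 0]. *)
Lemma aug_natural_modulo (t : R) (A : set Omega) : aug_natural P X t A ->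
  exists A', <<s natural_gen t >> A' /\
  exists M, [/\ measurable M, P M = 0%E & forall w, ~ M w -> (A w <-> A' w)].
Proof.
move: A; rewrite /aug_natural.
apply: smallest_sub; last first.
  have [N [mN PN N0]] := X0.
  move=> A [[s [B [st [mB ->]]]]|[M [mM [PM AM]]]].
    exists [set w | B (X s w - X 0 w)]; split.
      by apply: sub_sigma_algebra; exists s, B.
    exists N; split => // w Nw; have -> : [set w0 | B (X s w0 - X 0 w0)] w = B (X s w - X 0 w) by [].
    suff -> : X 0 w = 0 by rewrite subr0.
    by apply: contrapT => h; apply: Nw; exact: N0.
  exists set0; split; first exact: (@measurable0 _ (g_sigma_algebraType (natural_gen t))).
  by exists M; split => // w Mw; split => // /AM.
split.
- exists set0; split; first exact: (@measurable0 _ (g_sigma_algebraType (natural_gen t))).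
  by exists set0; split.
- move=> A [A' [sA' [M [mM PM h]]]]; exists (~` A'); split.
    exact: (@measurableC _ (g_sigma_algebraType (natural_gen t))).
  exists M; split => // w Mw; have := h w Mw; rewrite setTD /setC/=; tauto.
- move=> F hF; have [F' hF'] := choice hF.
  have [M hM] := choice (fun n => (hF' n).2).
  exists (\bigcup_n F' n); split.
    apply: (@bigcup_measurable _ (g_sigma_algebraType (natural_gen t))) => n _.
    exact: (hF' n).1.
  have [mN PN] : measurable (\bigcup_n M n) /\ P (\bigcup_n M n) = 0%E.
    by apply: measure_bigcup0 => n; have [? ? _] := hM n.
  exists (\bigcup_n M n); split => // w Nw; split => -[n _ Fw]; exists n => //.
    by have [_ _ /(_ w)H] := hM n; apply/H => // Mw; apply: Nw; exists n.
  by have [_ _ /(_ w)H] := hM n; apply/H => // Mw; apply: Nw; exists n.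
Qed.

End natural_filtration.

(** * The process and its exponent *)

Lemma ae_eq_Rintegral d (T : measurableType d) (R : realType)
    (mu : {measure set T -> \bar R}) (f g : T -> R) :
  measurable_fun setT f -> measurable_fun setT g ->
  {ae mu, forall w, f w = g w} -> \int[mu]_w f w = \int[mu]_w g w.
Proof.
move=> mf mg fg; rewrite /Rintegral; congr fine; apply: ae_eq_integral => //.
- exact/measurable_EFinP.
- exact/measurable_EFinP.
- by apply: filterS fg => w -> _.
Qed.

(** Stationarity of the increments in law. Independence factors the characteristic function at
    [t + h] into the one at [t] and that of the increment; the former has modulus [e^(t a(u))],
    never zero, and can be divided out. *)
Lemma increment_cf (R : realType) d (Omega : measurableType d)
    (P : probability Omega R) (X : R -> Omega -> R) (a b : R -> R) (t h u th : R) :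
  (forall t, measurable_fun setT (X t)) -> indep_increments P X ->
  {ae P, forall w, X 0 w = 0} ->
  (forall t u : R, 0 <= t ->
    \int[P]_w cos (u * X t w) = expR (t * a u) * cos (t * b u) /\
    \int[P]_w sin (u * X t w) = expR (t * a u) * sin (t * b u)) ->
  0 <= t -> 0 <= h ->
  \int[P]_w cos (u * (X (t + h) w - X t w) + th) = expR (h * a u) * cos (h * b u + th).
Proof.
move=> mX indX X0 cf t0 h0.
pose Z w := X t w - X 0 w; pose V w := X (t + h) w - X t w.
have mZ : measurable_fun setT Z by exact: measurable_funB.
have mV : measurable_fun setT V by exact: measurable_funB.
have ind A B : measurable A -> measurable B ->
    P (Z @^-1` A `&` V @^-1` B) = (P (Z @^-1` A) * P (V @^-1` B))%E.
  move=> mA mB; suff [_] : indep_of P V (Z @^-1` A) by apply.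
  apply: (natural_indep mX indX t0 h0); apply: sub_sigma_algebra.
  by exists t, A; rewrite t0 lexx.
have mc := @measurable_cosM R u; have ms := @measurable_sinM R u.
have cC x : `|cos (u * x)| <= 1 by exact: cos_max.
have sC x : `|sin (u * x)| <= 1 by exact: sin_max.
have mcX Y : measurable_fun setT Y -> measurable_fun setT (fun w : Omega => cos (u * Y w)).
  by move=> mY; exact: (measurableT_comp mc mY).
have msX Y : measurable_fun setT Y -> measurable_fun setT (fun w : Omega => sin (u * Y w)).
  by move=> mY; exact: (measurableT_comp ms mY).
have EZc : \int[P]_w cos (u * Z w) = expR (t * a u) * cos (t * b u).
  rewrite -(cf t u t0).1; apply: ae_eq_Rintegral; [exact: mcX|exact: mcX|].
  by apply: filterS X0 => w; rewrite /Z => ->; rewrite subr0.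
have EZs : \int[P]_w sin (u * Z w) = expR (t * a u) * sin (t * b u).
  rewrite -(cf t u t0).2; apply: ae_eq_Rintegral; [exact: msX|exact: msX|].
  by apply: filterS X0 => w; rewrite /Z => ->; rewrite subr0.
have th0 : 0 <= t + h by rewrite addr_ge0.
have ZVX w : X 0 w = 0 -> X (t + h) w = Z w + V w.
  by rewrite /Z /V => ->; ring.
have im (f g : R -> R) (Y Y' : Omega -> R) : measurable_fun setT f -> measurable_fun setT g ->
    (forall x, `|f x| <= 1) -> (forall x, `|g x| <= 1) ->
    measurable_fun setT Y -> measurable_fun setT Y' ->
    P.-integrable setT (EFin \o (fun w => f (Y w) * g (Y' w))).
  move=> mf mg fC gC mY mY'; apply: (@integrable_bounded _ _ _ _ _ 1).
    by apply: measurable_funM; exact: measurableT_comp.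
  by move=> w; rewrite normrM -[leRHS]mulr1 ler_pM.
have Ecc := indep_Rintegral mZ mV mc mc cC cC ind.
have Ess := indep_Rintegral mZ mV ms ms sC sC ind.
have Esc := indep_Rintegral mZ mV ms mc sC cC ind.
have Ecs := indep_Rintegral mZ mV mc ms cC sC ind.
have icc := im _ _ _ _ mc mc cC cC mZ mV.
have iss := im _ _ _ _ ms ms sC sC mZ mV.
have isc := im _ _ _ _ ms mc sC cC mZ mV.
have ics := im _ _ _ _ mc ms cC sC mZ mV.
have E1 : expR ((t + h) * a u) * cos ((t + h) * b u) =
    expR (t * a u) * cos (t * b u) * \int[P]_w cos (u * V w) -
    expR (t * a u) * sin (t * b u) * \int[P]_w sin (u * V w).
  rewrite -(cf (t + h) u th0).1 -EZc -EZs -Ecc -Ess -(RintegralB measurableT icc iss).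
  apply: ae_eq_Rintegral; first exact: mcX.
    by apply: measurable_funB; apply: measurable_funM; (exact: mcX || exact: msX).
  by apply: filterS X0 => w /ZVX ->; rewrite mulrDr cosD.
have E2 : expR ((t + h) * a u) * sin ((t + h) * b u) =
    expR (t * a u) * sin (t * b u) * \int[P]_w cos (u * V w) +
    expR (t * a u) * cos (t * b u) * \int[P]_w sin (u * V w).
  rewrite -(cf (t + h) u th0).2 -EZc -EZs -Esc -Ecs -(RintegralD measurableT isc ics).
  apply: ae_eq_Rintegral; first exact: msX.
    by apply: measurable_funD; apply: measurable_funM; (exact: mcX || exact: msX).
  by apply: filterS X0 => w /ZVX ->; rewrite mulrDr sinD.
have icv : P.-integrable setT (EFin \o (fun w => cos (u * V w))).
  by apply: (@integrable_bounded _ _ _ _ _ 1) => [|w]; [exact: mcX|exact: cC].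
have isv : P.-integrable setT (EFin \o (fun w => sin (u * V w))).
  by apply: (@integrable_bounded _ _ _ _ _ 1) => [|w]; [exact: msX|exact: sC].
have icv' : P.-integrable setT (EFin \o (fun w => cos (u * V w) * cos th)).
  exact: (integrableZr measurableT _ icv).
have isv' : P.-integrable setT (EFin \o (fun w => sin (u * V w) * sin th)).
  exact: (integrableZr measurableT _ isv).
rewrite (_ : Rintegral _ _ _ = \int[P]_w cos (u * V w) * cos th - \int[P]_w sin (u * V w) * sin th); last first.
  rewrite -!RintegralZr// -RintegralB//; apply: eq_Rintegral => w _.
  by rewrite cosD.
rewrite cosD; move: E1 E2; rewrite !mulrDl expRD cosD sinD.
move: (\int[P]_w cos _) (\int[P]_w sin _) => Cv Sv.
(* The division in real form: after cancelling [E], the unknowns [Cv], [Sv] solve a linear system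
   whose matrix is the rotation by [t b(u)]. *)
have := cos2Dsin2 (t * b u); have := expR_gt0 (t * a u).
move: (expR (t * a u)) (expR (h * a u)) (cos (t * b u)) (sin (t * b u)).
move: (cos (h * b u)) (sin (h * b u)) => ch sh E F c s E0 cs E1 E2.
have EN : E != 0 by rewrite gt_eqF.
have F1 : F * (c * ch - s * sh) = c * Cv - s * Sv.
  by apply: (mulfI EN); rewrite mulrA E1; ring.
have F2 : F * (s * ch + c * sh) = s * Cv + c * Sv.
  by apply: (mulfI EN); rewrite mulrA E2; ring.
have -> : Cv = F * ch.
  have : (c ^+ 2 + s ^+ 2) * Cv = (c ^+ 2 + s ^+ 2) * (F * ch).
    transitivity (c * (c * Cv - s * Sv) + s * (s * Cv + c * Sv)); first by ring.
    by rewrite -F1 -F2; ring.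
  by rewrite cs !mul1r.
have -> : Sv = F * sh.
  have : (c ^+ 2 + s ^+ 2) * Sv = (c ^+ 2 + s ^+ 2) * (F * sh).
    transitivity (c * (s * Cv + c * Sv) - s * (c * Cv - s * Sv)); first by ring.
    by rewrite -F1 -F2; ring.
  by rewrite cs !mul1r.
by ring.
Qed.

Lemma measurable_le_cst (R : realType) (f g : R -> R) :
  measurable_fun setT f -> measurable_fun setT g ->
  measurable_fun setT (fun x : R => if f x <= g x then 1 else 0 : R).
Proof. by move=> mf mg; apply: measurable_fun_ifT => //; exact: measurable_fun_ler. Qed.

(** * What finite variation says about the triplet *)

Section levy_measure_facts.
Context (R : realType) (nu : {measure set R -> \bar R}).
Hypothesis lev : levy_measure nu.
Hypothesis fin1 :
  (\int[nu]_(x in [set x : R | (`|x| <= 1)%R]) (`|x|)%R%:E < +oo)%E.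

Lemma measurable_norm_le1 : measurable [set x : R | `|x| <= 1].
Proof.
rewrite -[X in measurable X]setTI (_ : [set x : R | `|x| <= 1] = (fun x : R => `|x|) @^-1` `]-oo, 1]).
  exact: normr_measurable.
by apply/seteqP; split => x /=; rewrite in_itv.
Qed.

Lemma measurable_norm_ge1 : measurable [set x : R | 1 <= `|x|].
Proof.
rewrite -[X in measurable X]setTI (_ : [set x : R | 1 <= `|x|] = (fun x : R => `|x|) @^-1` `[1, +oo[).
  exact: normr_measurable.
by apply/seteqP; split => x /=; rewrite in_itv/= andbT.
Qed.

Lemma levy_fv : fv_measure nu.
Proof.
have [_ fin2] := lev.
have i1 : nu.-integrable setT (EFin \o (fun x : R => Num.min (x ^+ 2) 1)).
  apply/integrableP; split.
    apply/measurable_EFinP; apply: measurable_minr => //; exact: exprn_measurable.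
  rewrite (eq_integral (fun x : R => (Num.min (x ^+ 2) 1)%:E))// => x _ /=.
  by rewrite ger0_norm// le_min sqr_ge0 ler01.
have i2 : nu.-integrable setT (EFin \o ((fun x : R => `|x|) \_ [set x : R | `|x| <= 1])).
  rewrite -restrict_EFin; apply/integrable_restrict => //; first exact: measurable_norm_le1.
  rewrite setTI; apply/integrableP; split.
    by apply/measurable_EFinP/measurable_funTS; exact: normr_measurable.
  by under eq_integral do rewrite /= normr_id.
have i3 := integrableD measurableT i2 i1.
apply: (@integrable_dom _ _ _ _ _ _ _ measurableT (measurable_min_norm 1) i3).
move=> x _ /=; rewrite ger0_norm; last by rewrite le_min ler01/=.
have x2 : 0 <= x ^+ 2 := sqr_ge0 x; have x0 := normr_ge0 x.
rewrite /patch; case: ifPn; rewrite ?notin_setE ?inE/= => h.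
  by rewrite ge_min; apply/orP; right; rewrite lerDl le_min x2 ler01.
have h' : 1 < `|x| by rewrite ltNge; apply/negP.
have x21 : 1 <= x ^+ 2 by rewrite -(real_normK (num_real x)) expr_ge1// ltW.
by rewrite min_l ?(ltW h')// min_r// add0r.
Qed.

Let small (x : R) := if `|x| <= 1 then 1 else 0 : R.

Let msmall : measurable_fun setT small.
Proof. by apply: measurable_le_cst => //; exact: normr_measurable. Qed.

Lemma integrable_small_jumps : nu.-integrable setT (EFin \o (fun x : R => x * small x)).
Proof.
apply: (@fv_integrable _ _ _ 1); first exact: levy_fv.
  exact: measurable_funM.
move=> x; rewrite mul1r normrM /small; case: ifPn => h.
  by rewrite normr1 mulr1 le_min h lexx.
by rewrite normr0 mulr0 le_min ler01/=.
Qed.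

Lemma Re_psi_fv (gamma u : R) : Re_psi 0 gamma nu u = fv_re nu u.
Proof. by rewrite /Re_psi expr0n/= !mul0r oppr0 mul0r add0r. Qed.

(** With finite variation the compensator of the small jumps is integrable by itself and can be
    moved into the drift. *)
Lemma Im_psi_fv (gamma u : R) :
  Im_psi 0 gamma nu u = (gamma - \int[nu]_x (x * small x)) * u + fv_im nu u.
Proof.
rewrite /Im_psi mulrBl -addrA; congr (_ + _).
have js := integrable_small_jumps.
have iu : nu.-integrable setT (EFin \o (fun x : R => u * (x * small x))).
  exact: (integrableZl measurableT u js).
transitivity (\int[nu]_x (sin (u * x) - u * (x * small x))).
  by apply: eq_Rintegral => x _; rewrite mulrA.
rewrite RintegralB//; last exact: (fv_integrable_im u levy_fv).
by rewrite RintegralZl// /fv_im addrC mulrC.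
Qed.

Hypothesis exp_fin : (\int[nu]_(x in [set x : R | (1 <= `|x|)%R]) (expR x)%:E < +oo)%E.

Lemma integrable_expR_sub1 : nu.-integrable setT (EFin \o (fun x : R => expR x - 1)).
Proof.
have i2 : nu.-integrable setT (EFin \o (@expR R \_ [set x : R | 1 <= `|x|])).
  rewrite -restrict_EFin; apply/integrable_restrict => //; first exact: measurable_norm_ge1.
  rewrite setTI; apply/integrableP; split.
    by apply/measurable_EFinP/measurable_funTS; exact: measurable_expR.
  by under eq_integral do rewrite /= ger0_norm ?expR_ge0//.
have i1 := integrableZl measurableT (expR 1) levy_fv.
have i3 := integrableD measurableT i1 i2.
have mf : measurable_fun setT (fun x : R => expR x - 1).
  by apply: measurable_funB => //; exact: measurable_expR.
apply: (@integrable_dom _ _ _ _ _ _ _ measurableT mf i3).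
move=> x _ /=; have e1 : 1 <= expR (1 : R) by rewrite -(expR0 R) ler_expR.
have x0 := normr_ge0 x; have ex := expR_gt0 x.
rewrite /patch; case: ifPn; rewrite ?notin_setE ?inE/= => h.
  rewrite min_l// mulr1; apply: (le_trans (ler_normB _ _)).
  by rewrite normr1 gtr0_norm//; lra.
have h' : `|x| < 1 by rewrite ltNge; apply/negP.
rewrite min_r ?(ltW h')// addr0.
have [x0'|x0'] := leP 0 x.
  rewrite (ger0_norm x0') ger0_norm; last by rewrite subr_ge0 -(expR0 R) ler_expR.
  have : expR x <= expR 1 by rewrite ler_expR ltW// -(ger0_norm x0').
  have := expR_ge1Dx (- x).
  have : expR x * expR (- x) = 1 by rewrite -expRD subrr expR0.
  nra.
rewrite (ltr0_norm x0') ler0_norm; last by rewrite subr_le0 -(expR0 R) ler_expR ltW.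
have := expR_ge1Dx x; nra.
Qed.

(** The martingale condition determines the drift of the uncompensated process; the log-price thus
    has drift [d = r - delta - int (e^x - 1)]. *)
Lemma levy_drift (gamma : R) :
  (gamma%:E + \int[nu]_x (expR x - 1 - x * (if `|x| <= 1 then 1 else 0))%R%:E = 0)%E ->
  gamma - \int[nu]_x (x * small x) = - \int[nu]_x (expR x - 1).
Proof.
have js := integrable_small_jumps; have ie := integrable_expR_sub1.
rewrite (_ : (\int[nu]_x _)%E = (\int[nu]_x (expR x - 1) - \int[nu]_x (x * small x))%:E); last first.
  rewrite -RintegralB// /Rintegral fineK//.
  by apply: integrable_fin_num => //; exact: (integrableB measurableT ie js).
by rewrite -EFinD => -[] h; lra.
Qed.

Lemma integrable_put_payoff : nu.-integrable setT (EFin \o @put_payoff R).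
Proof.
apply: (@fv_integrable _ _ _ 1); first exact: levy_fv.
  exact: (bounded_lip_measurable (@bounded_lip_put R)).
by move=> y; rewrite mul1r ger0_norm ?put_payoff_ge0// put_payoff_le.
Qed.

(** Since [(v)_+ = v + (v)_-] with [v = e^y - 1], the number [d_+] is [d - I]. *)
Lemma d_plus_fv (r delta : R) : (0 < d_plus nu r delta)%E ->
  \int[nu]_y put_payoff y < r - delta - \int[nu]_x (expR x - 1).
Proof.
have ie := integrable_expR_sub1; have ip := integrable_put_payoff.
have iep : nu.-integrable setT (EFin \o (fun y : R => Num.max (expR y - 1) 0)).
  have := integrableD measurableT ie ip; apply: eq_integrable => // y _ /=.
  by rewrite -EFinD /put_payoff /Num.max; congr EFin; case: ifPn; rewrite -?leNgt => ?; case: ifPn; rewrite -?leNgt => ?; lra.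
rewrite /d_plus.
rewrite (_ : (\int[nu]_y _)%E = (\int[nu]_x (expR x - 1) + \int[nu]_y put_payoff y)%:E); last first.
  rewrite -RintegralD// /Rintegral fineK; last first.
    by apply: integrable_fin_num => //; exact: (integrableD measurableT ie ip).
  apply: eq_integral => y _; congr EFin.
  by rewrite /put_payoff /Num.max; case: ifPn; rewrite -?leNgt => ?; case: ifPn; rewrite -?leNgt => ?; lra.
by rewrite -EFinB lte_fin => h; lra.
Qed.

Lemma put_payoff_integralE :
  (\int[nu]_y (Num.max (- (expR y - 1)) 0)%:E)%E = (\int[nu]_y put_payoff y)%:E.
Proof.
rewrite /Rintegral fineK; last by apply: integrable_fin_num => //; exact: integrable_put_payoff.
by apply: eq_integral => y _; rewrite opprB.
Qed.

(** The payoff is positive exactly on negative jumps, so a zero integral would make the negative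
    half-line [nu]-null. *)
Lemma put_payoff_integral_gt0 : (0 < nu `]-oo, 0%R[%classic)%E ->
  0 < \int[nu]_y put_payoff y.
Proof.
move=> nu0; rewrite lt_neqAle Rintegral_ge0 ?andbT; last by move=> y _; exact: put_payoff_ge0.
apply/eqP => /esym I0.
have ip := integrable_put_payoff.
have := put_payoff_integralE; rewrite I0 => e0.
have := ae_eq_integral_abs nu measurableT (measurable_int _ ip).
move=> /= H; have {}H : ae_eq nu setT (EFin \o @put_payoff R) (cst 0%E).
  apply/H; rewrite -[RHS]e0; apply: eq_integral => y _ /=.
  by rewrite ger0_norm ?put_payoff_ge0// opprB.
have [N [mN N0 sN]] := H.
move: nu0; rewrite ltNge => /negP; apply; rewrite -N0; apply: le_measure; rewrite ?inE//.
move=> y /=; rewrite in_itv/= => y0; apply: sN => /= /(_ Logic.I) [].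
rewrite /put_payoff => /eqP; rewrite eq_le => /andP[+ _]; rewrite ge_max lexx andbT subr_le0.
by rewrite leNgt expR_lt1 y0.
Qed.

Lemma fv_small_jumps_fin : (\int[nu]_(x in `]0%R, +oo[%classic) (Num.min x 1)%:E < +oo)%E.
Proof.
have fv := levy_fv.
have i1 : nu.-integrable `]0%R, +oo[%classic (EFin \o (fun x : R => Num.min 1 `|x|)).
  exact: integrableS fv.
have := integrable_lty (measurable_itv _) i1; congr (_ < _)%E; apply: eq_integral => x.
by rewrite inE/= in_itv/= andbT => x0; rewrite gtr0_norm// minC.
Qed.

End levy_measure_facts.

(** * Stopped payoffs and the mean of one step *)

Lemma measure_sigma_finiteE d (T : measurableType d) (R : realType)
    (mu : {measure set T -> \bar R}) : sigma_finite setT mu ->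
  exists mu' : {sigma_finite_measure set T -> \bar R},
    mu = mu' :> {measure set T -> \bar R}.
Proof.
case: mu => f [m1 m2] sf.
pose fM : {measure set T -> \bar R} := @Measure.Pack d T R f (@Measure.Class d T R f m1 m2).
pose B := Measure_isSigmaFinite.Build d T R fM sf.
pose mu' : {sigma_finite_measure set T -> \bar R} := HB.pack (fM : set T -> \bar R) fM B.
by exists mu'.
Qed.

(* [f] need not be measurable: its integral is the supremum of the integrals of
   the simple functions below it. *)
Lemma integral_le_simple d (T : measurableType d) (R : realType)
    (mu : {measure set T -> \bar R}) (f : T -> R) (C : \bar R) :
  (forall w, 0 <= f w) ->
  (forall h : T -> R, measurable_fun setT h -> (forall w, 0 <= h w <= f w) ->
    (\int[mu]_w (h w)%:E <= C)%E) ->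
  (\int[mu]_w (f w)%:E <= C)%E.
Proof.
move=> f0 H; rewrite ge0_integralTE; last by move=> w; rewrite lee_fin.
apply: ge_ereal_sup => _ [h /= hf <-]; rewrite -integralT_nnsfun; apply: H; first exact: measurable_funP.
move=> w; apply/andP; split; first exact: fun_ge0.
by have := hf w; rewrite lee_fin.
Qed.

(** A version of Fatou's lemma for non-measurable [f]. For measurable [h <= f], the positive part of
    [h - F n] is at most that of [f - g n], which tends to [0], and is dominated by [h]; only [h]
    and [F n] are ever integrated. *)
Lemma integral_le_liminf d (T : measurableType d) (R : realType)
    (P : probability T R) (f : T -> R) (F g : nat -> T -> R) (B C : R) :
  (forall w, 0 <= f w <= B) ->
  (forall n, P.-integrable setT (EFin \o F n)) ->
  (forall n, \int[P]_w F n w <= C) ->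
  {ae P, forall w, (forall n, 0 <= g n w <= F n w) /\ g ^~ w @ \oo --> f w} ->
  (\int[P]_w (f w)%:E <= C%:E)%E.
Proof.
move=> fB iF FC gF; apply: integral_le_simple => [w|h mh hf]; first by have /andP[] := fB w.
have hB w : `|h w| <= B.
  have /andP[h0 hfw] := hf w; rewrite ger0_norm//.
  by have /andP[_] := fB w; exact: le_trans.
have ih := @integrable_bounded _ _ _ P _ _ mh hB.
have mF n : measurable_fun setT (F n) by apply/measurable_EFinP; exact: measurable_int (iF n).
pose D n w := Num.max (h w - F n w) 0.
have D0 n w : 0 <= D n w by rewrite /D le_max lexx orbT.
have mD n : measurable_fun setT (D n).
  by apply: measurable_maxr => //; exact: measurable_funB.
have [] := @dominated_convergence _ _ _ P setT measurableT
  (fun n w => (D n w)%:E) (cst 0%E) (EFin \o h).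
- by move=> n; apply/measurable_EFinP.
- exact: measurable_cst.
- apply: filterS gF => w [gFw gfw] _.
  apply: cvg_EFin; first by near=> n.
  apply/cvgrPdist_le => e e0; move/cvgrPdist_le : gfw => /(_ e e0).
  apply: filterS => n; rewrite sub0r normrN (ger0_norm (D0 n w)).
  have /andP[g0 gFn] := gFw n; have /andP[h0 hfw] := hf w.
  rewrite ler_norml => /andP[_ fg]; rewrite /D ge_max (ltW e0) andbT.
  by move: fg gFn hfw; rewrite /=; lra.
- exact: ih.
- apply: filterS gF => w [gFw _] n _; rewrite /= lee_fin (ger0_norm (D0 n w)).
  have /andP[g0 gFn] := gFw n; have /andP[h0 hfw] := hf w.
  by rewrite /D ge_max h0 andbT; lra.
move=> _ _; rewrite integral_cst// mul0e => /fine_cvgP[_ cD].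
have hF n : \int[P]_w h w <= C + \int[P]_w D n w.
  have iD : P.-integrable setT (EFin \o D n).
    have i1 : P.-integrable setT (EFin \o (fun w => `|h w - F n w|)).
      exact: (integrable_abse (integrableB measurableT ih (iF n))).
    apply: (@integrable_dom _ _ _ _ _ _ _ measurableT (mD n) i1) => w _ /=.
    have := ler_norm (h w - F n w); have := normr_ge0 (h w - F n w).
    by rewrite (ger0_norm (D0 n w)) /D ge_max => -> ->.
  apply: (@le_trans _ _ (\int[P]_w (F n w + D n w))).
    apply: le_Rintegral => //; first exact: (integrableD measurableT (iF n) iD).
    move=> w _; have : h w - F n w <= D n w by rewrite /D le_max lexx.
    by lra.
  by rewrite RintegralD// lerD2r.
have : \int[P]_w h w <= C + 0.
  apply/ler_addgt0Pr => e e0; rewrite addr0.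
  have /cvgrPdist_le/(_ e e0) := cD.
  move=> /filter_ex[n /=]; rewrite sub0r normrN => dn.
  apply: (le_trans (hF n)); rewrite lerD2l.
  by apply: le_trans dn; exact: ler_norm.
by rewrite addr0 -lee_fin /Rintegral fineK//; exact: integrable_fin_num.
Unshelve. all: by end_near. Qed.

(* One step of the supermartingale [max (K - S, m)], whose floor [m] decreases by
   [K q] at each step; a step has nonpositive mean as soon as [max (1 - Y, - q)] does. *)
Lemma put_one_step (R : realType) (K m x Y q : R) : 0 <= m -> m <= K -> 0 <= x ->
  0 < Y -> 0 <= q ->
  Num.max (K - x * Y) (m - K * q) <=
    Num.max (K - x) m + Num.min x (K - m) * Num.max (1 - Y) (- q).
Proof.
move=> m0 mK x0 Y0 q0; set w := Num.min x (K - m); set z := Num.max (1 - Y) _.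
have w0 : 0 <= w by rewrite le_min x0 subr_ge0.
have wx : w <= x by rewrite ge_min lexx.
have wK : w <= K - m by rewrite ge_min lexx orbT.
have -> : Num.max (K - x) m = K - w.
  rewrite /w /Num.max /Num.min; case: ifPn => h1; case: ifPn => h2; move: h1 h2; rewrite -?leNgt => *; lra.
have z1 : 1 - Y <= z by rewrite le_max lexx.
have z2 : - q <= z by rewrite le_max lexx orbT.
have := ler_wpM2l w0 z1; have := ler_wpM2l w0 z2.
have := ler_wpM2r (ltW Y0) wx; have : w * q <= K * q by rewrite ler_wpM2r//; lra.
by rewrite ge_max => *; apply/andP; split; lra.
Qed.

Section increments.
Context (R : realType) d (Omega : measurableType d) (P : probability Omega R).
Context (nu : {sigma_finite_measure set R -> \bar R}).
Variables (X : R -> Omega -> R) (gamma : R).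
Hypothesis levX : is_levy_process P X 0 gamma nu.
Hypothesis fin1 :
  (\int[nu]_(x in [set x : R | (`|x| <= 1)%R]) (`|x|)%R%:E < +oo)%E.
Hypothesis exp_fin : (\int[nu]_(x in [set x : R | (1 <= `|x|)%R]) (expR x)%:E < +oo)%E.
Hypothesis martingale :
  (gamma%:E + \int[nu]_x (expR x - 1 - x * (if `|x| <= 1 then 1 else 0))%R%:E = 0)%E.

Let levn : levy_measure nu. Proof. by case: levX. Qed.
Let mX t : measurable_fun setT (X t). Proof. by case: levX => [_ []]. Qed.
Let indX : indep_increments P X. Proof. by case: levX => [_ [_ [_ [_ []]]]]. Qed.
Let X0 : {ae P, forall w, X 0 w = 0}. Proof. by case: levX => [_ [_ []]]. Qed.
Let fv : fv_measure nu. Proof. exact: levy_fv. Qed.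

Lemma increment_levy_cf (k t h : R) : 0 <= t -> 0 <= h ->
  levy_cf nu P (k - \int[nu]_x (expR x - 1)) h (fun w => k * h + (X (t + h) w - X t w)).
Proof.
move=> t0 h0; split.
  by apply: measurable_funD => //; exact: measurable_funB.
move=> u th.
pose b u := - (\int[nu]_x (expR x - 1)) * u + fv_im nu u.
have cf s v : 0 <= s ->
    \int[P]_w cos (v * X s w) = expR (s * fv_re nu v) * cos (s * b v) /\
    \int[P]_w sin (v * X s w) = expR (s * fv_re nu v) * sin (s * b v).
  move=> s0; have [_ [_ [_ [_ [_ /(_ s v s0)[c1 c2]]]]]] := levX.
  rewrite /Rintegral c1 c2/= (Re_psi_fv nu gamma) (Im_psi_fv levn fin1).
  by rewrite (levy_drift levn fin1 exp_fin martingale).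
transitivity (\int[P]_w cos (u * (X (t + h) w - X t w) + (u * (k * h) + th))).
  by apply: eq_Rintegral => w _; congr cos; ring.
rewrite (increment_cf u _ mX indX X0 cf)//; congr (_ * cos _).
by rewrite /b; ring.
Qed.

Lemma small_put_increment (k e : R) : \int[nu]_x (expR x - 1) <= k -> 0 < e ->
  exists2 h0 : R, 0 < h0 & forall t h : R, 0 <= t -> 0 < h -> h < h0 ->
  `| \int[P]_w put_payoff (k * h + (X (t + h) w - X t w)) -
     h * \int[nu]_y put_payoff y | <= e * h.
Proof.
move=> k0 e0; have c0 : 0 <= k - \int[nu]_x (expR x - 1) by rewrite subr_ge0.
have [_ /(_ e e0)[h0 h00 H]] := small_time_put P fv c0.
exists h0 => // t h t0 hp hh0.
have := H h _ hp hh0 (increment_levy_cf k t0 (ltW hp)).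
rewrite (put_payoff_pos (mulr_ge0 c0 (ltW hp))) subr0.
suff -> : \int[nu]_y (put_payoff y - put_payoff 0) = \int[nu]_y put_payoff y by [].
by apply: eq_Rintegral => y _; rewrite (put_payoff_pos (lexx 0)) subr0.
Qed.

(** Multiplying by [e^(lam h)] turns the floor into a put: [max (1 - Y) (- lam h)] is at most
    [e^(lam h) (1 - e^(- lam h) Y)_+ - lam h]. The new put has drift [d - lam >= 0], so its mean is
    [h I + o(h)], and [I < lam] absorbs the factor [e^(lam h)]. *)
Lemma step_mean_le0 (k lam : R) : \int[nu]_y put_payoff y < lam ->
  lam <= k - \int[nu]_x (expR x - 1) ->
  exists2 h0 : R, 0 < h0 & forall t h : R, 0 <= t -> 0 < h -> h < h0 ->
  \int[P]_w Num.max (1 - expR (k * h + (X (t + h) w - X t w))) (- (lam * h)) <= 0.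
Proof.
set I := \int[nu]_y put_payoff y => Ilam lamk.
have I0 : 0 <= I by apply: Rintegral_ge0 => y _; exact: put_payoff_ge0.
have e0 : 0 < (lam - I) / 2 by rewrite divr_gt0// subr_gt0.
have kl : \int[nu]_x (expR x - 1) <= k - lam by lra.
have [h1 h10 H] := small_put_increment kl e0.
set e := (lam - I) / 2 in e0 H.
have l0 : 0 < lam by lra.
(* As [I + e = lam - e], the requirement [I + e <= lam e^(- lam h)] follows from
   [e^(- lam h) >= 1 - lam h] when [lam^2 h < e]. *)
exists (Num.min h1 (e / lam ^+ 2)); first by rewrite lt_min h10 divr_gt0// exprn_gt0.
move=> t h t0 hp; rewrite lt_min => /andP[hh1 hh2].
have {hh2} hh2 : lam * (lam * h) < e.
  by move: hh2; rewrite ltr_pdivlMr ?exprn_gt0// mulrC expr2 mulrA.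
pose V w := X (t + h) w - X t w.
have mV : measurable_fun setT V by exact: measurable_funB.
have mp : measurable_fun setT (fun w => put_payoff ((k - lam) * h + V w)).
  apply: (measurableT_comp (bounded_lip_measurable (@bounded_lip_put R))).
  exact: measurable_funD.
have ip : P.-integrable setT (EFin \o (fun w => put_payoff ((k - lam) * h + V w))).
  apply: (@integrable_bounded _ _ _ _ _ 1) => // w; rewrite ger0_norm ?put_payoff_ge0//.
  by rewrite (le_trans (put_payoff_le _))// ge_min lexx.
set E := expR (lam * h).
have iE : P.-integrable setT (EFin \o (fun w => E * put_payoff ((k - lam) * h + V w))).
  exact: (integrableZl measurableT E ip).
have ic : P.-integrable setT (EFin \o (fun w : Omega => lam * h)).
  by apply: (@integrable_bounded _ _ _ _ _ `|lam * h|).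
apply: (@le_trans _ _ (\int[P]_w (E * put_payoff ((k - lam) * h + V w) - lam * h))).
  apply: le_Rintegral => //.
  - apply: (@integrable_bounded _ _ _ _ _ (1 + lam * h)).
      apply: measurable_maxr => //; apply: measurable_funB => //.
      apply: measurableT_comp; first exact: measurable_expR.
      exact: measurable_funD.
    move=> w; have := expR_gt0 (k * h + (X (t + h) w - X t w)).
    have lh : 0 < lam * h by rewrite mulr_gt0.
    by rewrite ler_norml le_max ge_max => *; apply/andP; split; [apply/orP; right|apply/andP; split]; lra.
  - exact: (integrableB measurableT iE ic).
  move=> w _; rewrite /put_payoff -/(V w) maxr_pMr ?expR_ge0// mulr0 mulrBr mulr1.
  have -> : E * expR ((k - lam) * h + V w) = expR (k * h + V w).
    by rewrite /E -expRD; congr expR; ring.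
  have := expR_ge1Dx (lam * h); rewrite -/E => E1.
  rewrite ge_max; apply/andP; split.
    by rewrite lerBrDr le_max; apply/orP; left; lra.
  by rewrite lerBrDr addNr le_max lexx orbT.
rewrite RintegralB// RintegralZl// probability_Rintegral_cst.
have := H t h t0 hp hh1; rewrite ler_norml -/I => /andP[_]; rewrite lerBlDr -/V.
move=> Hle; have E0 : 0 < E by exact: expR_gt0.
rewrite subr_le0; apply: (le_trans (ler_wpM2l (ltW E0) Hle)).
have EN : E * expR (- (lam * h)) = 1 by rewrite -expRD subrr expR0.
have := expR_ge1Dx (- (lam * h)) => EN1.
have : I + e <= lam * expR (- (lam * h)).
  by apply: le_trans (ler_wpM2l (ltW l0) EN1); rewrite /e in hh2 *; lra.
move=> /(ler_wpM2l (ltW E0)); rewrite mulrCA EN mulr1 => /(ler_wpM2r (ltW hp)).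
by rewrite -mulrA mulrDl [h * I]mulrC addrC.
Qed.

End increments.

(** * The discretised supermartingale *)

(** The filtration of the stopping time is a right limit, but the strict inequality is a countable
    union of events [tau <= u - 1/(m+1)], each already known at time [u]. Independence of the
    increment after [u] can therefore be used. *)
Lemma aug_natural_lt (R : realType) d (Omega : measurableType d)
    (P : probability Omega R) (X : R -> Omega -> R) (s u : R) (tau : Omega -> R) :
  stopping_time_le P X s tau -> aug_natural P X u [set w | tau w < u].
Proof.
move=> [_ st]; rewrite /aug_natural.
have -> : [set w | tau w < u] = \bigcup_m [set w | tau w <= u - m.+1%:R^-1].
  apply/seteqP; split => [w /= tu|w [m _ /= tm]].
    have e0 : 0 < u - tau w by rewrite subr_gt0.
    have [m _ /(_ m (leqnn m)) /ltW hm] := near_infty_natSinv_lt (PosNum e0).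
    by exists m => //=; rewrite lerBrDr addrC -lerBrDr.
  by apply: (le_lt_trans tm); rewrite ltrBlDr ltrDl invr_gt0.
set G := (X in <<s X >>).
apply: (@bigcup_measurable _ (g_sigma_algebraType G)) => m _.
by apply: (st (u - m.+1%:R^-1)); rewrite ltrBlDr ltrDl invr_gt0.
Qed.

Section grid.
Context (R : realType) d (Omega : measurableType d) (P : probability Omega R).
Variables (X : R -> Omega -> R) (k K lam x h : R) (n : nat) (A : nat -> set Omega).
Hypothesis mX : forall t, measurable_fun setT (X t).
Hypothesis indX : indep_increments P X.
Hypothesis K0 : 0 < K.
Hypothesis lam0 : 0 < lam.
Hypothesis h0 : 0 < h.
Hypothesis x0 : 0 <= x.
Hypothesis lamn : lam * (h * n.+1%:R) <= 1.
Hypothesis mean_le0 : forall t : R, 0 <= t ->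
  \int[P]_w Num.max (1 - expR (k * h + (X (t + h) w - X t w))) (- (lam * h)) <= 0.
Hypothesis sA : forall i, <<s natural_gen X (i%:R * h) >> (A i).

Definition grid_price i w := x * expR (k * (i%:R * h) + (X (i%:R * h) w - X 0 w)).
Definition grid_floor i := K * (lam * (h * (n.+1%:R - i%:R))).
Definition grid_step i w :=
  Num.max (1 - expR (k * h + (X (i%:R * h + h) w - X (i%:R * h) w))) (- (lam * h)).
(** The coefficient from [put_one_step], switched off once [A i], the event of having stopped, has
    occurred. It is known at time [i h] and stays in [[0, K]]. *)
Definition grid_weight i w :=
  \1_(~` A i) w * Num.min (grid_price i w) (K - grid_floor i).
(** An explicit majorant of the stopped supermartingale: being a sum of known weights times later
    steps, its mean is bounded term by term by independence, without conditional expectations. *)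
Definition grid_sum j w := Num.max (K - x) (grid_floor 0) +
  \sum_(i < j) grid_weight i w * grid_step i w.

Let ih i : 0 <= i%:R * h. Proof. by rewrite mulr_ge0// ltW. Qed.

Lemma grid_floor_bounds i : (i <= n.+1)%N -> 0 <= grid_floor i <= K.
Proof.
move=> ni; rewrite /grid_floor.
have ni' : (i%:R : R) <= n.+1%:R by rewrite ler_nat.
have i0 : (0 : R) <= i%:R by [].
have l1 : lam * (h * (n.+1%:R - i%:R)) <= 1.
  by apply: le_trans lamn; rewrite ler_wpM2l ?ler_wpM2l ?(ltW lam0) ?(ltW h0)// lerBlDr lerDl.
have l2 : 0 <= lam * (h * (n.+1%:R - i%:R)).
  by rewrite mulr_ge0 ?(ltW lam0)// mulr_ge0 ?(ltW h0)// subr_ge0.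
by rewrite mulr_ge0 ?(ltW K0)//= ler_piMr// ltW.
Qed.

Lemma grid_floorS i : grid_floor i.+1 = grid_floor i - K * (lam * h).
Proof. by rewrite /grid_floor -(natr1 i); ring. Qed.

Lemma grid_priceS i w : grid_price i.+1 w =
  grid_price i w * expR (k * h + (X (i%:R * h + h) w - X (i%:R * h) w)).
Proof.
rewrite /grid_price -mulrA -expRD; have -> : i.+1%:R * h = i%:R * h + h.
  by rewrite -natr1 mulrDl mul1r.
by congr (_ * expR _); ring.
Qed.

Lemma grid_price_ge0 i w : 0 <= grid_price i w.
Proof. by rewrite mulr_ge0// expR_ge0. Qed.

Lemma grid_weight_bounds i w : (i <= n.+1)%N -> 0 <= grid_weight i w <= K.
Proof.
move=> /grid_floor_bounds/andP[m0 mK]; rewrite /grid_weight.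
have := grid_price_ge0 i w => s0.
have c0 : 0 <= Num.min (grid_price i w) (K - grid_floor i) by rewrite le_min s0 subr_ge0.
have cK : Num.min (grid_price i w) (K - grid_floor i) <= K.
  by rewrite ge_min; apply/orP; right; rewrite lerBlDr lerDl.
rewrite indicE; case: (_ \in _); rewrite /= ?mul1r ?mul0r ?lexx ?(ltW K0)//.
by rewrite c0 cK.
Qed.

Lemma measurable_grid_weight i :
  @measurable_fun _ _ (g_sigma_algebraType (natural_gen X (i%:R * h))) R setT (grid_weight i).
Proof.
pose GT := g_sigma_algebraType (natural_gen X (i%:R * h)).
have mA : @measurable _ GT (~` A i) by apply: measurableC; exact: sA.
have mXi : measurable_fun [set: GT] (fun w : GT => X (i%:R * h) w - X 0 w).
  move=> _ B mB; rewrite setTI; apply: sub_sigma_algebra.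
  by exists (i%:R * h), B; rewrite ih lexx.
apply: (@measurable_funM _ GT); first exact: measurable_indic.
apply: (@measurable_minr _ GT) => //.
apply: (@measurable_funM _ GT) => //.
apply: (measurableT_comp (@measurable_expR R)).
exact: (@measurable_funD _ GT).
Qed.

Lemma measurable_grid_step i : measurable_fun setT (grid_step i).
Proof.
apply: measurable_maxr => //; apply: measurable_funB => //.
apply: measurableT_comp; first exact: measurable_expR.
by apply: measurable_funD => //; exact: measurable_funB.
Qed.

Lemma grid_weight_indep i B : measurable B ->
  indep_of P (fun w => X (i%:R * h + h) w - X (i%:R * h) w) (grid_weight i @^-1` B).
Proof.
move=> mB; apply: (natural_indep mX indX (ih i) (ltW h0)).
by have := @measurable_grid_weight i measurableT B mB; rewrite setTI.
Qed.

Lemma measurable_grid_weightT i : measurable_fun setT (grid_weight i).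
Proof. by move=> _ B mB; rewrite setTI; case: (@grid_weight_indep i B mB). Qed.

Let step_bound (v : R) :
  `| Num.max (1 - expR (k * h + v)) (- (lam * h)) | <= 1 + lam * h.
Proof.
have lh : 0 < lam * h by rewrite mulr_gt0.
have := expR_gt0 (k * h + v).
by rewrite ler_norml le_max ge_max => *; apply/andP; split; [apply/orP; right|apply/andP; split]; lra.
Qed.

Lemma integrable_grid_term i : (i <= n)%N ->
  P.-integrable setT (EFin \o (fun w => grid_weight i w * grid_step i w)).
Proof.
move=> ni; apply: (@integrable_bounded _ _ _ _ _ (K * (1 + lam * h))).
  by apply: measurable_funM; [exact: measurable_grid_weightT|exact: measurable_grid_step].
move=> w; have /andP[w0 wK] := @grid_weight_bounds i w (leqW ni).
by rewrite normrM ler_pM//; [rewrite ger0_norm|exact: step_bound].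
Qed.

Lemma grid_term_mean i : (i <= n)%N -> \int[P]_w (grid_weight i w * grid_step i w) <= 0.
Proof.
move=> ni.
pose V w := X (i%:R * h + h) w - X (i%:R * h) w.
have mV : measurable_fun setT V by exact: measurable_funB.
(* The identity on [[0, K]], where the weight lives; truncated because the product formula wants a
   function bounded on the whole line. *)
pose f (u : R) := Num.min (Num.max u 0) K.
pose g (v : R) := Num.max (1 - expR (k * h + v)) (- (lam * h)).
have mf : measurable_fun setT f.
  by apply: measurable_minr => //; exact: measurable_maxr.
have mg : measurable_fun setT g.
  apply: measurable_maxr => //; apply: measurable_funB => //.
  by apply: (measurableT_comp (@measurable_expR R)); exact: measurable_funD.
have fK u : `|f u| <= K.
  by rewrite /f ger0_norm ?ge_min ?lexx ?orbT// le_min le_max lexx orbT (ltW K0).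
have fU w : f (grid_weight i w) = grid_weight i w.
  have /andP[w0 wK] := @grid_weight_bounds i w (leqW ni).
  by rewrite /f max_l// min_l.
have ind B C : measurable B -> measurable C ->
    P (grid_weight i @^-1` B `&` V @^-1` C) =
    (P (grid_weight i @^-1` B) * P (V @^-1` C))%E.
  by move=> mB mC; have [_] := @grid_weight_indep i B mB; apply.
have := indep_Rintegral (@measurable_grid_weightT i) mV mf mg fK step_bound ind.
under eq_Rintegral do rewrite fU.
move=> ->; rewrite mulr_ge0_le0//; last exact: mean_le0.
by apply: Rintegral_ge0 => w _; rewrite fU; have /andP[] := @grid_weight_bounds i w (leqW ni).
Qed.

Lemma grid_sum_mean j : (j <= n.+1)%N ->
  P.-integrable setT (EFin \o grid_sum j) /\
  \int[P]_w grid_sum j w <= Num.max (K - x) (grid_floor 0).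
Proof.
elim: j => [_|j IHj jn].
  have e : grid_sum 0 = cst (Num.max (K - x) (grid_floor 0)).
    by apply/funext => w; rewrite /grid_sum big_ord0 addr0.
  rewrite e; split; last by rewrite probability_Rintegral_cst.
  exact: (@integrable_bounded _ _ _ _ _ `|Num.max (K - x) (grid_floor 0)|).
have [i1 m1] := IHj (ltnW jn).
have i2 := @integrable_grid_term j jn.
have e : grid_sum j.+1 = (fun w => grid_sum j w + grid_weight j w * grid_step j w).
  by apply/funext => w; rewrite /grid_sum big_ord_recr/= addrA.
rewrite e; split; first exact: (integrableD measurableT i1 i2).
rewrite RintegralD//; have := grid_term_mean jn; move: m1; lra.
Qed.

(** Here [c] is the stopping index of the path: up to it [put_one_step] propagates the bound, and
    after it all weights vanish. *)
Lemma grid_sum_path w (c : nat) : (c <= n.+1)%N ->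
  (forall i, (i < c)%N -> ~ A i w) -> (forall i, (c <= i)%N -> A i w) ->
  Num.max (K - grid_price c w) (grid_floor c) <= grid_sum n.+1 w.
Proof.
move=> cn Ac cA.
have step1 j : (j <= c)%N ->
    Num.max (K - grid_price j w) (grid_floor j) <= grid_sum j w.
  elim: j => [_|j IHj jc].
    by rewrite /grid_sum big_ord0 addr0 /grid_price mul0r mulr0 add0r subrr expR0 mulr1.
  rewrite /grid_sum big_ord_recr/= addrA -/(grid_sum j w).
  apply: le_trans (lerD (IHj (ltnW jc)) (lexx _)).
  have jn : (j <= n.+1)%N by exact: leq_trans (ltnW jc) cn.
  have /andP[m0 mK] := grid_floor_bounds jn.
  rewrite grid_priceS grid_floorS /grid_weight indicE mem_set ?mul1r; last exact: Ac.
  apply: put_one_step => //; [exact: grid_price_ge0|exact: expR_gt0|].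
  by rewrite mulr_ge0// ltW.
suff -> : grid_sum n.+1 w = grid_sum c w by exact: step1.
have : forall j, (c <= j)%N -> grid_sum j w = grid_sum c w.
  elim => [|j IHj]; first by rewrite leqn0 => /eqP ->.
  rewrite leq_eqVlt => /predU1P[<-//|cj].
  rewrite -(IHj cj) /grid_sum big_ord_recr/= /grid_weight indicE memNset ?mul0r ?addr0//.
  by move=> /(_ (cA j cj)).
exact.
Qed.

End grid.

(** * The American put and its critical price *)

Lemma discounted_payoff_bounds (R : realType) (Omega : Type) (X : R -> Omega -> R)
    (r delta K x t : R) (w : Omega) : 0 <= K -> 0 <= r -> 0 <= x -> 0 <= t ->
  0 <= expR (- r * t) * Num.max (K - price X r delta x t w) 0 <= K.
Proof.
move=> K0 r0 x0 t0.
have e1 : expR (- r * t) <= 1 by rewrite -(expR0 R) ler_expR mulNr oppr_le0 mulr_ge0.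
have pr0 : 0 <= price X r delta x t w by rewrite mulr_ge0// expR_ge0.
have m0 : 0 <= Num.max (K - price X r delta x t w) 0 by rewrite le_max lexx orbT.
rewrite mulr_ge0 ?expR_ge0//= (le_trans (ler_piMl m0 e1))//.
by rewrite ge_max K0 andbT lerBlDr lerDl.
Qed.

Section american_put.
Context (R : realType) d (Omega : measurableType d) (P : probability Omega R).
Variable X : R -> Omega -> R.
Hypothesis mX : forall t, measurable_fun setT (X t).
Hypothesis indX : indep_increments P X.
Hypothesis X0 : {ae P, forall w, X 0 w = 0}.

(** Rounding [tau] strictly upwards makes [tau < i h] the event of having stopped by step [i]. The
    rounded time may exceed the horizon [n h] by one step, hence [n + 1] steps and a floor starting
    from [K lam h (n + 1)]. *)
Lemma grid_dominates (k K lam x h : R) (n : nat) (tau : Omega -> R) :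
  0 < K -> 0 < lam -> 0 < h -> 0 <= x -> lam * (h * n.+1%:R) <= 1 ->
  (forall t : R, 0 <= t ->
    \int[P]_w Num.max (1 - expR (k * h + (X (t + h) w - X t w))) (- (lam * h)) <= 0) ->
  stopping_time_le P X (n%:R * h) tau ->
  exists F : Omega -> R, [/\ P.-integrable setT (EFin \o F),
    \int[P]_w F w <= Num.max (K - x) (K * (lam * (h * n.+1%:R))) &
    {ae P, forall w,
      Num.max (K - grid_price X k x h (Num.trunc (tau w / h)).+1 w) 0 <= F w}].
Proof.
move=> K0 lam0 h0 x0 lamn mean st.
have [A hA] := choice (fun i => aug_natural_modulo X0 (@aug_natural_lt _ _ _ _ _ _ (i%:R * h) _ st)).
have [M hM] := choice (fun i => (hA i).2).
have [mM PM] : measurable (\bigcup_i M i) /\ P (\bigcup_i M i) = 0%E.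
  by apply: measure_bigcup0 => i; have [] := hM i.
have sA i := (hA i).1.
have [iF mF] := grid_sum_mean mX indX K0 lam0 h0 x0 lamn mean sA (leqnn n.+1).
exists (grid_sum X k K lam x h n A n.+1); split => //.
  by move: mF; rewrite /grid_floor subr0.
exists (\bigcup_i M i); split => // w /=; apply: contra_notP => Mw.
have tA i : tau w < i%:R * h <-> A i w.
  by have [_ _] := hM i; apply => Miw; apply: Mw; exists i.
have /andP[t0 tn] := st.1 w.
have th0 : 0 <= tau w / h by rewrite divr_ge0// ltW.
set c := (Num.trunc (tau w / h)).+1.
have cn : (c <= n.+1)%N.
  by rewrite ltnS truncn_le_nat ltr_pdivrMr// (le_lt_trans tn)// ltr_pM2r// ltr_nat.
have /andP[m0 _] := grid_floor_bounds K0 lam0 h0 lamn cn.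
apply: (@le_trans _ _ (Num.max (K - grid_price X k x h c w) (grid_floor K lam h n c))).
  by rewrite ge_max !le_max lexx m0 orbT.
apply: (grid_sum_path X k K0 lam0 h0 x0 lamn cn).
- move=> i ic /tA; apply/negP; rewrite -leNgt -ler_pdivlMr//.
  by rewrite -truncn_ge_nat.
- by move=> i ci; apply/tA; rewrite -ltr_pdivrMr// -truncn_lt_nat.
Qed.

Hypothesis cadX : {ae P, forall w, cadlag (fun t => X t w)}.

Lemma stopped_put_le (r delta K lam x s : R) (tau : Omega -> R) :
  0 < K -> 0 < lam -> 0 < s -> 0 <= x -> 0 <= r -> K * (lam * s) < K - x ->
  (exists2 h0 : R, 0 < h0 & forall t h : R, 0 <= t -> 0 < h -> h < h0 ->
    \int[P]_w Num.max (1 - expR ((r - delta) * h + (X (t + h) w - X t w))) (- (lam * h)) <= 0) ->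
  stopping_time_le P X s tau ->
  (\int[P]_w (expR (- r * tau w) * Num.max (K - price X r delta x (tau w) w) 0)%:E
    <= (K - x)%:E)%E.
Proof.
move=> K0 lam0 s0 x0 r0 Kx [h0 h00 mean] st.
pose hh n : R := s / n.+1%:R.
have hh_gt0 n : 0 < hh n by rewrite divr_gt0.
have hhn n : n.+1%:R * hh n = s by rewrite /hh mulrC divfK.
have cvh : hh @ \oo --> (0 : R).
  rewrite -(mulr0 s); apply: cvgM; first exact: cvg_cst.
  exact: cvg_harmonic.
(* The extra step raises the initial floor by [K lam] times the mesh; the strict gap between
   [K lam s] and [K - x] absorbs it for fine grids. *)
have e0 : 0 < Num.min h0 ((K - x - K * (lam * s)) / (K * lam)).
  by rewrite lt_min h00 divr_gt0 ?subr_gt0// mulr_gt0.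
have [N _ hN] : \forall n \near \oo, hh n < Num.min h0 ((K - x - K * (lam * s)) / (K * lam)).
  have /cvgrPdist_lt/(_ _ e0) := cvh; apply: filterS => n.
  by rewrite sub0r normrN gtr0_norm.
have HF n : exists F : Omega -> R, [/\ P.-integrable setT (EFin \o F),
    \int[P]_w F w <= K - x &
    {ae P, forall w, Num.max (K - grid_price X (r - delta) x (hh (n + N)%N)
      (Num.trunc (tau w / hh (n + N)%N)).+1 w) 0 <= F w}].
  have := hN (n + N)%N (leq_addl _ _); rewrite lt_min => /andP[hh0].
  rewrite ltr_pdivlMr ?mulr_gt0// => hK.
  have Kn : K * (lam * (hh (n + N)%N * (n + N).+2%:R)) <= K - x.
    rewrite -(natr1 (n + N).+1) mulrDr mulr1 [hh _ * _]mulrC hhn.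
    by move: hK; lra.
  have [|||F [iF mF gF]] := @grid_dominates (r - delta) K lam x (hh (n + N)%N) (n + N).+1 tau
      K0 lam0 (hh_gt0 _) x0.
  - by rewrite -(ler_pM2l K0) mulr1 (le_trans Kn)// lerBlDr lerDl.
  - by move=> t t0; exact: mean.
  - by rewrite hhn.
  by exists F; split => //; apply: le_trans mF _; rewrite ge_max lexx Kn.
have [F hF] := choice HF.
pose g n w := expR (- r * tau w) * Num.max (K - grid_price X (r - delta) x (hh (n + N)%N)
      (Num.trunc (tau w / hh (n + N)%N)).+1 w) 0.
apply: (@integral_le_liminf _ _ _ P _ F g K).
- by move=> w; apply: discounted_payoff_bounds => //; [exact: ltW|by have /andP[] := st.1 w].
- by move=> n; have [] := hF n.
- by move=> n; have [] := hF n.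
have aeF : {ae P, forall w n, Num.max (K - grid_price X (r - delta) x (hh (n + N)%N)
      (Num.trunc (tau w / hh (n + N)%N)).+1 w) 0 <= F n w}.
  by apply: ae_foralln => n; have [] := hF n.
apply: filterS3 aeF cadX X0 => w Fw cadw X0w; have /andP[t0 ts] := st.1 w.
have e1 : expR (- r * tau w) <= 1.
  by rewrite -(expR0 R) ler_expR mulNr oppr_le0 mulr_ge0.
(* For this upper bound the discount factor is merely bounded by [1]. *)
split => [n|].
  rewrite /g mulr_ge0 ?expR_ge0 ?le_max ?lexx ?orbT//=.
  by apply: le_trans (Fw n); rewrite ler_piMl// le_max lexx orbT.
apply: cvgM; first exact: cvg_cst.
pose u n := (Num.trunc (tau w / hh (n + N)%N)).+1%:R * hh (n + N)%N.
have ut n : tau w < u n by rewrite /u -ltr_pdivrMr// truncnS_gt.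
have cu : u @ \oo --> tau w.
  have cvh' : (fun n => hh (n + N)%N) @ \oo --> (0 : R) by exact: (cvg_comp _ _ (cvg_addnr N) cvh).
  (* The rounded times exceed [tau] by at most one mesh, and strictly, so right continuity of the
     paths applies. *)
  apply/cvgrPdist_le => e ep; have /cvgrPdist_le/(_ e ep) := cvh'.
  apply: filterS => n; rewrite sub0r normrN gtr0_norm// => he.
  rewrite ltr0_norm ?subr_lt0// opprB.
  have : (Num.trunc (tau w / hh (n + N)%N))%:R * hh (n + N)%N <= tau w.
    by rewrite -ler_pdivlMr// truncn_le divr_ge0// ltW.
  by rewrite /u -natr1 mulrDl mul1r; lra.
have cXu : (fun n => X (u n) w) @ \oo --> X (tau w) w.
  by have [/cvg_at_rightP c _] := cadw _ t0; apply: c.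
have cmax : {for K - price X r delta x (tau w) w, continuous (fun z : R => Num.max z 0)}.
  by apply: continuous_max; [exact: cvg_id|exact: cvg_cst].
apply: (continuous_cvg _ cmax); apply: cvgB; first exact: cvg_cst.
apply: cvgM; first exact: cvg_cst.
apply: (continuous_cvg _ (@continuous_expR R _)).
apply: cvgD; first by apply: cvgM => //; exact: cvg_cst.
by under eq_fun do rewrite X0w subr0.
Qed.

Lemma stopping_time_cst (s : R) : 0 <= s -> stopping_time_le P X s (fun=> s).
Proof.
move=> s0; split => [w|u v uv]; first by rewrite s0 lexx.
rewrite /aug_natural; set G := (X in <<s X >>).
have [su|su] := boolP (s <= u).
  rewrite (_ : [set w | _] = setT); last by apply/seteqP; split.
  exact: (@measurableT _ (g_sigma_algebraType G)).
rewrite (_ : [set w | _] = set0); last by apply/seteqP; split.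
exact: (@measurable0 _ (g_sigma_algebraType G)).
Qed.

Lemma put_value_le (r delta K T t x C : R) : 0 <= C ->
  (forall tau, stopping_time_le P X (T - t) tau ->
    (\int[P]_w (expR (- r * tau w) * Num.max (K - price X r delta x (tau w) w) 0)%:E
      <= C%:E)%E) ->
  put_value P X r delta K T t x <= C.
Proof.
move=> C0 H; rewrite /put_value; set S := ereal_sup _.
have : (S <= C%:E)%E by apply: ge_ereal_sup => _ [tau st <-]; exact: H.
(* Infinite suprema are sent to [0] by [fine], which is where [0 <= C] enters. *)
by case: S => [y||]//=; rewrite lee_fin.
Qed.

Lemma put_value_ge (r delta K T t x : R) (tau : Omega -> R) :
  0 < K -> 0 <= r -> 0 <= x -> stopping_time_le P X (T - t) tau ->
  (\int[P]_w (expR (- r * tau w) * Num.max (K - price X r delta x (tau w) w) 0)%:E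
    <= (put_value P X r delta K T t x)%:E)%E.
Proof.
move=> K0 r0 x0 st; rewrite /put_value.
have pay tau' (st' : stopping_time_le P X (T - t) tau') w :
    0 <= expR (- r * tau' w) * Num.max (K - price X r delta x (tau' w) w) 0 <= K.
  by have /andP[t0 _] := st'.1 w; apply: discounted_payoff_bounds => //; exact: ltW.
set S := ereal_sup _; set I := (\int[P]_w _)%E.
(* The supremum has to be finite, otherwise [fine] would return [0] and the lower bound could
   fail. *)
have SK : (S <= K%:E)%E.
  apply: ge_ereal_sup => _ [tau' st' <-].
  apply: integral_le_simple => [w|h mh hf]; first by have /andP[] := pay _ st' w.
  apply: (@le_trans _ _ (\int[P]_w (cst K%:E w))%E).
    apply: ge0_le_integral => //.
    - by move=> w _; rewrite lee_fin; have /andP[] := hf w.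
    - exact/measurable_EFinP.
    move=> w _; rewrite lee_fin; have /andP[_ h1] := hf w.
    by have /andP[_] := pay _ st' w; exact: le_trans.
  rewrite integral_cst//; have PT : (P : set Omega -> \bar R) setT = 1%E by exact: probability_setT.
  by rewrite [X in (_ * X)%E]PT mule1.
have IS : (I <= S)%E by apply: ereal_sup_ubound; exists tau.
have I0 : (0 <= I)%E.
  by apply: integral_ge0 => w _; rewrite lee_fin; have /andP[] := pay _ st w.
rewrite fineK// fin_numElt (lt_le_trans (ltNyr 0) (le_trans I0 IS))/=.
exact: le_lt_trans SK (ltry K).
Qed.

End american_put.

Section critical_price.
Context (R : realType) d (Omega : measurableType d) (P : probability Omega R).
Context (nu : {sigma_finite_measure set R -> \bar R}).
Variables (X : R -> Omega -> R) (gamma r delta K T : R).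
Hypothesis levX : is_levy_process P X 0 gamma nu.
Hypothesis fin1 :
  (\int[nu]_(x in [set x : R | (`|x| <= 1)%R]) (`|x|)%R%:E < +oo)%E.
Hypothesis exp_fin : (\int[nu]_(x in [set x : R | (1 <= `|x|)%R]) (expR x)%:E < +oo)%E.
Hypothesis martingale :
  (gamma%:E + \int[nu]_x (expR x - 1 - x * (if `|x| <= 1 then 1 else 0))%R%:E = 0)%E.
Hypothesis K0 : 0 < K.
Hypothesis r0 : 0 < r.
Hypothesis d_gt : (0 < d_plus nu r delta)%E.

Let I := \int[nu]_y put_payoff y.

Let levn : levy_measure nu. Proof. by case: levX. Qed.
Let mX t : measurable_fun setT (X t). Proof. by case: levX => [_ []]. Qed.
Let indX : indep_increments P X. Proof. by case: levX => [_ [_ [_ [_ []]]]]. Qed.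
Let X0 : {ae P, forall w, X 0 w = 0}. Proof. by case: levX => [_ [_ []]]. Qed.
Let cadX : {ae P, forall w, cadlag (fun t => X t w)}.
Proof. by case: levX => [_ [_ [_ []]]]. Qed.
Let Id : I < r - delta - \int[nu]_x (expR x - 1).
Proof. exact: d_plus_fv. Qed.
Let I0 : 0 <= I. Proof. by apply: Rintegral_ge0 => y _; exact: put_payoff_ge0. Qed.

Lemma european_put_gt (lam : R) : 0 < lam -> lam < I ->
  exists2 s0 : R, 0 < s0 & forall s : R, 0 < s -> s < s0 ->
  ((K - K / (1 + lam * s))%:E <
   \int[P]_w (expR (- r * s) *
     Num.max (K - price X r delta (K / (1 + lam * s)) s w) 0)%:E)%E.
Proof.
move=> lam0 lamI.
have e0 : 0 < (I - lam) / 2 by rewrite divr_gt0// subr_gt0.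
have kd : \int[nu]_x (expR x - 1) <= r - delta by move: Id I0; lra.
have [h0 h00 H] := small_put_increment levX fin1 exp_fin martingale kd e0.
set e := (I - lam) / 2 in e0 H.
have eI : I - e = lam + e by rewrite /e; lra.
clearbody e; have le0 : 0 < lam + e by rewrite addr_gt0.
(* Discounting costs at most the factor [1 - r s]; the second bound on [s] says that
   [(1 - r s) (lam + e) > lam], with [lam + e = I - e]. *)
exists (Num.min h0 (e / (r * (lam + e)))).
  by rewrite lt_min h00 divr_gt0// mulr_gt0.
move=> s s0; rewrite lt_min => /andP[sh0].
rewrite ltr_pdivlMr ?mulr_gt0// => se.
have := H 0 s (lexx 0) s0 sh0; rewrite ler_norml => /andP[+ _]; rewrite -/I add0r => Hle.
have ls0 : 0 < 1 + lam * s by rewrite addr_gt0// mulr_gt0.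
set x := K / (1 + lam * s).
have x0 : 0 < x by rewrite divr_gt0.
have Kx : K = x * (1 + lam * s) by rewrite /x divfK// gt_eqF.
clearbody x.
pose W w := (r - delta) * s + X s w.
have mW : measurable_fun setT W by exact: measurable_funD.
have mp : measurable_fun setT (fun w => put_payoff (W w)).
  exact: (measurableT_comp (bounded_lip_measurable (@bounded_lip_put R))).
have ip : P.-integrable setT (EFin \o (fun w => put_payoff (W w))).
  apply: (@integrable_bounded _ _ _ _ _ 1) => // w; rewrite ger0_norm ?put_payoff_ge0//.
  by rewrite (le_trans (put_payoff_le _))// ge_min lexx.
have EW : \int[P]_w put_payoff ((r - delta) * s + (X s w - X 0 w)) = \int[P]_w put_payoff (W w).
  apply: ae_eq_Rintegral => //.
    apply: (measurableT_comp (bounded_lip_measurable (@bounded_lip_put R))).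
    by apply: measurable_funD => //; exact: measurable_funB.
  by apply: filterS X0 => w; rewrite /W => ->; rewrite subr0.
rewrite EW in Hle.
pose f w := expR (- r * s) * Num.max (K - price X r delta x s w) 0.
have mf : measurable_fun setT f.
  apply: measurable_funM => //; apply: measurable_maxr => //; apply: measurable_funB => //.
  by apply: measurable_funM => //; apply: (measurableT_comp (@measurable_expR R)).
have if_ : P.-integrable setT (EFin \o f).
  apply: (@integrable_bounded _ _ _ _ _ K) => // w.
  have /andP[f0 fK] := @discounted_payoff_bounds _ _ X r delta K x s w (ltW K0) (ltW r0) (ltW x0) (ltW s0).
  by rewrite ger0_norm.
have ig : P.-integrable setT (EFin \o (fun w => expR (- r * s) * x * put_payoff (W w))).
  exact: (integrableZl measurableT _ ip).
rewrite -[X in (_ < X)%E]fineK; last exact: (integrable_fin_num measurableT if_).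
rewrite lte_fin -/(Rintegral P setT f).
apply: (@lt_le_trans _ _ (\int[P]_w (expR (- r * s) * x * put_payoff (W w)))); last first.
  (* As [K >= x], the payoff is at least [x] times the put payoff of the growth factor at strike
     [1]. *)
  apply: le_Rintegral => // w _; rewrite /f -mulrA ler_wpM2l ?expR_ge0//.
  rewrite /put_payoff maxr_pMr ?(ltW x0)// mulr0 ge_max !le_max lexx orbT andbT.
  apply/orP; left; rewrite /price -/(W w) {1}Kx mulrBr mulr1 lerD2r mulrDr mulr1 lerDl.
  by rewrite mulr_ge0 ?(ltW x0)// mulr_ge0// ltW.
rewrite RintegralZl//.
have -> : K - x = x * (lam * s) by rewrite {1}Kx; ring.
rewrite -[ltRHS]mulrA [ltRHS]mulrCA ltr_pM2l//.
apply: (@lt_le_trans _ _ (expR (- r * s) * ((lam + e) * s))); last first.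
  by rewrite ler_wpM2l ?expR_ge0// -eI mulrBl; move: Hle; rewrite lerBrDl [s * I]mulrC.
rewrite mulrA ltr_pM2r//.
have := expR_ge1Dx (- r * s) => E1.
apply: lt_le_trans (ler_wpM2r (ltW le0) E1).
by move: se; lra.
Qed.

Lemma critical_price_bounds (lam lam' : R) : 0 < lam -> lam < I -> I < lam' ->
  lam' <= r - delta - \int[nu]_x (expR x - 1) ->
  \forall t \near T^'-, lam <= (K / critical_price P X r delta K T t - 1) / (T - t) <= lam'.
Proof.
move=> lam0 lamI Ilam' lamd.
have [s0 s00 Hlow] := european_put_gt lam0 lamI.
pose mu := (I + lam') / 2.
have Imu : I < mu by rewrite /mu; lra.
have mulam : mu < lam' by rewrite /mu; lra.
have mu0 : 0 < mu by move: I0; lra.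
have mud : mu <= r - delta - \int[nu]_x (expR x - 1) by lra.
clearbody mu.
have mean := step_mean_le0 levX fin1 exp_fin martingale Imu mud.
have l0' : 0 < lam' by lra.
(* The intermediate slope [mu] gives room to pass from [K / (1 + lam' s)] to [K (1 - mu s)]: this
   needs [mu (1 + lam' s) < lam'], which is the second bound on [s]. *)
pose s1 := Num.min s0 ((lam' - mu) / (mu * lam')).
have lm0 : 0 < lam' - mu by rewrite subr_gt0.
have s10 : 0 < s1 by rewrite lt_min s00 divr_gt0// mulr_gt0.
near=> t.
have tT : t < T by near: t; exact: nbhs_left_lt.
have ts1 : T - t < s1.
  have : T - s1 < t by near: t; apply: nbhs_left_gt; rewrite ltrBlDr ltrDl.
  lra.
set s := T - t in ts1 *.
have sp : 0 < s by rewrite subr_gt0.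
move: ts1; rewrite lt_min => /andP[ss0]; rewrite ltr_pdivlMr ?mulr_gt0// => ss1.
set E := [set x | 0 <= x /\ Num.max (K - x) 0 < put_value P X r delta K T t x].
have l1 : 0 < 1 + lam * s by rewrite addr_gt0// mulr_gt0.
have l1' : 0 < 1 + lam' * s by rewrite addr_gt0// mulr_gt0.
have Elow : E (K / (1 + lam * s)).
  have x0 : 0 < K / (1 + lam * s) by rewrite divr_gt0.
  split; first exact: ltW.
  have xK : K / (1 + lam * s) <= K by rewrite ler_pdivrMr// ler_peMr ?(ltW K0)// lerDl mulr_ge0// ltW.
  rewrite max_l ?subr_ge0// -lte_fin; apply: (lt_le_trans (Hlow s sp ss0)).
  exact: (put_value_ge delta K0 (ltW r0) (ltW x0) (stopping_time_cst P X (ltW sp))).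
have Eup x : E x -> K / (1 + lam' * s) <= x.
  move=> [x0 vx]; rewrite leNgt; apply/negP => xlt.
  have Kx : K * (mu * s) < K - x.
    have xlt' : x * (1 + lam' * s) < K by rewrite -ltr_pdivlMr.
    rewrite -(ltr_pM2r l1') [ltRHS]mulrBl.
    have : K * (mu * s) * (1 + lam' * s) < K * (lam' * s).
      by rewrite -mulrA ltr_pM2l// mulrAC ltr_pM2r//; move: ss1; lra.
    lra.
  have xK : 0 <= K - x by apply: ltW; apply: le_lt_trans Kx; rewrite mulr_ge0 ?(ltW K0)// mulr_ge0// ltW.
  move: vx; rewrite ltNge => /negP; apply; rewrite max_l//.
  apply: put_value_le => // tau st.
  exact: (stopped_put_le mX indX X0 cadX K0 mu0 sp x0 (ltW r0) Kx mean st).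
have b1 : critical_price P X r delta K T t <= K / (1 + lam * s).
  by apply: ge_inf => //; exists 0 => y [].
have b2 : K / (1 + lam' * s) <= critical_price P X r delta K T t.
  (* Nonemptiness, witnessed by the point of the lower bound, is essential: the infimum of the empty
     set is [0] by convention. *)
  by apply: lb_le_inf; [exists (K / (1 + lam * s))|].
move: b1 b2; set b := critical_price _ _ _ _ _ _ _ => b1 b2.
have b0 : 0 < b by apply: lt_le_trans b2; rewrite divr_gt0.
rewrite ler_pdivlMr// ler_pdivrMr// lerBrDr lerBlDr [_ + 1]addrC [_ + 1]addrC.
rewrite ler_pdivlMr// ler_pdivrMr//.
rewrite ler_pdivlMr// in b1; rewrite ler_pdivrMr// in b2.
by rewrite ![_ * b]mulrC b1 b2.
Unshelve. all: by end_near. Qed.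

Lemma critical_price_cvg : 0 < I ->
  (fun t => ((K / critical_price P X r delta K T t - 1) / (T - t))%:E) @ T^'- --> I%:E.
Proof.
move=> Ip; apply: cvg_EFin; first by near=> t.
apply/cvgrPdist_le => e e0.
(* The maximum keeps [lam] positive, and the minimum below keeps [lam'] under the drift [d]; this is
   where [0 < I < d] is used. *)
pose lam := Num.max (I / 2) (I - e).
pose lam' := Num.min (r - delta - \int[nu]_x (expR x - 1)) (I + e).
have l1 : 0 < lam by rewrite lt_max divr_gt0.
have l2 : lam < I by rewrite gt_max; apply/andP; split; lra.
have l3 : I < lam' by rewrite lt_min Id ltrDl.
have l4 : lam' <= r - delta - \int[nu]_x (expR x - 1) by rewrite ge_min lexx.
have l5 : I - e <= lam by rewrite le_max lexx orbT.
have l6 : lam' <= I + e by rewrite ge_min lexx orbT.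
apply: filterS (critical_price_bounds l1 l2 l3 l4) => t /andP[h1 h2] /=.
by rewrite ler_norml; apply/andP; split; lra.
Unshelve. all: by end_near. Qed.

End critical_price.

Theorem theorem5p2 (R : realType) (d : measure_display) (Omega : measurableType d)
  (P : probability Omega R) (X : R -> Omega -> R)
  (sigma gamma : R) (nu : {measure set R -> \bar R})
  (T K r delta : R) :
  0 < T -> 0 < K -> 0 < r -> 0 <= delta ->
  is_levy_process P X sigma gamma nu ->
  (\int[nu]_(x in [set x : R | (1 <= `|x|)%R]) (expR x)%:E < +oo)%E ->
  ((sigma ^+ 2 / 2)%:E + gamma%:E +
    \int[nu]_x (expR x - 1 - x * (if `|x| <= 1 then 1 else 0))%R%:E = 0)%E ->
  (sigma != 0 \/ (0 < nu `]-oo, 0%R[%classic)%E \/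
     (\int[nu]_(x in `]0%R, +oo[%classic) (Num.min x 1)%:E = +oo)%E) ->
  sigma = 0 ->
  (\int[nu]_(x in [set x : R | (`|x| <= 1)%R]) (`|x|)%R%:E < +oo)%E ->
  (0 < d_plus nu r delta)%E ->
  (fun t => ((K / critical_price P X r delta K T t - 1) / (T - t))%:E) @ T^'-
    --> (\int[nu]_y (Num.max (- (expR y - 1)) 0)%:E)%E.
Proof.
move=> _ K0 r0 _ levX exp_fin drift nondeg sigma0 fin1 d_gt; subst sigma.
have levn : levy_measure nu by case: levX.
have sf := sigma_finite_fv levn.1 (levy_fv levn fin1).
have [nu' nuE] := measure_sigma_finiteE sf; subst nu.
rewrite put_payoff_integralE//.
apply: (critical_price_cvg (gamma := gamma)) => //.
  by rewrite -[RHS]drift expr0n/= mul0r add0e.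
(* Non-degeneracy reduces to negative jumps: [sigma] is zero, and finite variation makes the
   integral of [min x 1] over the positive jumps finite. *)
apply: put_payoff_integral_gt0 => //.
case: nondeg => [|[//|inf]]; first by rewrite eqxx.
by have := fv_small_jumps_fin levn fin1; rewrite inf ltxx.
Qed.
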